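(* Let $0<\alpha<1$. Then the operator norm of the Hilbert matrix operator $\mathcal{H}$ from $H^\infty_{\alpha,\log}$ into $H^\infty_\alpha$ is $$\|\mathcal{H}\|_{H^\infty_{\alpha,\log}\rightarrow H^\infty_\alpha}=\sup_{0\leq r<1}\int_{0}^{1}\frac{(1+r)^\alpha\left((t-1)r+1\right)^{2\alpha-1}}{(1-t)^\alpha\left((t-1)r+1+t\right)^\alpha\log\frac{2e^{1/\alpha}}{1-\left(\frac{t}{1-(1-t)r}\right)^2}}\,dt,$$ and $$\|\mathcal{H}\|_{H^\infty_{\alpha,\log}\rightarrow H^\infty_\alpha}\geq\int_{0}^{1}\frac{1}{(1-t^2)^\alpha\log\frac{2e^{1/\alpha}}{1-t^2}}\,dt.$$
   Context: $\mathbb{D}$ is the open unit disk in $\mathbb{C}$ and $H(\mathbb{D})$ is the set of analytic functions on $\mathbb{D}$; $\log$ is the natural logarithm. For $0<\alpha<1$, the Korenblum space $H^\infty_\alpha$ is the space of all $f\in H(\mathbb{D})$ with $\|f\|_{H^\infty_\alpha}=\sup_{z\in\mathbb{D}}(1-|z|^2)^\alpha|f(z)|<\infty$. The logarithmically weighted Korenblum space $H^\infty_{\alpha,\log}$ is the space of all $f\in H(\mathbb{D})$ with $$\|f\|_{H^\infty_{\alpha,\log}}=\sup_{z\in\mathbb{D}}(1-|z|^2)^\alpha\log\frac{2e^{1/\alpha}}{1-|z|^2}\,|f(z)|<\infty.$$ The Hilbert matrix operator $\mathcal{H}$ acts on $f(z)=\sum_{k\ge 0}a_kz^k\in H(\mathbb{D})$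 by $$\mathcal{H}f(z)=\sum_{n=0}^\infty\left(\sum_{k=0}^\infty\frac{a_k}{n+k+1}\right)z^n,$$ whenever the right-hand side makes sense and defines an analytic function in $\mathbb{D}$. For normed spaces $X,Y$ of analytic functions, $\|\mathcal{H}\|_{X\to Y}=\sup\{\|\mathcal{H}f\|_Y:\ f\in X,\ \|f\|_X\le 1\}$. *)

(* Defs.v *)
From Stdlib Require Import Reals.
From Coquelicot Require Import Coquelicot.

Open Scope R_scope.

(* A function on the open unit disk is represented by a total map [C -> C]
   whose values outside the disk are irrelevant.
   [ex_derive] over [C_AbsRing] is complex differentiability. *)
Definition analytic_disk (f : C -> C) : Prop :=
  forall z : C, Cmod z < 1 -> ex_derive (K := C_AbsRing) (V := C_NormedModule) f z.

Definition log_factor (alpha x : R) : R := ln (2 * exp (1 / alpha) / x).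

Definition korenblum_norm (alpha : R) (f : C -> C) : Rbar :=
  Lub_Rbar (fun y : R => exists z : C, Cmod z < 1 /\
    y = Rpower (1 - Cmod z ^ 2) alpha * Cmod (f z)).

Definition korenblum_log_norm (alpha : R) (f : C -> C) : Rbar :=
  Lub_Rbar (fun y : R => exists z : C, Cmod z < 1 /\
    y = Rpower (1 - Cmod z ^ 2) alpha * log_factor alpha (1 - Cmod z ^ 2)
        * Cmod (f z)).

(* The space of analytic functions with finite norm [N]. *)
Definition in_space (N : (C -> C) -> Rbar) (f : C -> C) : Prop :=
  analytic_disk f /\ Rbar_lt (N f) p_infty.

Definition taylor_series_disk (a : nat -> C) (f : C -> C) : Prop :=
  forall z : C, Cmod z < 1 ->
    is_pseries (K := C_AbsRing) (V := C_NormedModule) a z (f z).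

(* [hilbert_image f g]: all the series defining the image of [f] under the
   Hilbert matrix operator converge, and that image is the function [g],
   analytic on the disk. The inner series need not converge absolutely. *)
Definition hilbert_image (f g : C -> C) : Prop :=
  exists a b : nat -> C,
    taylor_series_disk a f /\
    (forall n : nat,
       is_series (K := C_AbsRing) (V := C_NormedModule)
         (fun k : nat => (a k / RtoC (INR (n + k + 1)))%C) (b n)) /\
    taylor_series_disk b g /\
    analytic_disk g.

(* Every element of the domain space has an image, lying in the target space. *)
Definition maps_into (T : (C -> C) -> (C -> C) -> Prop)
    (NX NY : (C -> C) -> Rbar) : Prop :=
  forall f : C -> C, in_space NX f -> exists g : C -> C, T f g /\ in_space NY g.

Definition operator_norm (T : (C -> C) -> (C -> C) -> Prop)
    (NX NY : (C -> C) -> Rbar) : Rbar :=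
  Rbar_lub (fun y : Rbar => exists f g : C -> C,
    in_space NX f /\ Rbar_le (NX f) 1 /\ T f g /\ y = NY g).

Definition norm_integrand (alpha r t : R) : R :=
  Rpower (1 + r) alpha * Rpower ((t - 1) * r + 1) (2 * alpha - 1)
  / (Rpower (1 - t) alpha * Rpower ((t - 1) * r + 1 + t) alpha
     * log_factor alpha (1 - (t / (1 - (1 - t) * r)) ^ 2)).

Definition lower_integrand (alpha t : R) : R :=
  1 / (Rpower (1 - t ^ 2) alpha * log_factor alpha (1 - t ^ 2)).

(* The integrands above are in general unbounded as [t] tends to 1 from the
   left, so integrals over (0,1) are improper Riemann integrals at 1. *)
Definition ex_int01 (h : R -> R) : Prop :=
  ex_RInt_gen h (at_point 0) (at_left 1).

Definition int01 (h : R -> R) : R :=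
  RInt_gen h (at_point 0) (at_left 1).

(* Main.v *)
(* The coefficients of the image are moments, b_n = int_0^1 t^n f(t) dt, so
   H f(z) = int_0^1 f(t) / (1 - t z) dt.  With F(t) = 1 / ((1-t^2)^alpha log(...)) one
   gets |H f(z)| <= ||f|| int_0^1 F(t) / (1 - t |z|) dt directly, because
   |1 - t z| >= 1 - t |z|; the change of variable t -> t / (1 - (1-t) r) turns the
   weighted right-hand side into the integral of the theorem.  It is attained by
   f_0(z) = 1 / ((1-z^2)^alpha log(2 e^(1/alpha) / (1-z^2))), which equals F on [0,1)
   and has norm at most 1 because s^alpha log(2 e^(1/alpha) / s) increases on (0,2].
   The lower bound is the case r = 0.

   The series sum_k a_k / (n+k+1) need not converge absolutely when alpha >= 1/2.  It
   converges by summation by parts, since the partial sums of the a_k are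
   O(N^alpha log N): they are the means of f(zeta) (zeta^-0 + ... + zeta^-N) over a
   circle of radius 1 - 1/N, and the Dirichlet-type kernel has L^1 norm O(log N). *)

Require Import Defs.
From Stdlib Require Import Reals Lra Lia Psatz ClassicalEpsilon.
From Coquelicot Require Import Coquelicot.

Open Scope R_scope.

(** * Complex derivative, exponential and logarithm *)

(** Elements of the domain space are only assumed complex differentiable, so the Taylor expansion
    has to be earned: Goursat's theorem on rectangles, carried to annuli by the exponential, makes
    circle integrals independent of the radius. The same circle integrals represent the partial sums
    of the a_k.

    Since the series for b_n converges only conditionally, its sum is tied to the moment by Abel's
    theorem, as a limit of integrals over [0,x]. Summation over n and integration up to 1 are never
    exchanged: estimates are made for N terms and x < 1, x tends to 1 for fixed N, and N tends to
    infinity last. The truncated geometric sum costs a factor 1 + |z|^N in the upper bound and 1 -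
    |z|^N in the lower one, which the last limit removes.

    The constant 2 e^(1/alpha) is the one for which the derivative of s^alpha log(2 e^(1/alpha) / s)
    is alpha s^(alpha-1) log(2/s): its sign changes exactly at s = 2, the supremum of |1 - z^2| over
    the disk. *)

Definition cdiff (f : C -> C) (z l : C) : Prop :=
  forall eps, 0 < eps -> exists d, 0 < d /\ forall w, Cmod (w - z) < d ->
    Cmod (f w - f z - l * (w - z)) <= eps * Cmod (w - z).

(* [C_NormedModule] and the ring [C_AbsRing] seen as a module over itself carry
   different uniform structures; the rules for [is_derive] need the latter. *)
Ltac cdiff_unfold f z l :=
  split;
  [ intros H; split; [apply is_linear_scal_l|];
    intros x Hx eps;
    assert (E : z = x) by exact (is_filter_lim_locally_unique (V := AbsRing_NormedModule C_AbsRing) z x Hx);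
    subst x;
    destruct (H eps (cond_pos eps)) as (d & Hd & Hw);
    exists (mkposreal d Hd); intros y Hy;
    specialize (Hw y Hy);
    change (Cmod (f y - f z - (y - z) * l) <= eps * Cmod (y - z));
    rewrite (Cmult_comm (y - z) l); exact Hw
  | intros [_ H] eps Heps;
    destruct (H z (fun P HP => HP) (mkposreal eps Heps)) as (d & Hd);
    exists d; split; [apply cond_pos|]; intros w Hw;
    specialize (Hd w Hw); simpl in Hd;
    change (Cmod (f w - f z - (w - z) * l) <= eps * Cmod (w - z)) in Hd;
    rewrite (Cmult_comm l); exact Hd ].

Lemma cdiff_is_derive (f : C -> C) (z l : C) :
  cdiff f z l <-> is_derive (K := C_AbsRing) (V := C_NormedModule) f z l.
Proof. cdiff_unfold f z l. Qed.

Lemma cdiff_is_derive_ring (f : C -> C) (z l : C) :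
  cdiff f z l <-> is_derive (K := C_AbsRing) (V := AbsRing_NormedModule C_AbsRing) f z l.
Proof. cdiff_unfold f z l. Qed.

Lemma cdiff_comp (f g : C -> C) (z df dg : C) :
  cdiff f (g z) df -> cdiff g z dg -> cdiff (fun w => f (g w)) z (dg * df).
Proof.
  intros Hf Hg. apply cdiff_is_derive_ring.
  exact (is_derive_comp (K := C_AbsRing) (V := AbsRing_NormedModule C_AbsRing) f g z df dg
    (proj1 (cdiff_is_derive_ring _ _ _) Hf) (proj1 (cdiff_is_derive_ring _ _ _) Hg)).
Qed.

Lemma cdiff_mult (f g : C -> C) (z df dg : C) :
  cdiff f z df -> cdiff g z dg -> cdiff (fun w => f w * g w)%C z (df * g z + f z * dg)%C.
Proof.
  intros Hf Hg. apply cdiff_is_derive_ring.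
  exact (is_derive_mult (K := C_AbsRing) f g z df dg
    (proj1 (cdiff_is_derive_ring _ _ _) Hf) (proj1 (cdiff_is_derive_ring _ _ _) Hg) Cmult_comm).
Qed.

Lemma cdiff_const (c z : C) : cdiff (fun _ => c) z 0.
Proof.
  intros eps Heps. exists 1. split; [lra|]. intros w _.
  replace (c - c - 0 * (w - z))%C with (RtoC 0) by ring.
  rewrite Cmod_0. apply Rmult_le_pos; [lra | apply Cmod_ge_0].
Qed.

Lemma cdiff_id (z : C) : cdiff (fun w => w) z 1.
Proof.
  intros eps Heps. exists 1. split; [lra|]. intros w _.
  replace (w - z - 1 * (w - z))%C with (RtoC 0) by ring.
  rewrite Cmod_0. apply Rmult_le_pos; [lra | apply Cmod_ge_0].
Qed.

Lemma cdiff_scal (c : C) (f : C -> C) (z df : C) :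
  cdiff f z df -> cdiff (fun w => c * f w)%C z (c * df)%C.
Proof.
  intros Hf. replace (c * df)%C with (0 * f z + c * df)%C by ring.
  exact (cdiff_mult (fun _ => c) f z 0 df (cdiff_const c z) Hf).
Qed.

Lemma cdiff_minus (f g : C -> C) (z df dg : C) :
  cdiff f z df -> cdiff g z dg -> cdiff (fun w => f w - g w)%C z (df - dg)%C.
Proof.
  intros Hf Hg. apply cdiff_is_derive_ring.
  exact (is_derive_minus (K := C_AbsRing) (V := AbsRing_NormedModule C_AbsRing) f g z df dg
    (proj1 (cdiff_is_derive_ring _ _ _) Hf) (proj1 (cdiff_is_derive_ring _ _ _) Hg)).
Qed.

Lemma cdiff_pow (f : C -> C) (z df : C) (n : nat) :
  cdiff f z df -> exists l, cdiff (fun w => f w ^ n)%C z l.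
Proof.
  intros Hf. induction n as [|n [l Hl]].
  - exists (RtoC 0). exact (cdiff_const 1 z).
  - eexists. exact (cdiff_mult _ _ _ _ _ Hf Hl).
Qed.

Lemma cdiff_ext_loc (f g : C -> C) (z l : C) (d : R) :
  0 < d -> (forall w, Cmod (w - z) < d -> f w = g w) -> cdiff f z l -> cdiff g z l.
Proof.
  intros Hd He Hf eps Heps. destruct (Hf eps Heps) as (e & He0 & H).
  exists (Rmin d e). split; [apply Rmin_pos; assumption|]. intros w Hw.
  rewrite <- !He.
  - apply H. apply Rlt_le_trans with (1 := Hw), Rmin_r.
  - replace (z - z)%C with (RtoC 0) by ring. rewrite Cmod_0. exact Hd.
  - apply Rlt_le_trans with (1 := Hw), Rmin_l.
Qed.

Lemma Cmod_minus_sym (a b : C) : Cmod (a - b) = Cmod (b - a).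
Proof. rewrite <- Cmod_opp. f_equal. ring. Qed.

Lemma Cmod_triangle_rev (a b : C) : Cmod a - Cmod b <= Cmod (a - b).
Proof.
  pose proof (Cmod_triangle (a - b) b) as H.
  replace (a - b + b)%C with a in H by ring. lra.
Qed.

Lemma Cmod_lipschitz (a b : C) : Rabs (Cmod a - Cmod b) <= Cmod (a - b).
Proof.
  apply Rabs_le. pose proof (Cmod_triangle_rev a b).
  pose proof (Cmod_triangle_rev b a) as H0. rewrite Cmod_minus_sym in H0. lra.
Qed.

Lemma cdiff_continuity (f : C -> C) (z l : C) :
  cdiff f z l -> forall eps, 0 < eps -> exists d, 0 < d /\
    forall w, Cmod (w - z) < d -> Cmod (f w - f z) < eps.
Proof.
  intros H eps Heps. destruct (H 1 Rlt_0_1) as (d & Hd & Hw).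
  pose proof (Cmod_ge_0 l) as Hl.
  exists (Rmin d (eps / (2 + Cmod l))). split.
  - apply Rmin_pos; [exact Hd|]. apply Rdiv_lt_0_compat; lra.
  - intros w H0.
    assert (H1 : Cmod (w - z) < d) by (apply Rlt_le_trans with (1 := H0), Rmin_l).
    assert (H2 : Cmod (w - z) < eps / (2 + Cmod l)) by (apply Rlt_le_trans with (1 := H0), Rmin_r).
    specialize (Hw w H1).
    replace (f w - f z)%C with ((f w - f z - l * (w - z)) + l * (w - z))%C by ring.
    eapply Rle_lt_trans; [apply Cmod_triangle|]. rewrite Cmod_mult.
    apply Rmult_lt_compat_r with (r := 2 + Cmod l) in H2; [|lra].
    unfold Rdiv in H2. rewrite Rmult_assoc, Rinv_l, Rmult_1_r in H2 by lra.
    pose proof (Cmod_ge_0 (w - z)). nra.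
Qed.

Lemma cdiff_inv (f : C -> C) (z l : C) :
  cdiff f z l -> f z <> 0%C -> exists l', cdiff (fun w => / f w)%C z l'.
Proof.
  intros Hf Hz.
  assert (Hm : 0 < Cmod (f z)) by (apply Cmod_gt_0; exact Hz).
  assert (Hi : exists m, cdiff Cinv (f z) m).
  { exists (- / (f z * f z))%C. intros eps Heps.
    set (a := f z) in *. set (A := Cmod a) in *.
    (* The first radius keeps |w| above A/2; the second absorbs the exact error (w - a)^2 / (w
       a^2). *)
    exists (Rmin (A / 2) (eps * A * A * A / 2)). split.
    { apply Rmin_pos; [lra|]. assert (0 < eps * A * A * A) by (repeat apply Rmult_lt_0_compat; auto). lra. }
    intros w Hw.
    assert (H1 : Cmod (w - a) < A / 2) by (apply Rlt_le_trans with (1 := Hw), Rmin_l).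
    assert (H2 : Cmod (w - a) < eps * A * A * A / 2) by (apply Rlt_le_trans with (1 := Hw), Rmin_r).
    assert (H3 : A / 2 < Cmod w).
    { pose proof (Cmod_triangle_rev a w) as H. rewrite Cmod_minus_sym in H. fold A in H. lra. }
    assert (Hw0 : w <> 0%C) by (apply Cmod_gt_0; lra).
    replace (/ w - / a - - / (a * a) * (w - a))%C with ((w - a) * (w - a) / (w * (a * a)))%C
      by (field; split; assumption).
    rewrite Cmod_div, !Cmod_mult by (repeat apply Cmult_neq_0; assumption).
    fold A. set (u := Cmod (w - a)) in *. assert (Hu : 0 <= u) by apply Cmod_ge_0.
    apply Rle_div_l; [repeat apply Rmult_lt_0_compat; lra|].
    assert (u <= eps * (Cmod w * (A * A))).
    { apply Rle_trans with (eps * (A / 2 * (A * A))); [lra|].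
      apply Rmult_le_compat_l; [lra|]. apply Rmult_le_compat_r; nra. }
    nra. }
  destruct Hi as [m Hi]. eexists. exact (cdiff_comp Cinv f z m l Hi Hf).
Qed.

Lemma cdiff_div (f g : C -> C) (z df dg : C) :
  cdiff f z df -> cdiff g z dg -> g z <> 0%C -> exists l, cdiff (fun w => f w / g w)%C z l.
Proof.
  intros Hf Hg Hz. destruct (cdiff_inv g z dg Hg Hz) as [m Hm].
  eexists. exact (cdiff_mult _ _ _ _ _ Hf Hm).
Qed.

Lemma analytic_disk_cdiff (f : C -> C) :
  analytic_disk f <-> forall z, Cmod z < 1 -> exists l, cdiff f z l.
Proof.
  split; intros H z Hz; destruct (H z Hz) as [l Hl]; exists l; apply cdiff_is_derive; exact Hl.
Qed.

Definition cexp (z : C) : C := (exp (fst z) * cos (snd z), exp (fst z) * sin (snd z)).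

Lemma cexp_plus (z w : C) : cexp (z + w) = (cexp z * cexp w)%C.
Proof.
  unfold cexp, Cmult, Cplus; simpl. rewrite exp_plus, cos_plus, sin_plus. f_equal; ring.
Qed.

Lemma Cmod_cexp (z : C) : Cmod (cexp z) = exp (fst z).
Proof.
  unfold Cmod, cexp; simpl fst; simpl snd.
  replace ((exp (fst z) * cos (snd z)) ^ 2 + (exp (fst z) * sin (snd z)) ^ 2)
    with (Rsqr (exp (fst z))).
  - apply sqrt_Rsqr. left. apply exp_pos.
  - pose proof (sin2_cos2 (snd z)) as H. unfold Rsqr in *.
    transitivity (exp (fst z) * exp (fst z) * (sin (snd z) * sin (snd z) + cos (snd z) * cos (snd z))).
    + rewrite H; ring.
    + ring.
Qed.

Lemma cexp_neq_0 (z : C) : cexp z <> 0%C.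
Proof. apply Cmod_gt_0. rewrite Cmod_cexp. apply exp_pos. Qed.

Lemma cexp_0 : cexp 0 = 1%C.
Proof. unfold cexp; simpl. rewrite exp_0, cos_0, sin_0. apply injective_projections; simpl; ring. Qed.

Lemma is_derive_eps (f : R -> R) (x l : R) :
  is_derive f x l -> forall eps, 0 < eps -> exists d, 0 < d /\
    forall y, Rabs (y - x) < d -> Rabs (f y - f x - l * (y - x)) <= eps * Rabs (y - x).
Proof.
  intros [_ H] eps Heps.
  destruct (H x (fun P HP => HP) (mkposreal eps Heps)) as (d & Hd).
  exists d. split; [apply cond_pos|]. intros w Hw.
  specialize (Hd w Hw). simpl in Hd.
  change (Rabs (f w - f x - (w - x) * l) <= eps * Rabs (w - x)) in Hd.
  rewrite (Rmult_comm l). exact Hd.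
Qed.

Lemma Rabs_fst_Cmod (z : C) : Rabs (fst z) <= Cmod z.
Proof. eapply Rle_trans; [apply Rmax_l | apply Rmax_Cmod]. Qed.

Lemma Rabs_snd_Cmod (z : C) : Rabs (snd z) <= Cmod z.
Proof. eapply Rle_trans; [apply Rmax_r | apply Rmax_Cmod]. Qed.

Lemma Cmod_le_Rabs (z : C) : Cmod z <= Rabs (fst z) + Rabs (snd z).
Proof.
  destruct z as [x y]. replace ((x, y) : C) with (RtoC x + RtoC y * Ci)%C
    by (apply injective_projections; simpl; ring).
  eapply Rle_trans; [apply Cmod_triangle|].
  rewrite Cmod_mult, Cmod_Ci, !Cmod_R. simpl.
  right. f_equal; [f_equal; ring|]. rewrite Rmult_1_r. f_equal; ring.
Qed.

Lemma cdiff_cexp_0 : cdiff cexp 0 1.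
Proof.
  intros eps Heps.
  destruct (is_derive_eps exp 0 1) with (eps := Rmin 1 (eps / 8)) as (d1 & Hd1 & H1).
  { rewrite <- exp_0 at 1. apply is_derive_exp. }
  { apply Rmin_pos; lra. }
  destruct (is_derive_eps cos 0 0) with (eps := eps / 16) as (d2 & Hd2 & H2).
  { replace 0 with (- sin 0) at 2 by (rewrite sin_0; ring). apply is_derive_cos. }
  { lra. }
  destruct (is_derive_eps sin 0 1) with (eps := Rmin 1 (eps / 8)) as (d3 & Hd3 & H3).
  { rewrite <- cos_0 at 1. apply is_derive_sin. }
  { apply Rmin_pos; lra. }
  (* With m = |w|, the radius 1/2 keeps exp x <= 2, and eps/32 brings the quadratic term (exp x - 1)
     sin y, at most 4 m^2, below eps m / 8. Each of the four error terms is then at most eps m /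
     8. *)
  exists (Rmin (Rmin d1 d2) (Rmin d3 (Rmin (1/2) (eps / 32)))). split.
  { repeat apply Rmin_pos; lra. }
  intros w Hw. rewrite cexp_0.
  replace (w - 0)%C with w in * by ring.
  assert (Hb : Cmod w < d1 /\ Cmod w < d2 /\ Cmod w < d3 /\ Cmod w < 1/2 /\ Cmod w < eps / 32).
  { repeat (apply Rmin_Rgt_l in Hw as [? ?] || (match goal with H : Rmin _ _ > _ |- _ => apply Rmin_Rgt_l in H as [? ?] end)). lra. }
  destruct Hb as (B1 & B2 & B3 & B4 & B5).
  pose proof (Rabs_fst_Cmod w) as Hx. pose proof (Rabs_snd_Cmod w) as Hy.
  destruct w as [x y]. simpl fst in *. simpl snd in *. set (m := Cmod (x, y)) in *.
  specialize (H1 x). specialize (H2 y). specialize (H3 y).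
  rewrite exp_0 in H1. rewrite cos_0 in H2. rewrite sin_0 in H3.
  replace (x - 0) with x in H1 by ring. replace (y - 0) with y in H2, H3 by ring.
  specialize (H1 ltac:(lra)). specialize (H2 ltac:(lra)). specialize (H3 ltac:(lra)).
  replace (cos y - 1 - 0 * y) with (cos y - 1) in H2 by ring.
  rewrite Rmult_1_l in H1, H3. replace (sin y - 0 - y) with (sin y - y) in H3 by ring.
  pose proof (Rabs_pos x). pose proof (Rabs_pos y).
  assert (E1 : Rabs (exp x - 1 - x) <= eps / 8 * m).
  { eapply Rle_trans; [exact H1|]. pose proof (Rmin_r 1 (eps/8)). apply Rmult_le_compat; try lra. apply Rmin_glb; lra. }
  assert (E2 : Rabs (exp x - 1) <= 2 * m).
  { replace (exp x - 1) with ((exp x - 1 - x) + x) by ring.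
    eapply Rle_trans; [apply Rabs_triang|].
    pose proof (Rmin_l 1 (eps/8)). nra. }
  assert (E3 : Rabs (sin y - y) <= eps / 8 * m).
  { eapply Rle_trans; [exact H3|]. pose proof (Rmin_r 1 (eps/8)). apply Rmult_le_compat; try lra. apply Rmin_glb; lra. }
  assert (E4 : Rabs (sin y) <= 2 * m).
  { replace (sin y) with ((sin y - y) + y) by ring.
    eapply Rle_trans; [apply Rabs_triang|].
    pose proof (Rmin_l 1 (eps/8)). nra. }
  assert (E5 : Rabs (cos y - 1) <= eps / 16 * m) by nra.
  assert (E6 : Rabs (exp x) <= 2).
  { replace (exp x) with ((exp x - 1) + 1) by ring.
    eapply Rle_trans; [apply Rabs_triang|]. rewrite Rabs_R1. lra. }
  eapply Rle_trans; [apply Cmod_le_Rabs|]. unfold cexp; simpl.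
  replace (exp x * cos y + - (1) + - (1 * x - 0 * y)) with ((exp x - 1 - x) + exp x * (cos y - 1)) by ring.
  replace (exp x * sin y + - 0 + - (1 * y + 0 * x)) with ((exp x - 1) * sin y + (sin y - y)) by ring.
  pose proof (Rabs_triang (exp x - 1 - x) (exp x * (cos y - 1))) as T1.
  pose proof (Rabs_triang ((exp x - 1) * sin y) (sin y - y)) as T2.
  rewrite Rabs_mult in T1, T2.
  assert (M1 : Rabs (exp x) * Rabs (cos y - 1) <= 2 * (eps / 16 * m)).
  { apply Rmult_le_compat; auto using Rabs_pos. }
  assert (M2 : Rabs (exp x - 1) * Rabs (sin y) <= (2 * m) * (2 * m)).
  { apply Rmult_le_compat; auto using Rabs_pos. }
  assert (0 <= m) by apply Cmod_ge_0. nra.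
Qed.

(** The functional equation cexp w = cexp z cexp (w - z) carries the derivative at 0 to every
    point. *)
Lemma cdiff_cexp (z : C) : cdiff cexp z (cexp z).
Proof.
  assert (H : cdiff (fun w => cexp z * cexp (w - z))%C z (cexp z * ((1 - 0) * 1))%C).
  { apply cdiff_scal. apply (cdiff_comp cexp (fun w => w - z)%C).
    - replace (z - z)%C with (RtoC 0) by ring. apply cdiff_cexp_0.
    - apply cdiff_minus; [apply cdiff_id | apply cdiff_const]. }
  replace (cexp z * ((1 - 0) * 1))%C with (cexp z) in H by ring.
  apply (cdiff_ext_loc _ _ _ _ 1 Rlt_0_1) with (2 := H).
  intros w _. rewrite <- cexp_plus. f_equal. ring.
Qed.

(* The principal branch, meaningful on the right half-plane. *)
Definition clog (w : C) : C := (ln (Cmod w), atan (snd w / fst w)).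

Lemma cexp_clog (w : C) : 0 < fst w -> cexp (clog w) = w.
Proof.
  intros Hx. destruct w as [x y]. simpl in Hx.
  assert (Hm : 0 < Cmod (x, y)).
  { pose proof (Rabs_fst_Cmod (x, y)). simpl in H. rewrite Rabs_pos_eq in H by lra. lra. }
  (* This root is the denominator in the closed forms of cos (atan u) and sin (atan u) at u =
     y/x. *)
  assert (E : sqrt (1 + (y / x)²) = Cmod (x, y) / x).
  { rewrite <- (sqrt_Rsqr (Cmod (x, y) / x)) by (left; apply Rdiv_lt_0_compat; assumption).
    f_equal. pose proof (Cmod2_alt (x, y)) as H. simpl in H.
    unfold Rsqr. field_simplify; [|lra|lra]. f_equal. simpl. rewrite H. ring. }
  unfold cexp, clog; simpl fst; simpl snd. rewrite exp_ln by exact Hm.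
  rewrite cos_atan, sin_atan, E.
  apply injective_projections; simpl; field; split; lra.
Qed.

Lemma clog_continuity (w0 : C) : 0 < fst w0 -> forall eps, 0 < eps -> exists d, 0 < d /\
  forall w, Cmod (w - w0) < d -> Cmod (clog w - clog w0) < eps.
Proof.
  intros Hx eps Heps.
  assert (Hm : 0 < Cmod w0).
  { pose proof (Rabs_fst_Cmod w0). rewrite Rabs_pos_eq in H by lra. lra. }
  assert (C1 : continuous (ln : R -> R) (Cmod w0)).
  { apply (ex_derive_continuous (K := R_AbsRing) (V := R_NormedModule)). exists (/ Cmod w0). apply is_derive_ln; exact Hm. }
  assert (C2 : continuous (fun w : C_UniformSpace => atan (snd w / fst w)) w0).
  { apply (continuous_comp (fun w : C_UniformSpace => snd w / fst w) atan).
    - apply (continuous_mult (K := R_AbsRing) (fun w : C_UniformSpace => snd w) (fun w : C_UniformSpace => / fst w)).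
      + destruct w0; apply continuous_snd.
      + apply (continuous_comp (fun w : C_UniformSpace => fst w) Rinv).
        * destruct w0; apply continuous_fst.
        * apply continuous_Rinv. lra.
    - apply (ex_derive_continuous (K := R_AbsRing) (V := R_NormedModule)). eexists. apply is_derive_atan. }
  assert (He2 : 0 < eps / 2) by lra.
  destruct (proj1 (filterlim_locally _ _) C1 (mkposreal _ He2)) as [d1 H1].
  destruct (proj1 (filterlim_locally _ _) C2 (mkposreal _ He2)) as [d2 H2].
  exists (Rmin d1 d2). split; [apply Rmin_pos; apply cond_pos|].
  intros w Hw.
  assert (B1 : Cmod (w - w0) < d1) by (apply Rlt_le_trans with (1 := Hw), Rmin_l).
  assert (B2 : Cmod (w - w0) < d2) by (apply Rlt_le_trans with (1 := Hw), Rmin_r).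
  eapply Rle_lt_trans; [apply Cmod_le_Rabs|]. unfold clog; simpl fst; simpl snd.
  assert (Rabs (ln (Cmod w) - ln (Cmod w0)) < eps / 2).
  { apply H1. change (Rabs (Cmod w - Cmod w0) < d1). eapply Rle_lt_trans; [apply Cmod_lipschitz | exact B1]. }
  assert (Rabs (atan (snd w / fst w) - atan (snd w0 / fst w0)) < eps / 2).
  { apply H2. apply C_NormedModule_mixin_compat1. exact B2. }
  unfold Rminus in *. lra.
Qed.

(** Inverse function rule: [cexp] has the nonzero derivative w0 at [clog w0], and [clog] is
    continuous, so its increment L satisfies w - w0 = w0 L up to an error eta |L|. *)
Lemma cdiff_clog (w0 : C) : 0 < fst w0 -> cdiff clog w0 (/ w0)%C.
Proof.
  intros Hx.
  assert (Hm : 0 < Cmod w0).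
  { pose proof (Rabs_fst_Cmod w0). rewrite Rabs_pos_eq in H by lra. lra. }
  assert (Hw0 : w0 <> 0%C) by (apply Cmod_gt_0; exact Hm).
  intros eps Heps. set (m := Cmod w0) in *.
  (* The bound m/2 lets eta |L| be absorbed, whence m |L| <= 2 |w - w0|; the other bound turns eta
     |L| / m into at most eps |w - w0|. *)
  set (eta := Rmin (m / 2) (eps * m * m / 2)).
  assert (Heta : 0 < eta).
  { apply Rmin_pos; [lra|]. assert (0 < eps * m * m) by (repeat apply Rmult_lt_0_compat; lra). lra. }
  pose proof (cdiff_cexp (clog w0)) as HE.
  destruct (HE eta Heta) as (d1 & Hd1 & H1).
  destruct (clog_continuity w0 Hx d1 Hd1) as (d2 & Hd2 & H2).
  exists (Rmin d2 (fst w0)). split; [apply Rmin_pos; assumption|].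
  intros w Hw.
  assert (B1 : Cmod (w - w0) < d2) by (apply Rlt_le_trans with (1 := Hw), Rmin_l).
  assert (B2 : Cmod (w - w0) < fst w0) by (apply Rlt_le_trans with (1 := Hw), Rmin_r).
  assert (Hwx : 0 < fst w).
  { pose proof (Rabs_fst_Cmod (w - w0)) as H. simpl in H.
    pose proof (Rle_abs (- (fst w + - fst w0))) as H'. rewrite Rabs_Ropp in H'. lra. }
  specialize (H1 (clog w) (H2 w B1)).
  rewrite !cexp_clog in H1 by assumption.
  set (L := (clog w - clog w0)%C) in *.
  assert (HL : m * Cmod L <= 2 * Cmod (w - w0)).
  { assert (T : m * Cmod L <= Cmod (w - w0) + eta * Cmod L).
    { unfold m. rewrite <- Cmod_mult.
      replace (w0 * L)%C with ((w - w0) - (w - w0 - w0 * L))%C by ring.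
      eapply Rle_trans; [apply Cmod_triangle|]. rewrite Cmod_opp. lra. }
    assert (eta <= m / 2) by apply Rmin_l. pose proof (Cmod_ge_0 L). nra. }
  replace (L - / w0 * (w - w0))%C with (- (w - w0 - w0 * L) / w0)%C by (field; exact Hw0).
  rewrite Cmod_div, Cmod_opp by exact Hw0. fold m.
  apply Rle_div_l; [exact Hm|].
  eapply Rle_trans; [exact H1|].
  assert (eta <= eps * m * m / 2) by apply Rmin_r.
  apply Rle_trans with (eps * m * m / 2 * Cmod L).
  - apply Rmult_le_compat_r; [apply Cmod_ge_0 | assumption].
  - assert (0 < eps * m) by (apply Rmult_lt_0_compat; lra). nra.
Qed.

(** * Goursat's theorem on rectangles *)

Notation CInt := (RInt (V := C_R_CompleteNormedModule)).
Notation is_CInt := (is_RInt (V := C_R_NormedModule)).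
Notation ccont := (continuous (T := R_UniformSpace) (U := C_UniformSpace)).

Lemma ccont_eps (g : R -> C) (t : R) :
  (forall eps, 0 < eps -> exists d, 0 < d /\
    forall s, Rabs (s - t) < d -> Cmod (g s - g t) < eps) -> ccont g t.
Proof.
  intros H. apply filterlim_locally. intros eps.
  destruct (H eps (cond_pos eps)) as (d & Hd & Hs).
  exists (mkposreal d Hd). intros s Hb. apply C_NormedModule_mixin_compat1. exact (Hs s Hb).
Qed.

Lemma ccont_inv (g : R -> C) (t : R) : ccont g t ->
  forall eps, 0 < eps -> exists d, 0 < d /\
    forall s, Rabs (s - t) < d -> Cmod (g s - g t) < eps.
Proof.
  intros H eps Heps. assert (He : 0 < eps / 2) by lra.
  destruct (proj1 (filterlim_locally _ _) H (mkposreal _ He)) as [d Hd].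
  exists d. split; [apply cond_pos|]. intros s Hs. specialize (Hd s Hs).
  eapply Rle_lt_trans; [apply Cmod_le_Rabs|].
  destruct Hd as [H1 H2].
  change (Rabs (fst (g s) - fst (g t)) < eps / 2) in H1.
  change (Rabs (snd (g s) - snd (g t)) < eps / 2) in H2.
  simpl. unfold Rminus in *. lra.
Qed.

Lemma ccont_pair (u v : R -> R) (t : R) :
  continuous u t -> continuous v t -> ccont (fun s : R => (u s, v s)) t.
Proof.
  intros Hu Hv. apply filterlim_locally. intros eps.
  generalize (filter_and _ _ (proj1 (filterlim_locally _ _) Hu eps) (proj1 (filterlim_locally _ _) Hv eps)).
  apply filter_imp. intros s [H1 H2]. split; assumption.
Qed.

Lemma ccont_cdiff (h : C -> C) (g : R -> C) (t : R) (l : C) :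
  cdiff h (g t) l -> ccont g t -> ccont (fun s : R => h (g s)) t.
Proof.
  intros Hh Hg. apply ccont_eps. intros eps Heps.
  destruct (cdiff_continuity h (g t) l Hh eps Heps) as (e & He & H1).
  destruct (ccont_inv g t Hg e He) as (d & Hd & H2).
  exists d. split; [exact Hd|]. intros s Hs. apply H1, H2, Hs.
Qed.

Lemma ccont_minus (g h : R -> C) (t : R) :
  ccont g t -> ccont h t -> ccont (fun s : R => g s - h s)%C t.
Proof. exact (continuous_minus (V := C_R_NormedModule) g h t). Qed.

Lemma ccont_plus (g h : R -> C) (t : R) :
  ccont g t -> ccont h t -> ccont (fun s : R => g s + h s)%C t.
Proof. exact (continuous_plus (V := C_R_NormedModule) g h t). Qed.

Lemma ccont_const (c : C) (t : R) : ccont (fun _ => c) t.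
Proof. apply continuous_const. Qed.

Lemma ccont_fst (g : R -> C) (t : R) : ccont g t -> continuous (fun s => fst (g s)) t.
Proof.
  intros H. apply (continuous_comp g (fst : C_UniformSpace -> R_UniformSpace)); [exact H|].
  destruct (g t). apply continuous_fst.
Qed.

Lemma ccont_snd (g : R -> C) (t : R) : ccont g t -> continuous (fun s => snd (g s)) t.
Proof.
  intros H. apply (continuous_comp g (snd : C_UniformSpace -> R_UniformSpace)); [exact H|].
  destruct (g t). apply continuous_snd.
Qed.

Lemma ccont_mult (g h : R -> C) (t : R) :
  ccont g t -> ccont h t -> ccont (fun s : R => g s * h s)%C t.
Proof.
  intros Hg Hh. unfold Cmult.
  pose proof (ccont_fst g t Hg). pose proof (ccont_snd g t Hg).
  pose proof (ccont_fst h t Hh). pose proof (ccont_snd h t Hh).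
  apply ccont_pair.
  - apply (continuous_minus (V := R_NormedModule)); apply (continuous_mult (K := R_AbsRing)); assumption.
  - apply (continuous_plus (V := R_NormedModule)); apply (continuous_mult (K := R_AbsRing)); assumption.
Qed.

Lemma norm_C_R (z : C) : norm (V := C_R_NormedModule) z = Cmod z.
Proof.
  change (sqrt (Rabs (fst z) ^ 2 + Rabs (snd z) ^ 2) = Cmod z). unfold Cmod.
  rewrite !pow2_abs. reflexivity.
Qed.

Lemma CInt_correct (g : R -> C) (a b : R) :
  (forall t, Rmin a b <= t <= Rmax a b -> ccont g t) -> is_CInt g a b (CInt g a b).
Proof.
  intros H. apply (RInt_correct (V := C_R_CompleteNormedModule)).
  apply (ex_RInt_continuous (V := C_R_CompleteNormedModule)). exact H.
Qed.

Lemma CInt_unique (g : R -> C) (a b : R) (l : C) : is_CInt g a b l -> CInt g a b = l.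
Proof. exact (is_RInt_unique (V := C_R_CompleteNormedModule) g a b l). Qed.

Lemma is_CInt_plus (g h : R -> C) (a b : R) (lg lh : C) :
  is_CInt g a b lg -> is_CInt h a b lh -> is_CInt (fun t => g t + h t)%C a b (lg + lh)%C.
Proof. exact (is_RInt_plus (V := C_R_NormedModule) g h a b lg lh). Qed.

Lemma is_CInt_minus (g h : R -> C) (a b : R) (lg lh : C) :
  is_CInt g a b lg -> is_CInt h a b lh -> is_CInt (fun t => g t - h t)%C a b (lg - lh)%C.
Proof. exact (is_RInt_minus (V := C_R_NormedModule) g h a b lg lh). Qed.

Lemma is_CInt_const (a b : R) (c : C) : is_CInt (fun _ => c) a b (RtoC (b - a) * c)%C.
Proof. rewrite <- scal_R_Cmult. exact (is_RInt_const (V := C_R_NormedModule) a b c). Qed.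

Lemma is_CInt_fst (g : R -> C) (a b : R) (l : C) :
  is_CInt g a b l -> is_RInt (fun t => fst (g t)) a b (fst l).
Proof. exact (is_RInt_fct_extend_fst (U := R_NormedModule) (V := R_NormedModule) g a b l). Qed.

Lemma is_CInt_snd (g : R -> C) (a b : R) (l : C) :
  is_CInt g a b l -> is_RInt (fun t => snd (g t)) a b (snd l).
Proof. exact (is_RInt_fct_extend_snd (U := R_NormedModule) (V := R_NormedModule) g a b l). Qed.

Lemma is_CInt_pair (g : R -> C) (a b : R) (l : C) :
  is_RInt (fun t => fst (g t)) a b (fst l) -> is_RInt (fun t => snd (g t)) a b (snd l) ->
  is_CInt g a b l.
Proof.
  destruct l as [l1 l2].
  exact (is_RInt_fct_extend_pair (U := R_NormedModule) (V := R_NormedModule) g a b l1 l2).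
Qed.

Lemma is_CInt_scal (c : C) (g : R -> C) (a b : R) (l : C) :
  is_CInt g a b l -> is_CInt (fun t => c * g t)%C a b (c * l)%C.
Proof.
  intros H. pose proof (is_CInt_fst _ _ _ _ H) as H1. pose proof (is_CInt_snd _ _ _ _ H) as H2.
  apply is_CInt_pair; simpl.
  - apply (is_RInt_minus (V := R_NormedModule)); apply (is_RInt_scal (V := R_NormedModule)); assumption.
  - apply (is_RInt_plus (V := R_NormedModule)); apply (is_RInt_scal (V := R_NormedModule)); assumption.
Qed.

Lemma is_CInt_ext (g h : R -> C) (a b : R) (l : C) :
  (forall t, Rmin a b < t < Rmax a b -> g t = h t) -> is_CInt g a b l -> is_CInt h a b l.
Proof. exact (is_RInt_ext (V := C_R_NormedModule) g h a b l). Qed.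

Lemma is_CInt_Chasles (g : R -> C) (a b c : R) (l1 l2 : C) :
  is_CInt g a b l1 -> is_CInt g b c l2 -> is_CInt g a c (l1 + l2)%C.
Proof. exact (is_RInt_Chasles (V := C_R_NormedModule) g a b c l1 l2). Qed.

Lemma is_CInt_bound (g : R -> C) (k : R -> R) (a b : R) (l : C) (K : R) : a <= b ->
  (forall t, a <= t <= b -> Cmod (g t) <= k t) ->
  is_CInt g a b l -> is_RInt k a b K -> Cmod l <= K.
Proof.
  intros Hab Hb Hg Hk. rewrite <- norm_C_R.
  apply (norm_RInt_le (V := C_R_NormedModule) g k a b l K Hab); try assumption.
  intros t Ht. rewrite norm_C_R. apply Hb, Ht.
Qed.

Lemma is_CInt_bound_const (g : R -> C) (a b M : R) (l : C) : a <= b ->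
  (forall t, a <= t <= b -> Cmod (g t) <= M) -> is_CInt g a b l -> Cmod l <= (b - a) * M.
Proof.
  intros Hab Hb Hg. apply (is_CInt_bound g (fun _ => M) a b l _ Hab Hb Hg).
  exact (is_RInt_const (V := R_NormedModule) a b M).
Qed.

Lemma CInt_near_const (g : R -> C) (a b M : R) (c : C) : a <= b ->
  (forall t, a <= t <= b -> ccont g t) ->
  (forall t, a <= t <= b -> Cmod (g t - c) <= M) ->
  Cmod (CInt g a b - RtoC (b - a) * c) <= (b - a) * M.
Proof.
  intros Hab Hc Hb. apply (is_CInt_bound_const (fun t => g t - c)%C a b M _ Hab Hb).
  apply is_CInt_minus; [|apply is_CInt_const].
  apply CInt_correct. rewrite Rmin_left, Rmax_right by exact Hab. exact Hc.
Qed.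

(* The contour integral of [h] along the boundary of [a,b] x [c,d], with opposite
   sides paired. *)
Definition rect_int (h : C -> C) (a b c d : R) : C :=
  (Ci * CInt (fun y => h (b, y) - h (a, y)) c d - CInt (fun x => h (x, d) - h (x, c)) a b)%C.

Definition cdiff_rect (h : C -> C) (a b c d : R) : Prop :=
  forall x y, a <= x <= b -> c <= y <= d -> exists l, cdiff h (x, y) l.

Lemma cdiff_rect_sub (h : C -> C) (a b c d a' b' c' d' : R) :
  a <= a' -> b' <= b -> c <= c' -> d' <= d -> cdiff_rect h a b c d -> cdiff_rect h a' b' c' d'.
Proof. intros ? ? ? ? H x y Hx Hy. apply H; lra. Qed.

Lemma ccont_horizontal (h : C -> C) (x y : R) : (exists l, cdiff h (x, y) l) -> ccont (fun s : R => h (s, y)) x.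
Proof.
  intros [l Hl]. apply (ccont_cdiff h (fun s => (s, y)) x l Hl).
  apply ccont_pair; [apply continuous_id | apply continuous_const].
Qed.

Lemma ccont_vertical (h : C -> C) (x y : R) : (exists l, cdiff h (x, y) l) -> ccont (fun s : R => h (x, s)) y.
Proof.
  intros [l Hl]. apply (ccont_cdiff h (fun s => (x, s)) y l Hl).
  apply ccont_pair; [apply continuous_const | apply continuous_id].
Qed.

Definition cont_vert (h : C -> C) (x c d : R) := forall y, c <= y <= d -> ccont (fun s : R => h (x, s)) y.
Definition cont_hor (h : C -> C) (a b y : R) := forall x, a <= x <= b -> ccont (fun s : R => h (s, y)) x.

(** Continuity is asked only along the sides and the cut, so that the splitting also applies to a
    rectangle whose interior contains a point where [h] is not differentiable. *)
Lemma rect_int_split_x (h : C -> C) (a m b c d : R) : a <= m <= b -> c <= d ->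
  cont_vert h a c d -> cont_vert h m c d -> cont_vert h b c d -> cont_hor h a b c -> cont_hor h a b d ->
  rect_int h a b c d = (rect_int h a m c d + rect_int h m b c d)%C.
Proof.
  intros Hm Hcd Va Vm Vb Hc Hd.
  assert (I1 : is_CInt (fun y => h (m, y) - h (a, y))%C c d (CInt (fun y => h (m, y) - h (a, y))%C c d)).
  { apply CInt_correct. rewrite Rmin_left, Rmax_right by lra. intros t Ht.
    apply ccont_minus; [apply Vm | apply Va]; exact Ht. }
  assert (I2 : is_CInt (fun y => h (b, y) - h (m, y))%C c d (CInt (fun y => h (b, y) - h (m, y))%C c d)).
  { apply CInt_correct. rewrite Rmin_left, Rmax_right by lra. intros t Ht.
    apply ccont_minus; [apply Vb | apply Vm]; exact Ht. }
  assert (J1 : is_CInt (fun x => h (x, d) - h (x, c))%C a m (CInt (fun x => h (x, d) - h (x, c))%C a m)).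
  { apply CInt_correct. rewrite Rmin_left, Rmax_right by lra. intros t Ht.
    apply ccont_minus; [apply Hd | apply Hc]; lra. }
  assert (J2 : is_CInt (fun x => h (x, d) - h (x, c))%C m b (CInt (fun x => h (x, d) - h (x, c))%C m b)).
  { apply CInt_correct. rewrite Rmin_left, Rmax_right by lra. intros t Ht.
    apply ccont_minus; [apply Hd | apply Hc]; lra. }
  unfold rect_int.
  rewrite (CInt_unique (fun y => h (b, y) - h (a, y))%C c d
    (CInt (fun y => h (m, y) - h (a, y))%C c d + CInt (fun y => h (b, y) - h (m, y))%C c d)%C).
  - rewrite (CInt_unique _ _ _ _ (is_CInt_Chasles _ _ _ _ _ _ J1 J2)). ring.
  - apply (is_CInt_ext (fun y => (h (m, y) - h (a, y)) + (h (b, y) - h (m, y)))%C).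
    + intros t _. ring.
    + apply is_CInt_plus; assumption.
Qed.

Lemma rect_int_split_y (h : C -> C) (a b c m d : R) : c <= m <= d -> a <= b ->
  cont_hor h a b c -> cont_hor h a b m -> cont_hor h a b d -> cont_vert h a c d -> cont_vert h b c d ->
  rect_int h a b c d = (rect_int h a b c m + rect_int h a b m d)%C.
Proof.
  intros Hm Hab Hc Hmm Hd Va Vb.
  assert (I1 : is_CInt (fun x => h (x, m) - h (x, c))%C a b (CInt (fun x => h (x, m) - h (x, c))%C a b)).
  { apply CInt_correct. rewrite Rmin_left, Rmax_right by lra. intros t Ht.
    apply ccont_minus; [apply Hmm | apply Hc]; exact Ht. }
  assert (I2 : is_CInt (fun x => h (x, d) - h (x, m))%C a b (CInt (fun x => h (x, d) - h (x, m))%C a b)).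
  { apply CInt_correct. rewrite Rmin_left, Rmax_right by lra. intros t Ht.
    apply ccont_minus; [apply Hd | apply Hmm]; exact Ht. }
  assert (J1 : is_CInt (fun y => h (b, y) - h (a, y))%C c m (CInt (fun y => h (b, y) - h (a, y))%C c m)).
  { apply CInt_correct. rewrite Rmin_left, Rmax_right by lra. intros t Ht.
    apply ccont_minus; [apply Vb | apply Va]; lra. }
  assert (J2 : is_CInt (fun y => h (b, y) - h (a, y))%C m d (CInt (fun y => h (b, y) - h (a, y))%C m d)).
  { apply CInt_correct. rewrite Rmin_left, Rmax_right by lra. intros t Ht.
    apply ccont_minus; [apply Vb | apply Va]; lra. }
  unfold rect_int.
  rewrite (CInt_unique (fun x => h (x, d) - h (x, c))%C a b
    (CInt (fun x => h (x, m) - h (x, c))%C a b + CInt (fun x => h (x, d) - h (x, m))%C a b)%C).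
  - rewrite (CInt_unique _ _ _ _ (is_CInt_Chasles _ _ _ _ _ _ J1 J2)). ring.
  - apply (is_CInt_ext (fun x => (h (x, m) - h (x, c)) + (h (x, d) - h (x, m)))%C).
    + intros t _. ring.
    + apply is_CInt_plus; assumption.
Qed.

Lemma cdiff_rect_vert (h : C -> C) (a b c d x : R) :
  cdiff_rect h a b c d -> a <= x <= b -> cont_vert h x c d.
Proof. intros H Hx y Hy. apply ccont_vertical, H; assumption. Qed.

Lemma cdiff_rect_hor (h : C -> C) (a b c d y : R) :
  cdiff_rect h a b c d -> c <= y <= d -> cont_hor h a b y.
Proof. intros H Hy x Hx. apply ccont_horizontal, H; assumption. Qed.

Lemma rect_int_quarters (h : C -> C) (p q r s m n : R) :
  p <= m <= q -> r <= n <= s -> cdiff_rect h p q r s ->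
  rect_int h p q r s =
    (rect_int h p m r n + rect_int h p m n s + (rect_int h m q r n + rect_int h m q n s))%C.
Proof.
  intros Hm Hn Hc.
  assert (H1 : cdiff_rect h p m r s) by (apply (cdiff_rect_sub h p q r s); [..|exact Hc]; lra).
  assert (H2 : cdiff_rect h m q r s) by (apply (cdiff_rect_sub h p q r s); [..|exact Hc]; lra).
  rewrite (rect_int_split_x h p m q r s), (rect_int_split_y h p m r n s),
    (rect_int_split_y h m q r n s); [reflexivity|..];
    lazymatch goal with
    | |- cont_vert _ ?x _ _ => apply (cdiff_rect_vert h p q r s x Hc); lra
    | |- cont_hor _ p m ?y => apply (cdiff_rect_hor h p m r s y H1); lra
    | |- cont_hor _ m q ?y => apply (cdiff_rect_hor h m q r s y H2); lra
    | |- cont_hor _ _ _ ?y => apply (cdiff_rect_hor h p q r s y Hc); lra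
    | |- _ => lra
    end.
Qed.

(** The affine approximation of [h] at (x,y) contributes nothing: the constants l (b - a) and l (d -
    c) i that it predicts for the paired sides cancel once integrated. What remains differs from
    them by at most 2 eps D, D being the semiperimeter, over a total length D. *)
Lemma rect_int_local (h : C -> C) (a b c d x y eps s : R) (l : C) :
  cdiff_rect h a b c d -> a <= x <= b -> c <= y <= d -> (b - a) + (d - c) < s ->
  (forall w, Cmod (w - (x, y)) < s -> Cmod (h w - h (x, y) - l * (w - (x, y))) <= eps * Cmod (w - (x, y))) ->
  0 < eps -> Cmod (rect_int h a b c d) <= 2 * eps * ((b - a) + (d - c)) ^ 2.
Proof.
  intros Hh Hx Hy Hs Hl Heps. set (D := (b - a) + (d - c)) in *.
  assert (Hr : forall u v, a <= u <= b -> c <= v <= d ->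
    Cmod (h (u, v) - h (x, y) - l * ((u, v) - (x, y))) <= eps * D).
  { intros u v Hu Hv.
    assert (Hd : Cmod ((u, v) - (x, y)) <= D).
    { eapply Rle_trans; [apply Cmod_le_Rabs|]. simpl. unfold D.
      apply Rplus_le_compat; apply Rabs_le; lra. }
    eapply Rle_trans; [apply Hl; lra|]. apply Rmult_le_compat_l; lra. }
  unfold rect_int.
  pose proof (CInt_near_const (fun v => h (b, v) - h (a, v))%C c d (2 * eps * D) (l * RtoC (b - a))%C) as E1.
  pose proof (CInt_near_const (fun u => h (u, d) - h (u, c))%C a b (2 * eps * D) (l * (RtoC (d - c) * Ci))%C) as E2.
  lapply E1; [clear E1; intro E1 | lra]. lapply E2; [clear E2; intro E2 | lra].
  lapply E1; [clear E1; intro E1 | intros t Ht; apply ccont_minus; eapply cdiff_rect_vert; eauto; lra].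
  lapply E2; [clear E2; intro E2 | intros t Ht; apply ccont_minus; eapply cdiff_rect_hor; eauto; lra].
  lapply E1; [clear E1; intro E1 |].
  2:{ intros t Ht.
      replace (h (b, t) - h (a, t) - l * RtoC (b - a))%C with
        ((h (b, t) - h (x, y) - l * ((b, t) - (x, y))) - (h (a, t) - h (x, y) - l * ((a, t) - (x, y))))%C.
      - unfold Cminus at 1. eapply Rle_trans; [apply Cmod_triangle|]. rewrite Cmod_opp.
        pose proof (Hr b t ltac:(lra) Ht). pose proof (Hr a t ltac:(lra) Ht). lra.
      - replace (RtoC (b - a)) with ((b, t) - (a, t))%C by (apply injective_projections; simpl; ring). ring. }
  lapply E2; [clear E2; intro E2 |].
  2:{ intros t Ht.
      replace (h (t, d) - h (t, c) - l * (RtoC (d - c) * Ci))%C with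
        ((h (t, d) - h (x, y) - l * ((t, d) - (x, y))) - (h (t, c) - h (x, y) - l * ((t, c) - (x, y))))%C.
      - unfold Cminus at 1. eapply Rle_trans; [apply Cmod_triangle|]. rewrite Cmod_opp.
        pose proof (Hr t d Ht ltac:(lra)). pose proof (Hr t c Ht ltac:(lra)). lra.
      - replace (RtoC (d - c) * Ci)%C with ((t, d) - (t, c))%C by (apply injective_projections; simpl; ring). ring. }
  set (A := CInt _ c d) in *. set (B := CInt _ a b) in *.
  replace (Ci * A - B)%C with
    (Ci * (A - RtoC (d - c) * (l * RtoC (b - a))) - (B - RtoC (b - a) * (l * (RtoC (d - c) * Ci))))%C by ring.
  unfold Cminus at 1. eapply Rle_trans; [apply Cmod_triangle|].
  rewrite Cmod_opp, Cmod_mult, Cmod_Ci, Rmult_1_l. unfold D in *. nra.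
Qed.

Lemma nested_intervals (u v : nat -> R) :
  (forall n, u n <= u (S n)) -> (forall n, v (S n) <= v n) -> (forall n, u n <= v n) ->
  exists x, forall n, u n <= x <= v n.
Proof.
  intros Hu Hv Huv.
  assert (Mu : forall n k, u n <= u (n + k)%nat).
  { intros n k. induction k as [|k IH]; [rewrite Nat.add_0_r; lra|].
    rewrite Nat.add_succ_r. specialize (Hu (n + k)%nat). lra. }
  assert (Mv : forall n k, v (n + k)%nat <= v n).
  { intros n k. induction k as [|k IH]; [rewrite Nat.add_0_r; lra|].
    rewrite Nat.add_succ_r. specialize (Hv (n + k)%nat). lra. }
  assert (H : forall n m, u n <= v m).
  { intros n m. specialize (Mu n m). specialize (Mv m n). specialize (Huv (n + m)%nat).
    rewrite (Nat.add_comm m n) in Mv. lra. }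
  destruct (completeness (fun r => exists n, r = u n)) as [x [Hub Hlub]].
  - exists (v 0%nat). intros r [n ->]. apply H.
  - exists (u 0%nat), 0%nat. reflexivity.
  - exists x. intros n. split; [apply Hub; exists n; reflexivity|].
    apply Hlub. intros r [k ->]. apply H.
Qed.

Lemma goursat_rectangle (h : C -> C) (a b c d : R) :
  a <= b -> c <= d -> cdiff_rect h a b c d -> rect_int h a b c d = 0%C.
Proof.
  intros Hab Hcd Hh.
  (* Bisection argument for the claim [Main]: being bad, i.e. violating the bound, is
     inherited by one of the four quarters, and a bad rectangle cannot be small near
     a point of differentiability. *)
  set (D0 := (b - a) + (d - c)). assert (HD0 : 0 <= D0) by (unfold D0; lra).
  assert (Main : forall eps, 0 < eps -> Cmod (rect_int h a b c d) <= 2 * eps * D0 ^ 2).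
  { intros eps Heps. apply Rnot_lt_le. intros Hbad.
    set (ra := fun Q : R * R * R * R => fst (fst (fst Q))).
    set (rb := fun Q : R * R * R * R => snd (fst (fst Q))).
    set (rc := fun Q : R * R * R * R => snd (fst Q)).
    set (rd := fun Q : R * R * R * R => snd Q).
    set (ok := fun Q => a <= ra Q /\ ra Q <= rb Q /\ rb Q <= b /\ c <= rc Q /\ rc Q <= rd Q /\ rd Q <= d).
    (* The threshold is quadratic in the semiperimeter, so halving the sides divides it by 4; four
       quarters within their thresholds would add up to a rectangle within its own. *)
    set (bad := fun Q => 2 * eps * ((rb Q - ra Q) + (rd Q - rc Q)) ^ 2 < Cmod (rect_int h (ra Q) (rb Q) (rc Q) (rd Q))).
    set (child := fun Q Q' => ra Q <= ra Q' /\ rb Q' <= rb Q /\ rc Q <= rc Q' /\ rd Q' <= rd Q /\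
       rb Q' - ra Q' = (rb Q - ra Q) / 2 /\ rd Q' - rc Q' = (rd Q - rc Q) / 2).
    (* The subset type carries the invariants, so that iterating a chosen successor preserves
       them. *)
    assert (Step : forall Q : {Q | ok Q /\ bad Q}, exists Q' : {Q | ok Q /\ bad Q}, child (proj1_sig Q) (proj1_sig Q')).
    { intros [[[[p q] r] s] [HQ HB]].
      unfold ok in HQ; simpl in HQ. unfold bad in HB; simpl in HB.
      unfold ra, rb, rc, rd in HQ, HB. simpl in HQ, HB.
      set (m := (p + q) / 2). set (n := (r + s) / 2).
      assert (Hm : p <= m <= q) by (unfold m; lra). assert (Hn : r <= n <= s) by (unfold n; lra).
      assert (Hc : cdiff_rect h p q r s) by (apply (cdiff_rect_sub h a b c d); [..|exact Hh]; lra).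
      pose proof (rect_int_quarters h p q r s m n Hm Hn Hc) as Hsplit.
      assert (Pick : exists Q', bad Q' /\ (Q' = (p, m, r, n) \/ Q' = (p, m, n, s) \/ Q' = (m, q, r, n) \/ Q' = (m, q, n, s))).
      { apply NNPP. intros Hno.
        assert (G : forall Q', (Q' = (p, m, r, n) \/ Q' = (p, m, n, s) \/ Q' = (m, q, r, n) \/ Q' = (m, q, n, s)) ->
          Cmod (rect_int h (ra Q') (rb Q') (rc Q') (rd Q')) <= 2 * eps * (((q - p) + (s - r)) / 2) ^ 2).
        { intros Q' HQ'. apply Rnot_lt_le. intros Hlt. apply Hno. exists Q'. split; [|exact HQ'].
          unfold bad. eapply Rle_lt_trans; [|exact Hlt]. right. f_equal. f_equal.
          destruct HQ' as [-> | [-> | [-> | ->]]]; unfold ra, rb, rc, rd, m, n; simpl; field. }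
        pose proof (G (p, m, r, n) ltac:(auto)) as G1. pose proof (G (p, m, n, s) ltac:(auto)) as G2.
        pose proof (G (m, q, r, n) ltac:(auto)) as G3. pose proof (G (m, q, n, s) ltac:(auto)) as G4.
        unfold ra, rb, rc, rd in G1, G2, G3, G4. simpl fst in *. simpl snd in *.
        rewrite Hsplit in HB.
        pose proof (Cmod_triangle (rect_int h p m r n + rect_int h p m n s) (rect_int h m q r n + rect_int h m q n s)) as T1.
        pose proof (Cmod_triangle (rect_int h p m r n) (rect_int h p m n s)) as T2.
        pose proof (Cmod_triangle (rect_int h m q r n) (rect_int h m q n s)) as T3.
        set (X := q - p + (s - r)) in *. replace (X * (X * 1)) with (4 * (X / 2) ^ 2) in HB by field. lra. }
      destruct Pick as (Q' & HB' & HQ').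
      assert (HO : ok Q').
      { unfold ok. destruct HQ' as [-> | [-> | [-> | ->]]]; unfold ra, rb, rc, rd; simpl; lra. }
      exists (exist _ Q' (conj HO HB')). unfold child; simpl.
      destruct HQ' as [-> | [-> | [-> | ->]]]; unfold ra, rb, rc, rd, m, n in *; simpl in *; lra. }
    set (next := fun Q => proj1_sig (constructive_indefinite_description _ (Step Q))).
    assert (Hnext : forall Q, child (proj1_sig Q) (proj1_sig (next Q))).
    { intros Q. exact (proj2_sig (constructive_indefinite_description _ (Step Q))). }
    assert (O0 : ok (a, b, c, d)) by (unfold ok, ra, rb, rc, rd; simpl; lra).
    assert (B0 : bad (a, b, c, d)) by exact Hbad.
    set (Q := fun n => proj1_sig (Nat.iter n next (exist (fun Q => ok Q /\ bad Q) (a, b, c, d) (conj O0 B0)))).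
    assert (QO : forall n, ok (Q n) /\ bad (Q n)).
    { intros n. exact (proj2_sig (Nat.iter n next (exist (fun Q => ok Q /\ bad Q) (a, b, c, d) (conj O0 B0)))). }
    assert (QC : forall n, child (Q n) (Q (S n))) by (intros n; apply Hnext).
    assert (QD : forall n, (rb (Q n) - ra (Q n)) + (rd (Q n) - rc (Q n)) = D0 * (/ 2) ^ n).
    { intros n. induction n as [|n IH].
      - unfold Q, D0, ra, rb, rc, rd; simpl. ring.
      - destruct (QC n) as (_ & _ & _ & _ & E1 & E2). rewrite E1, E2. simpl. lra. }
    clearbody Q.
    destruct (nested_intervals (fun n => ra (Q n)) (fun n => rb (Q n))) as [x Hx].
    1-3: intros n; try apply (QC n); apply (QO n).
    destruct (nested_intervals (fun n => rc (Q n)) (fun n => rd (Q n))) as [y Hy].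
    1-3: intros n; try apply (QC n); apply (QO n).
    assert (Hxy : a <= x <= b /\ c <= y <= d).
    { specialize (Hx 0%nat). specialize (Hy 0%nat). destruct (QO 0%nat) as [HO _]. unfold ok in HO. lra. }
    (* Differentiability is now used at the single common point of the nested rectangles; the N-th
       one lies in the neighbourhood where the affine approximation is good, which contradicts its
       being bad. *)
    destruct (Hh x y) as [l Hl]; [lra..|].
    destruct (Hl eps Heps) as (s & Hs & Hw).
    destruct (pow_lt_1_zero (/ 2) ltac:(rewrite Rabs_pos_eq; lra) (s / (D0 + 1))) as [N HN].
    { apply Rdiv_lt_0_compat; lra. }
    specialize (HN N (Nat.le_refl _)). rewrite Rabs_pos_eq in HN by (apply pow_le; lra).
    assert (HD : D0 * (/ 2) ^ N < s).
    { apply Rlt_div_r in HN; [|lra]. assert (0 < (/2) ^ N) by (apply pow_lt; lra). nra. }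
    destruct (QO N) as [HO HB]. unfold bad in HB. apply (Rlt_not_le _ _ HB).
    unfold ok in HO.
    apply (rect_int_local h _ _ _ _ x y eps s l); auto.
    - apply (cdiff_rect_sub h a b c d); [..|exact Hh]; lra.
    - rewrite QD. exact HD. }
  apply Cmod_eq_0. apply Rle_antisym; [|apply Cmod_ge_0].
  apply le_epsilon. intros e He. rewrite Rplus_0_l.
  assert (He' : 0 < e / (2 * D0 ^ 2 + 1)) by (apply Rdiv_lt_0_compat; [lra | nra]).
  eapply Rle_trans; [apply (Main _ He')|].
  apply Rmult_le_reg_r with (2 * D0 ^ 2 + 1); [nra|].
  replace (2 * (e / (2 * D0 ^ 2 + 1)) * D0 ^ 2 * (2 * D0 ^ 2 + 1)) with (e * (2 * D0 ^ 2)) by (field; nra).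
  nra.
Qed.

(** * Integrals along vertical lines *)

Lemma Cmod_eq_0_eps (z : C) (K : R) : (forall eps, 0 < eps -> Cmod z <= K * eps) -> z = 0%C.
Proof.
  intros H. apply Cmod_eq_0. apply Rle_antisym; [|apply Cmod_ge_0].
  apply le_epsilon. intros e He. rewrite Rplus_0_l.
  assert (HK : 0 < Rabs K + 1) by (pose proof (Rabs_pos K); lra).
  assert (He' : 0 < e / (Rabs K + 1)) by (apply Rdiv_lt_0_compat; lra).
  eapply Rle_trans; [apply (H _ He')|].
  apply Rmult_le_reg_r with (Rabs K + 1); [exact HK|].
  replace (K * (e / (Rabs K + 1)) * (Rabs K + 1)) with (K * e) by (field; lra).
  pose proof (Rle_abs K). nra.
Qed.

(** Periodicity makes the two horizontal sides cancel. *)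
Lemma rect_int_periodic (h : C -> C) (s1 s2 c d : R) : c <= d ->
  cont_vert h s1 c d -> cont_vert h s2 c d ->
  (forall x, s1 <= x <= s2 -> h (x, d) = h (x, c)) -> s1 <= s2 ->
  rect_int h s1 s2 c d = (Ci * (CInt (fun y => h (s2, y)) c d - CInt (fun y => h (s1, y)) c d))%C.
Proof.
  intros Hcd V1 V2 Hp Hs. unfold rect_int.
  assert (E : CInt (fun x => h (x, d) - h (x, c))%C s1 s2 = RtoC 0).
  { replace (RtoC 0) with (RtoC (s2 - s1) * 0)%C by ring. apply CInt_unique.
    apply (is_CInt_ext (fun _ => RtoC 0)); [|apply is_CInt_const].
    rewrite Rmin_left, Rmax_right by exact Hs. intros t Ht. rewrite Hp by lra. ring. }
  rewrite E.
  rewrite (CInt_unique _ _ _ _ (is_CInt_minus (fun y => h (s2, y)) (fun y => h (s1, y)) c d _ _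
     (CInt_correct _ _ _ ltac:(rewrite Rmin_left, Rmax_right by exact Hcd; exact V2))
     (CInt_correct _ _ _ ltac:(rewrite Rmin_left, Rmax_right by exact Hcd; exact V1)))).
  ring.
Qed.

Lemma Ci_mult_eq_0 (a b : C) : (Ci * (a - b))%C = 0%C -> a = b.
Proof.
  intros H. apply Ceq_minus.
  replace (a - b)%C with (/ Ci * (Ci * (a - b)))%C by (field; apply Ci_nz).
  rewrite H. ring.
Qed.

Lemma vertical_shift (h : C -> C) (s1 s2 c d : R) : s1 <= s2 -> c <= d ->
  cdiff_rect h s1 s2 c d -> (forall x, s1 <= x <= s2 -> h (x, d) = h (x, c)) ->
  CInt (fun y => h (s1, y)) c d = CInt (fun y => h (s2, y)) c d.
Proof.
  intros Hs Hcd Hh Hp. symmetry. apply Ci_mult_eq_0.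
  rewrite <- rect_int_periodic; try assumption.
  - apply goursat_rectangle; assumption.
  - apply (cdiff_rect_vert h s1 s2); [assumption | lra].
  - apply (cdiff_rect_vert h s1 s2); [assumption | lra].
Qed.

Lemma rect_int_bound (h : C -> C) (a b c d M : R) : a <= b -> c <= d ->
  cont_vert h a c d -> cont_vert h b c d -> cont_hor h a b c -> cont_hor h a b d ->
  (forall x y, a <= x <= b -> c <= y <= d -> Cmod (h (x, y)) <= M) ->
  Cmod (rect_int h a b c d) <= 2 * M * ((b - a) + (d - c)).
Proof.
  intros Hab Hcd Va Vb Hc Hd HM. unfold rect_int.
  unfold Cminus at 1. eapply Rle_trans; [apply Cmod_triangle|].
  rewrite Cmod_opp, Cmod_mult, Cmod_Ci, Rmult_1_l.
  assert (T : forall u v : C, Cmod u <= M -> Cmod v <= M -> Cmod (u - v) <= 2 * M).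
  { intros u v Hu Hv. unfold Cminus. eapply Rle_trans; [apply Cmod_triangle|]. rewrite Cmod_opp. lra. }
  assert (E1 : Cmod (CInt (fun y => h (b, y) - h (a, y))%C c d) <= (d - c) * (2 * M)).
  { apply (is_CInt_bound_const (fun y => h (b, y) - h (a, y))%C c d (2 * M)); [lra| |].
    - intros t Ht. apply T; apply HM; lra.
    - apply CInt_correct. rewrite Rmin_left, Rmax_right by lra. intros t Ht.
      apply ccont_minus; [apply Vb | apply Va]; exact Ht. }
  assert (E2 : Cmod (CInt (fun x => h (x, d) - h (x, c))%C a b) <= (b - a) * (2 * M)).
  { apply (is_CInt_bound_const (fun x => h (x, d) - h (x, c))%C a b (2 * M)); [lra| |].
    - intros t Ht. apply T; apply HM; lra.
    - apply CInt_correct. rewrite Rmin_left, Rmax_right by lra. intros t Ht.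
      apply ccont_minus; [apply Hd | apply Hc]; exact Ht. }
  lra.
Qed.

Ltac cont_side VV HH := lazymatch goal with
  | |- cont_vert _ _ _ _ => apply VV; lra
  | |- cont_hor _ _ _ _ => apply HH; lra
  | |- _ < _ => lra | |- _ <= _ => lra | |- _ /\ _ => lra
  end.

(* A point where [h] may fail to be differentiable contributes nothing as long as
   [h] is bounded near it: enclose it in a small square. *)
Lemma vertical_shift_pole (h : C -> C) (s1 s2 c d p q dist M : R) :
  s1 < p < s2 -> c < q < d ->
  (forall x y, s1 <= x <= s2 -> c <= y <= d -> (x, y) <> (p, q) -> exists l, cdiff h (x, y) l) ->
  0 < dist -> (forall w, Cmod (w - (p, q)) < dist -> Cmod (h w) <= M) ->
  (forall x, s1 <= x <= s2 -> h (x, d) = h (x, c)) ->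
  CInt (fun y => h (s1, y)) c d = CInt (fun y => h (s2, y)) c d.
Proof.
  intros Hp Hq Hh Hdist HM Hper. symmetry. apply Ci_mult_eq_0.
  assert (Hne : forall x y, x <> p \/ y <> q -> (x, y) <> (p, q)).
  { intros x y [Hx|Hy] E; injection E; intros; auto. }
  assert (VV : forall x, s1 <= x <= s2 -> x <> p -> forall c' d', c <= c' -> d' <= d -> cont_vert h x c' d').
  { intros x Hx Hxp c' d' Hc' Hd' y Hy. apply ccont_vertical, Hh; [lra|lra|]. apply Hne; auto. }
  assert (HH : forall y, c <= y <= d -> y <> q -> forall a b, s1 <= a -> b <= s2 -> cont_hor h a b y).
  { intros y Hy Hyq a b Ha Hb x Hx. apply ccont_horizontal, Hh; [lra|lra|]. apply Hne; auto. }
  rewrite <- rect_int_periodic; [| lra | apply VV; lra | apply VV; lra | exact Hper | lra].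
  apply (Cmod_eq_0_eps _ (8 * M)). intros eps0 Heps0.
  (* The square of half-side [eps] around (p,q) must lie inside the rectangle and inside the disk
     where [h] is bounded; its points are at distance at most 2 eps < dist from the centre. *)
  set (eps := Rmin eps0 (Rmin (Rmin (p - s1) (s2 - p) / 2) (Rmin (Rmin (q - c) (d - q) / 2) (dist / 3)))).
  assert (Heps : 0 < eps /\ eps <= eps0 /\ eps < p - s1 /\ eps < s2 - p /\ eps < q - c /\ eps < d - q /\ 2 * eps < dist).
  { assert (0 < Rmin (p - s1) (s2 - p)) by (apply Rmin_pos; lra).
    assert (0 < Rmin (q - c) (d - q)) by (apply Rmin_pos; lra).
    split. { unfold eps. repeat apply Rmin_pos; lra. }
    unfold eps.
    pose proof (Rmin_l eps0 (Rmin (Rmin (p - s1) (s2 - p) / 2) (Rmin (Rmin (q - c) (d - q) / 2) (dist / 3)))).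
    pose proof (Rmin_r eps0 (Rmin (Rmin (p - s1) (s2 - p) / 2) (Rmin (Rmin (q - c) (d - q) / 2) (dist / 3)))).
    pose proof (Rmin_l (Rmin (p - s1) (s2 - p) / 2) (Rmin (Rmin (q - c) (d - q) / 2) (dist / 3))).
    pose proof (Rmin_r (Rmin (p - s1) (s2 - p) / 2) (Rmin (Rmin (q - c) (d - q) / 2) (dist / 3))).
    pose proof (Rmin_l (Rmin (q - c) (d - q) / 2) (dist / 3)).
    pose proof (Rmin_r (Rmin (q - c) (d - q) / 2) (dist / 3)).
    pose proof (Rmin_l (p - s1) (s2 - p)). pose proof (Rmin_r (p - s1) (s2 - p)).
    pose proof (Rmin_l (q - c) (d - q)). pose proof (Rmin_r (q - c) (d - q)). lra. }
  clearbody eps. destruct Heps as (E0 & E1 & E2 & E3 & E4 & E5 & E6).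
  assert (Z : forall a b c' d', s1 <= a <= b -> b <= s2 -> c <= c' <= d' -> d' <= d ->
     (b < p \/ p < a \/ d' < q \/ q < c') -> rect_int h a b c' d' = 0%C).
  { intros a b c' d' ? ? ? ? Ho. apply goursat_rectangle; [lra|lra|].
    intros x y Hx Hy. apply Hh; [lra|lra|]. apply Hne.
    destruct Ho as [?|[?|[?|?]]]; [left|left|right|right]; lra. }
  (* Strips to the left and right, then below and above, are cut off. Each of them misses (p,q) and
     integrates to zero by [Z]; only the central square is left. *)
  rewrite (rect_int_split_x h s1 (p - eps) s2 c d) by cont_side VV HH.
  rewrite (rect_int_split_x h (p - eps) (p + eps) s2 c d) by cont_side VV HH.
  rewrite (rect_int_split_y h (p - eps) (p + eps) c (q - eps) d) by cont_side VV HH.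
  rewrite (rect_int_split_y h (p - eps) (p + eps) (q - eps) (q + eps) d) by cont_side VV HH.
  rewrite (Z s1 (p - eps)), (Z (p + eps) s2), (Z (p - eps) (p + eps) c (q - eps)), (Z (p - eps) (p + eps) (q + eps) d) by lra.
  match goal with |- Cmod ?e <= _ => replace e with (rect_int h (p - eps) (p + eps) (q - eps) (q + eps)) by ring end.
  (* The square contributes at most 2 M (2 eps + 2 eps), the origin of the factor 8 M. *)
  eapply Rle_trans.
  - apply (rect_int_bound h _ _ _ _ M); try cont_side VV HH.
    intros x y Hx Hy. apply HM. eapply Rle_lt_trans; [apply Cmod_le_Rabs|]. simpl.
    assert (Rabs (x + - p) <= eps) by (apply Rabs_le; lra).
    assert (Rabs (y + - q) <= eps) by (apply Rabs_le; lra). lra.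
  - assert (0 <= M).
    { eapply Rle_trans; [apply Cmod_ge_0|]. apply (HM (p, q)).
      replace ((p, q) - (p, q))%C with (RtoC 0) by ring. rewrite Cmod_0. exact Hdist. }
    nra.
Qed.

Lemma is_CInt_shift (g : R -> C) (v a b : R) (l : C) :
  is_CInt g (a + v) (b + v) l -> is_CInt (fun y => g (y + v)) a b l.
Proof.
  intros H.
  apply (is_CInt_ext (fun y => scal (V := C_R_NormedModule) 1 (g (1 * y + v)))).
  - intros t _. rewrite scal_R_Cmult. rewrite Rmult_1_l. ring.
  - apply (is_RInt_comp_lin (V := C_R_NormedModule)). rewrite !Rmult_1_l. exact H.
Qed.

Lemma CInt_period (g : R -> C) (P a b : R) :
  (forall t, ccont g t) -> (forall t, g (t + P) = g t) ->
  CInt g a (a + P) = CInt g b (b + P).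
Proof.
  intros Hc Hp.
  assert (I : forall u v, is_CInt g u v (CInt g u v)) by (intros; apply CInt_correct; intros; apply Hc).
  pose proof (is_CInt_Chasles g a (a + P) (b + P) _ _ (I _ _) (I _ _)) as H1.
  pose proof (is_CInt_Chasles g a b (b + P) _ _ (I _ _) (I _ _)) as H2.
  pose proof (is_CInt_shift g P a b _ (I (a + P) (b + P))) as H3.
  apply (is_CInt_ext _ g) in H3; [|intros; apply Hp].
  pose proof (CInt_unique _ _ _ _ H3) as E3.
  pose proof (CInt_unique _ _ _ _ H1) as E1. pose proof (CInt_unique _ _ _ _ H2) as E2.
  rewrite E1, E3 in E2.
  apply Ceq_minus.
  match type of E2 with ?l = ?r =>
    replace (CInt g a (a + P) - CInt g b (b + P))%C with (l - r)%C by (simpl; ring) end.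
  rewrite E2. ring.
Qed.

Lemma cexp_period (x y : R) : cexp (x, y + 2 * PI) = cexp (x, y).
Proof. unfold cexp; simpl. rewrite cos_plus, sin_plus, cos_2PI, sin_2PI. f_equal; ring. Qed.

Lemma polar_form (z : C) : z <> 0%C -> exists t, z = cexp (ln (Cmod z), t).
Proof.
  intros Hz. assert (Hm : 0 < Cmod z) by (apply Cmod_gt_0; exact Hz).
  set (c := fst z / Cmod z). set (s := snd z / Cmod z).
  assert (Hcs : s ^ 2 = 1 - c ^ 2).
  { pose proof (Cmod2_alt z) as H. unfold Re, Im in H. unfold c, s.
    apply Rmult_eq_reg_r with (Cmod z ^ 2); [|nra].
    field_simplify; [|lra|lra]. rewrite H. ring. }
  assert (Hc : -1 <= c <= 1) by nra.
  assert (Hsq : sqrt (1 - c ^ 2) = Rabs s) by (rewrite <- Hcs, <- (sqrt_Rsqr_abs s); f_equal; unfold Rsqr; ring).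
  destruct (Rle_or_lt 0 s) as [Hs|Hs].
  - exists (acos c). unfold cexp; simpl. rewrite exp_ln, cos_acos, sin_acos by assumption.
    rewrite Rsqr_pow2. rewrite Hsq, Rabs_pos_eq by exact Hs.
    destruct z as [x y]; unfold c, s; simpl fst; simpl snd; apply injective_projections; simpl fst; simpl snd; field; lra.
  - exists (- acos c). unfold cexp; simpl. rewrite exp_ln, cos_neg, sin_neg, cos_acos, sin_acos by assumption.
    rewrite Rsqr_pow2. rewrite Hsq, Rabs_left by exact Hs.
    destruct z as [x y]; unfold c, s; simpl fst; simpl snd; apply injective_projections; simpl fst; simpl snd; field; lra.
Qed.

(** Here cos (y - y') = 1, and cos is strictly decreasing on [0, PI]. In a strip of height 2 PI
    centred at an argument of z this leaves a single preimage of z. *)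
Lemma cexp_eq_imag (x y x' y' : R) : cexp (x, y) = cexp (x', y') -> Rabs (y - y') <= PI ->
  x = x' /\ y = y'.
Proof.
  intros E Hy.
  assert (Hx : x = x').
  { apply exp_inv. pose proof (f_equal Cmod E) as H. rewrite !Cmod_cexp in H. exact H. }
  split; [exact Hx|]. subst x'. unfold cexp in E; simpl in E. injection E as E1 E2.
  pose proof (exp_pos x) as He.
  apply Rmult_eq_reg_l in E1; [|lra]. apply Rmult_eq_reg_l in E2; [|lra].
  assert (Hc : cos (y - y') = 1).
  { rewrite cos_minus, E1, E2. pose proof (sin2_cos2 y'). unfold Rsqr in H. lra. }
  assert (Hpi := PI_RGT_0). apply Rabs_le_between in Hy.
  destruct (Req_dec (y - y') 0) as [H0|H0]; [lra|exfalso].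
  assert (Hlt : cos (Rabs (y - y')) < cos 0).
  { apply cos_decreasing_1; try lra.
    - apply Rabs_pos.
    - apply Rabs_le; lra.
    - apply Rabs_pos_lt; exact H0. }
  rewrite cos_0 in Hlt. unfold Rabs in Hlt. destruct (Rcase_abs (y - y')); [rewrite cos_neg in Hlt|]; lra.
Qed.

(** * Taylor expansion in the disk *)

(** Unlike [sum_n], which has n + 1 terms, this sum is empty at 0; the geometric formula with 1 -
    q^n and the inductions on the number of terms start from there. *)
Fixpoint csum (u : nat -> C) (n : nat) : C :=
  match n with O => 0 | S m => (csum u m + u m)%C end.

Lemma csum_ext (u v : nat -> C) (n : nat) :
  (forall k, (k < n)%nat -> u k = v k) -> csum u n = csum v n.
Proof.
  induction n as [|n IH]; intros H; [reflexivity|]. simpl. rewrite IH, H; auto with arith.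
Qed.

Lemma csum_scal (c : C) (u : nat -> C) (n : nat) : csum (fun k => c * u k)%C n = (c * csum u n)%C.
Proof. induction n as [|n IH]; simpl; [ring|]. rewrite IH. ring. Qed.

Lemma csum_geom (q : C) (n : nat) : ((1 - q) * csum (fun k => q ^ k) n)%C = (1 - q ^ n)%C.
Proof.
  induction n as [|n IH]; [simpl; ring|]. simpl csum. rewrite Cpow_S.
  transitivity ((1 - q) * csum (fun k => q ^ k) n + (1 - q) * q ^ n)%C; [ring|]. rewrite IH. ring.
Qed.

Lemma is_CInt_csum (g : nat -> R -> C) (l : nat -> C) (a b : R) (n : nat) :
  (forall k, is_CInt (g k) a b (l k)) -> is_CInt (fun t => csum (fun k => g k t) n) a b (csum l n).
Proof.
  intros H. induction n as [|n IH]; simpl.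
  - pose proof (is_CInt_const a b 0) as H0. rewrite Cmult_0_r in H0. exact H0.
  - apply is_CInt_plus; [exact IH | apply H].
Qed.

Lemma sum_n_csum (u : nat -> C) (n : nat) : sum_n (G := C_AbelianGroup) u n = csum u (S n).
Proof.
  induction n as [|n IH].
  - rewrite sum_O. simpl. ring.
  - rewrite sum_Sn, IH. reflexivity.
Qed.

Lemma is_cseries_eps (u : nat -> C) (l : C) :
  is_series (K := C_AbsRing) (V := C_NormedModule) u l <->
  (forall eps, 0 < eps -> exists N, forall n, (N <= n)%nat -> Cmod (csum u n - l) < eps).
Proof.
  split.
  - intros H eps Heps. assert (He : 0 < eps / 2) by lra.
    destruct (proj1 (filterlim_locally _ _) H (mkposreal _ He)) as [N HN].
    exists (S N). intros n Hn. destruct n as [|n]; [lia|].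
    specialize (HN n ltac:(lia)). destruct HN as [H1 H2].
    rewrite <- sum_n_csum. set (v := sum_n (G := C_AbelianGroup) u n).
    change (Rabs (fst v - fst l) < eps / 2) in H1.
    change (Rabs (snd v - snd l) < eps / 2) in H2.
    eapply Rle_lt_trans; [apply Cmod_le_Rabs|].
    change (Rabs (fst v - fst l) + Rabs (snd v - snd l) < eps). lra.
  - intros H. apply filterlim_locally. intros eps.
    destruct (H eps (cond_pos eps)) as [N HN]. exists N. intros n Hn.
    apply C_NormedModule_mixin_compat1.
    change (Cmod (sum_n (G := C_AbelianGroup) u n - l) < eps).
    rewrite sum_n_csum. apply HN. lia.
Qed.

Lemma pow_n_Cpow (z : C) (k : nat) : pow_n (K := C_Ring) z k = (z ^ k)%C.
Proof. induction k as [|k IH]; [reflexivity|]. rewrite Cpow_S, <- IH. reflexivity. Qed.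

Lemma is_cpseries_eps (a : nat -> C) (z l : C) :
  is_pseries (K := C_AbsRing) (V := C_NormedModule) a z l <->
  (forall eps, 0 < eps -> exists N, forall n, (N <= n)%nat ->
     Cmod (csum (fun k => a k * z ^ k)%C n - l) < eps).
Proof.
  unfold is_pseries. rewrite is_cseries_eps.
  assert (E : forall n, csum (fun k => scal (K := C_Ring) (V := C_NormedModule) (pow_n (K := C_Ring) z k) (a k)) n
     = csum (fun k => a k * z ^ k)%C n).
  { intros n. apply csum_ext. intros k _.
    change (pow_n (K := C_Ring) z k * a k = a k * z ^ k)%C. rewrite pow_n_Cpow. ring. }
  split; intros H eps Heps; destruct (H eps Heps) as [N HN]; exists N; intros n Hn;
    specialize (HN n Hn); [rewrite <- E | rewrite E]; exact HN.
Qed.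

(* In the coordinate [w = s + i y] the circle of radius [exp s] is a vertical segment
   and annuli are rectangles, so Goursat's theorem compares circles. *)
Definition circle_coef (f : C -> C) (s : R) (k : nat) : C :=
  CInt (fun y => f (cexp (s, y)) * / cexp (s, y) ^ k)%C (- PI) PI.

Lemma Cmod_cexp_lt_1 (w : C) : fst w < 0 -> Cmod (cexp w) < 1.
Proof. intros H. rewrite Cmod_cexp, <- exp_0. apply exp_increasing, H. Qed.

Lemma cdiff_cexp_kernel (f : C -> C) (k : nat) (w : C) : analytic_disk f -> fst w < 0 ->
  exists l, cdiff (fun w => f (cexp w) * / cexp w ^ k)%C w l.
Proof.
  intros Hf Hw.
  destruct (proj1 (analytic_disk_cdiff f) Hf (cexp w) (Cmod_cexp_lt_1 w Hw)) as [l Hl].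
  destruct (cdiff_pow cexp w _ k (cdiff_cexp w)) as [m Hm].
  apply (cdiff_div (fun w => f (cexp w)) (fun w => cexp w ^ k)%C w _ _
    (cdiff_comp f cexp w l _ Hl (cdiff_cexp w)) Hm).
  apply Cpow_nz, cexp_neq_0.
Qed.

Lemma cexp_mPI (x : R) : cexp (x, PI) = cexp (x, - PI).
Proof. rewrite <- (cexp_period x (- PI)). do 2 f_equal. ring. Qed.

Lemma circle_coef_indep (f : C -> C) (s1 s2 : R) (k : nat) : analytic_disk f -> s1 < 0 -> s2 < 0 ->
  circle_coef f s1 k = circle_coef f s2 k.
Proof.
  intros Hf H1 H2.
  assert (W : forall s1 s2, s1 <= s2 -> s2 < 0 -> circle_coef f s1 k = circle_coef f s2 k).
  { intros u v Huv Hv. unfold circle_coef. pose proof PI_RGT_0.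
    apply (vertical_shift (fun w => f (cexp w) * / cexp w ^ k)%C u v (- PI) PI Huv).
    - lra.
    - intros x y Hx _. apply cdiff_cexp_kernel; [exact Hf | simpl; lra].
    - intros x _. rewrite cexp_mPI. reflexivity. }
  destruct (Rle_or_lt s1 s2); [|symmetry]; apply W; lra.
Qed.

Lemma ccont_circle (f : C -> C) (s y : R) (k : nat) : analytic_disk f -> s < 0 ->
  ccont (fun y : R => f (cexp (s, y)) * / cexp (s, y) ^ k)%C y.
Proof.
  intros Hf Hs. apply (ccont_vertical (fun w => f (cexp w) * / cexp w ^ k)%C s y).
  apply cdiff_cexp_kernel; assumption.
Qed.

(** The window is free to move because the singularity of the Cauchy quotient has to be interior to
    it, which is arranged by centring it at an argument of z. *)
Lemma circle_coef_shift (f : C -> C) (s t : R) (k : nat) : analytic_disk f -> s < 0 ->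
  is_CInt (fun y => f (cexp (s, y)) * / cexp (s, y) ^ k)%C (t - PI) (t + PI) (circle_coef f s k).
Proof.
  intros Hf Hs. unfold circle_coef.
  set (g := fun y => (f (cexp (s, y)) * / cexp (s, y) ^ k)%C).
  assert (Hc : forall y, ccont g y) by (intros; apply ccont_circle; assumption).
  assert (E : CInt g (t - PI) (t - PI + 2 * PI) = CInt g (- PI) (- PI + 2 * PI)).
  { apply CInt_period; [exact Hc|]. intros y. unfold g. rewrite cexp_period. reflexivity. }
  replace (- PI + 2 * PI) with PI in E by ring. replace (t - PI + 2 * PI) with (t + PI) in E by ring.
  rewrite <- E. apply CInt_correct. intros; apply Hc.
Qed.

Lemma analytic_const (c : C) : analytic_disk (fun _ => c).
Proof. apply analytic_disk_cdiff. intros z _. exists (RtoC 0). apply cdiff_const. Qed.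

Lemma circle_coef_one_0 (s : R) : circle_coef (fun _ => 1%C) s 0 = RtoC (2 * PI).
Proof.
  unfold circle_coef. apply CInt_unique.
  replace (RtoC (2 * PI)) with (RtoC (PI - - PI) * 1)%C by (rewrite Cmult_1_r; f_equal; ring).
  apply (is_CInt_ext (fun _ => RtoC 1)); [|apply is_CInt_const].
  intros t _. simpl. field.
Qed.

(* The integral over the circle of radius [r] is proportional to [r^-k] but
   independent of [r]. *)
Lemma circle_coef_one_S (s : R) (k : nat) : s < 0 -> circle_coef (fun _ => 1%C) s (S k) = 0%C.
Proof.
  intros Hs. set (A := circle_coef (fun _ => 1%C) s (S k)).
  assert (I : is_CInt (fun y => 1 * / cexp (s, y) ^ S k)%C (- PI) PI A).
  { apply CInt_correct. intros y _. apply (ccont_circle (fun _ => 1%C)); [apply analytic_const | exact Hs]. }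
  apply (is_CInt_scal (/ RtoC (exp (-1)) ^ S k)%C) in I.
  assert (E : circle_coef (fun _ => 1%C) (s - 1) (S k) = (/ RtoC (exp (-1)) ^ S k * A)%C).
  { apply CInt_unique. eapply is_CInt_ext; [|exact I].
    intros t _. simpl.
    replace (cexp (s - 1, t)) with (RtoC (exp (-1)) * cexp (s, t))%C.
    - rewrite Cpow_mult_l. field.
      assert (RtoC (exp (-1)) <> 0%C) by (apply Cmod_gt_0; rewrite Cmod_R, Rabs_pos_eq; [|left]; apply exp_pos).
      pose proof (cexp_neq_0 (s, t)).
      repeat split; try assumption; apply Cpow_nz; assumption.
    - unfold cexp; simpl. replace (s - 1) with (-1 + s) by ring. rewrite exp_plus. apply injective_projections; simpl; ring. }
  rewrite (circle_coef_indep _ (s - 1) s) in E by (try apply analytic_const; lra). fold A in E.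
  assert (Hne : (/ RtoC (exp (-1)) ^ S k - 1)%C <> 0%C).
  { intros H. assert (H1 : Cmod (/ RtoC (exp (-1)) ^ S k) = 1).
    { replace (/ RtoC (exp (-1)) ^ S k)%C with (1 : C); [apply Cmod_1|]. symmetry. apply Ceq_minus. exact H. }
    rewrite Cmod_inv, Cmod_pow, Cmod_R, Rabs_pos_eq in H1.
    - assert (H2 : exp (-1) < 1) by (rewrite <- exp_0; apply exp_increasing; lra).
      assert (H3 : exp (-1) ^ S k < 1) by (apply pow_lt_1_compat; [split; [left; apply exp_pos | exact H2] | lia]).
      assert (H4 : 0 < exp (-1) ^ S k) by (apply pow_lt, exp_pos).
      apply (f_equal Rinv) in H1. rewrite Rinv_inv, Rinv_1 in H1. lra.
    - left; apply exp_pos.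
    - apply Cpow_nz. apply Cmod_gt_0. rewrite Cmod_R, Rabs_pos_eq; [|left]; apply exp_pos. }
  replace A with ((/ RtoC (exp (-1)) ^ S k * A - A) / (/ RtoC (exp (-1)) ^ S k - 1))%C.
  - rewrite <- E. unfold Cdiv. ring.
  - set (X := (/ RtoC (exp (-1)) ^ S k)%C) in *. field. exact Hne.
Qed.

(** The form (f(zeta) - f(z)) / (zeta - z) d zeta in the coordinate zeta = cexp w, where d zeta =
    zeta dw. *)
Definition cauchy_quotient (f : C -> C) (z : C) (w : C) : C :=
  ((f (cexp w) - f z) * cexp w / (cexp w - z))%C.

(** The circle is shrunk towards 0. Crossing z does not change the integral because the quotient
    stays bounded there, and on small circles the integrand tends to 0. *)
Lemma cauchy_quotient_zero (f : C -> C) (z : C) (s : R) : analytic_disk f ->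
  s < 0 -> Cmod z < exp s ->
  exists t, CInt (fun y => cauchy_quotient f z (s, y)) (t - PI) (t + PI) = RtoC 0.
Proof.
  intros Hf Hs Hz. pose proof PI_RGT_0 as Hpi.
  assert (Hz1 : Cmod z < 1) by (apply Rlt_trans with (1 := Hz); rewrite <- exp_0; apply exp_increasing, Hs).
  assert (D : forall w, fst w < 0 -> cexp w <> z -> exists l, cdiff (cauchy_quotient f z) w l).
  { intros w Hw Hne.
    destruct (proj1 (analytic_disk_cdiff f) Hf (cexp w) (Cmod_cexp_lt_1 w Hw)) as [l Hl].
    apply (cdiff_div (fun w => (f (cexp w) - f z) * cexp w)%C (fun w => cexp w - z)%C w
      ((cexp w * l - 0) * cexp w + (f (cexp w) - f z) * cexp w)%C (cexp w - 0)%C).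
    - apply (cdiff_mult (fun w => f (cexp w) - f z)%C cexp); [|apply cdiff_cexp].
      apply cdiff_minus; [|apply cdiff_const]. apply (cdiff_comp f cexp); [exact Hl | apply cdiff_cexp].
    - apply cdiff_minus; [apply cdiff_cexp | apply cdiff_const].
    - intros H. apply Hne. apply Ceq_minus. exact H. }
  assert (Per : forall t x, cauchy_quotient f z (x, t + PI) = cauchy_quotient f z (x, t - PI)).
  { intros t x. unfold cauchy_quotient. replace (cexp (x, t + PI)) with (cexp (x, t - PI)); [reflexivity|].
    rewrite <- (cexp_period x (t - PI)). do 2 f_equal. ring. }
  (* [t] centres the window and [s0] is a radius below that of z; the cases z = 0 and z <> 0 supply
     constancy of the integral, continuity and smallness for different reasons. *)
  assert (Z : exists t s0, s0 < s /\
    (forall s', s' <= s0 -> CInt (fun y => cauchy_quotient f z (s', y)) (t - PI) (t + PI) =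
                CInt (fun y => cauchy_quotient f z (s, y)) (t - PI) (t + PI)) /\
    (forall s' y, s' <= s0 -> ccont (fun y : R => cauchy_quotient f z (s', y)) y) /\
    (forall eps, 0 < eps -> exists s', s' <= s0 /\ forall y, Cmod (cauchy_quotient f z (s', y)) <= eps)).
  { destruct (proj1 (analytic_disk_cdiff f) Hf 0%C) as [l0 Hl0]; [rewrite Cmod_0; lra|].
    assert (small : forall d s0, 0 < d -> exists s', s' <= s0 /\ exp s' < d).
    { intros d s0 Hd. exists (Rmin s0 (ln (d / 2))). split; [apply Rmin_l|].
      apply Rle_lt_trans with (exp (ln (d / 2))).
      - destruct (Rmin_r s0 (ln (d / 2))) as [H|H]; [left; apply exp_increasing, H | right; f_equal; exact H].
      - rewrite exp_ln; lra. }
    destruct (Ceq_dec z 0) as [->|Hz0].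
    (* [cexp] never vanishes, so for z = 0 there is no singularity and any window serves. The
       quotient reduces to f(zeta) - f(0), small by continuity. *)
    - exists 0, (s - 1). split; [lra|]. split; [|split].
      + intros s' Hs'. apply (vertical_shift (cauchy_quotient f 0%C)); [lra|lra| |].
        * intros x y Hx _. apply D; [simpl; lra | apply cexp_neq_0].
        * intros x _. apply Per.
      + intros s' y Hs'. apply ccont_vertical. apply D; [simpl; lra | apply cexp_neq_0].
      + intros eps Heps. destruct (cdiff_continuity f _ _ Hl0 eps Heps) as (d & Hd & H).
        destruct (small d (s - 1) Hd) as (s' & Hs' & He). exists s'. split; [exact Hs'|]. intros y.
        unfold cauchy_quotient.
        replace ((f (cexp (s', y)) - f 0) * cexp (s', y) / (cexp (s', y) - 0))%C with (f (cexp (s', y)) - f 0)%C.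
        * left. apply H. replace (cexp (s', y) - 0)%C with (cexp (s', y)) by ring.
          rewrite Cmod_cexp. exact He.
        * replace (cexp (s', y) - 0)%C with (cexp (s', y)) by ring. field. apply cexp_neq_0.
    - destruct (polar_form z Hz0) as [t Ht]. set (p := ln (Cmod z)) in *.
      assert (Hzm : 0 < Cmod z) by (apply Cmod_gt_0; exact Hz0).
      assert (Hps : p < s).
      { apply exp_lt_inv. unfold p. rewrite exp_ln; assumption. }
      exists t, (p - 1). split; [lra|].
      assert (D' : forall s' y, s' <> p -> s' < 0 -> exists l, cdiff (cauchy_quotient f z) (s', y) l).
      { intros s' y Hne Hlt. apply D; [exact Hlt|]. intros E. rewrite Ht in E.
        apply (f_equal Cmod) in E. rewrite !Cmod_cexp in E. apply exp_inv in E. simpl in E. auto. }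
      split; [|split].
      + intros s' Hs'.
        destruct (proj1 (analytic_disk_cdiff f) Hf z Hz1) as [l Hl].
        destruct (Hl 1 Rlt_0_1) as (d & Hd & Hnear).
        destruct (cdiff_continuity cexp (p, t) _ (cdiff_cexp _) d Hd) as (d' & Hd' & Hc').
        destruct (cdiff_continuity cexp (p, t) _ (cdiff_cexp _) 1 Rlt_0_1) as (d1 & Hd1 & Hc1).
        rewrite <- Ht in Hc', Hc1.
        (* Near (p,t) the difference quotient of [f] is at most 1 + |l|, and the factor zeta is at
           most |z| + 1 <= 2. *)
        apply (vertical_shift_pole (cauchy_quotient f z) s' s (t - PI) (t + PI) p t (Rmin d' d1) ((1 + Cmod l) * 2)); try lra.
        * intros x y Hx Hy Hne. apply D; [simpl; lra|]. intros E. rewrite Ht in E.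
          apply cexp_eq_imag in E; [|apply Rabs_le; lra]. destruct E as [-> ->]. auto.
        * apply Rmin_pos; assumption.
        * intros w Hw.
          assert (B1 : Cmod (w - (p, t)) < d') by (apply Rlt_le_trans with (1 := Hw), Rmin_l).
          assert (B2 : Cmod (w - (p, t)) < d1) by (apply Rlt_le_trans with (1 := Hw), Rmin_r).
          specialize (Hc' w B1). specialize (Hc1 w B2). specialize (Hnear _ Hc').
          assert (B3 : Cmod (cexp w) <= 2).
          { pose proof (Cmod_triangle_rev (cexp w) z). lra. }
          assert (B4 : Cmod (f (cexp w) - f z) <= (1 + Cmod l) * Cmod (cexp w - z)).
          { replace (f (cexp w) - f z)%C with ((f (cexp w) - f z - l * (cexp w - z)) + l * (cexp w - z))%C by ring.
            eapply Rle_trans; [apply Cmod_triangle|]. rewrite Cmod_mult. lra. }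
          unfold cauchy_quotient.
          pose proof (Cmod_ge_0 l). pose proof (Cmod_ge_0 (cexp w)).
          (* At the singularity itself the numerator is zero, so the quotient is 0 whatever the
             inverse of 0 is; boundedness is all that matters. *)
          destruct (Ceq_dec (cexp w - z) 0) as [E|E].
          -- rewrite E in B4. rewrite Cmod_0, Rmult_0_r in B4.
             unfold Cdiv. rewrite !Cmod_mult.
             assert (E0 : Cmod (f (cexp w) - f z) = 0) by (apply Rle_antisym; [exact B4 | apply Cmod_ge_0]).
             rewrite E0, !Rmult_0_l. nra.
          -- rewrite Cmod_div, Cmod_mult by exact E.
             assert (0 < Cmod (cexp w - z)) by (apply Cmod_gt_0; exact E).
             apply Rle_div_l; [assumption|].
             apply Rle_trans with ((1 + Cmod l) * Cmod (cexp w - z) * 2); [|right; ring].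
             apply Rmult_le_compat; auto; apply Cmod_ge_0.
        * intros x _. apply Per.
      + intros s' y Hs'. apply ccont_vertical. apply D'; lra.
      + intros eps Heps.
        destruct (cdiff_continuity f _ _ Hl0 1 Rlt_0_1) as (d & Hd & H).
        set (K := 1 + Cmod (f 0%C - f z)%C).
        assert (HK : 0 < K) by (unfold K; pose proof (Cmod_ge_0 (f 0 - f z)); lra).
        assert (He : 0 < eps * (Cmod z / 2) / K).
        { apply Rdiv_lt_0_compat; [|exact HK]. apply Rmult_lt_0_compat; lra. }
        (* For |zeta| < |z|/2 the denominator is at least |z|/2 and |f(zeta) - f(z)| is at most K,
           so the factor zeta makes the quotient small. *)
        destruct (small (Rmin d (Rmin (Cmod z / 2) (eps * (Cmod z / 2) / K))) (p - 1)) as (s' & Hs' & Hsm).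
        { repeat apply Rmin_pos; lra. }
        exists s'. split; [exact Hs'|]. intros y.
        apply Rmin_Rgt_l in Hsm as [S1 Hsm]. apply Rmin_Rgt_l in Hsm as [S2 S3].
        unfold cauchy_quotient. set (zeta := cexp (s', y)).
        assert (Hm : Cmod zeta = exp s') by apply Cmod_cexp.
        assert (H1 : Cmod (f zeta - f z) <= K).
        { replace (f zeta - f z)%C with ((f zeta - f 0) + (f 0 - f z))%C by ring.
          eapply Rle_trans; [apply Cmod_triangle|]. unfold K. apply Rplus_le_compat_r. left. apply H.
          replace (zeta - 0)%C with zeta by ring. lra. }
        assert (H2 : Cmod z / 2 <= Cmod (zeta - z)).
        { rewrite Cmod_minus_sym. pose proof (Cmod_triangle_rev z zeta). lra. }
        rewrite Cmod_div, Cmod_mult by (apply Cmod_gt_0; lra).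
        apply Rle_div_l; [lra|]. rewrite Hm.
        pose proof (exp_pos s').
        assert (H3 : K * exp s' <= eps * (Cmod z / 2)).
        { apply Rgt_lt in S3. apply Rlt_div_r in S3; [lra | exact HK]. }
        apply Rle_trans with (K * exp s'); [apply Rmult_le_compat_r; lra|].
        apply Rle_trans with (1 := H3). apply Rmult_le_compat_l; lra. }
  destruct Z as (t & s0 & Hs0 & Hconst & Hcont & Hsmall). exists t.
  apply (Cmod_eq_0_eps _ (2 * PI)). intros eps Heps.
  destruct (Hsmall eps Heps) as (s' & Hs' & Hb). rewrite <- (Hconst s' Hs').
  replace (2 * PI) with ((t + PI) - (t - PI)) by ring.
  apply (is_CInt_bound_const (fun y => cauchy_quotient f z (s', y))).
  - lra.
  - intros y _. apply Hb.
  - apply CInt_correct. intros y _. apply Hcont, Hs'.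
Qed.

(** With an exact remainder only finite sums have to be exchanged with the circle integral. *)
Lemma geometric_remainder (u v : C) (n : nat) : u <> 0%C -> (u - v)%C <> 0%C ->
  (u / (u - v))%C = (csum (fun k => v ^ k * / u ^ k) n + v ^ n * / u ^ n * (u / (u - v)))%C.
Proof.
  intros Hu Huv.
  assert (E : csum (fun k => v ^ k * / u ^ k)%C n = csum (fun k => (v / u) ^ k)%C n).
  { apply csum_ext. intros k _. unfold Cdiv. rewrite Cpow_mult_l, Cpow_inv by exact Hu. reflexivity. }
  rewrite E.
  replace (v ^ n * / u ^ n)%C with ((v / u) ^ n)%C
    by (unfold Cdiv; rewrite Cpow_mult_l, Cpow_inv by exact Hu; reflexivity).
  pose proof (csum_geom (v / u) n) as G.
  assert (Hq : (1 - v / u)%C = ((u - v) / u)%C) by (field; exact Hu).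
  rewrite Hq in G.
  replace (csum (fun k => (v / u) ^ k)%C n) with (u / (u - v) * ((u - v) / u * csum (fun k => (v / u) ^ k) n))%C
    by (field; split; assumption).
  rewrite G. ring.
Qed.

Lemma csum_first (u : nat -> C) (n : nat) :
  (forall k, u (S k) = 0%C) -> csum u (S n) = u O.
Proof.
  intros H. induction n as [|n IH]; [simpl; ring|].
  change (csum u (S (S n))) with (csum u (S n) + u (S n))%C. rewrite IH, H. ring.
Qed.

Lemma csum_minus (u v : nat -> C) (n : nat) : csum (fun k => u k - v k)%C n = (csum u n - csum v n)%C.
Proof. induction n as [|n IH]; simpl; [ring|]. rewrite IH. ring. Qed.

(** The radius e^(-1) is arbitrary: every s < 0 gives the same value. *)
Definition taylor_coef (f : C -> C) (k : nat) : C := (circle_coef f (-1) k / RtoC (2 * PI))%C.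

Lemma RtoC_2PI_neq_0 : RtoC (2 * PI) <> 0%C.
Proof. apply Cmod_gt_0. rewrite Cmod_R, Rabs_pos_eq; pose proof PI_RGT_0; lra. Qed.

Lemma taylor_coef_circle (f : C -> C) (s : R) (k : nat) : analytic_disk f -> s < 0 ->
  circle_coef f s k = (RtoC (2 * PI) * taylor_coef f k)%C.
Proof.
  intros Hf Hs. unfold taylor_coef. rewrite (circle_coef_indep f s (-1)) by (try assumption; lra).
  field. apply RtoC_2PI_neq_0.
Qed.

(** The factor zeta / (zeta - z) in the Cauchy quotient is expanded geometrically. The whole
    integrates to 0, the finite sum to 2 PI times the Taylor error, and the remainder carries the
    factor (z / zeta)^(n+1). With at least one term, the constant f(z) contributes exactly its term
    k = 0. *)
Lemma taylor_remainder (f : C -> C) (z : C) (s M : R) (n : nat) : analytic_disk f -> s < 0 ->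
  Cmod z < exp s -> (forall zeta, Cmod zeta = exp s -> Cmod (f zeta) <= M) ->
  Cmod (csum (fun k => taylor_coef f k * z ^ k)%C (S n) - f z) <=
    (Cmod z / exp s) ^ S n * ((M + Cmod (f z)) * exp s / (exp s - Cmod z)).
Proof.
  intros Hf Hs Hz HM. pose proof PI_RGT_0 as Hpi.
  destruct (cauchy_quotient_zero f z s Hf Hs Hz) as [t Ht].
  assert (Hne : forall y, (cexp (s, y) - z)%C <> 0%C).
  { intros y. apply Cmod_gt_0. pose proof (Cmod_triangle_rev (cexp (s, y)) z) as H.
    rewrite Cmod_cexp in H. simpl in H. lra. }
  (* The k-th term (f(zeta) - f(z)) (z / zeta)^k, arranged so that its integral is read off from
     [circle_coef] of f and of the constant 1. *)
  set (term := fun k y => (z ^ k * (f (cexp (s, y)) * / cexp (s, y) ^ k) - f z * (z ^ k * (1 * / cexp (s, y) ^ k)))%C).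
  set (R_ := fun y => (cauchy_quotient f z (s, y) - csum (fun k => term k y) (S n))%C).
  assert (Hsum : is_CInt (fun y => csum (fun k => term k y) (S n)) (t - PI) (t + PI)
     (csum (fun k => z ^ k * circle_coef f s k - f z * (z ^ k * circle_coef (fun _ => 1%C) s k))%C (S n))).
  { apply is_CInt_csum. intros k. unfold term. apply is_CInt_minus.
    - apply is_CInt_scal. apply circle_coef_shift; assumption.
    - apply is_CInt_scal. apply is_CInt_scal.
      apply (circle_coef_shift (fun _ => 1%C)); [apply analytic_const | assumption]. }
  assert (Esum : csum (fun k => z ^ k * circle_coef f s k - f z * (z ^ k * circle_coef (fun _ => 1%C) s k))%C (S n)
    = (RtoC (2 * PI) * (csum (fun k => taylor_coef f k * z ^ k) (S n) - f z))%C).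
  { rewrite csum_minus. rewrite (csum_scal (f z)).
    rewrite (csum_first (fun k => z ^ k * circle_coef (fun _ => 1%C) s k)%C).
    - rewrite circle_coef_one_0. rewrite (csum_ext _ (fun k => RtoC (2 * PI) * (taylor_coef f k * z ^ k))%C).
      + rewrite csum_scal. simpl Cpow. ring.
      + intros k _. rewrite taylor_coef_circle by assumption. ring.
    - intros k. rewrite circle_coef_one_S by assumption. ring. }
  assert (Hcont : forall y, ccont (fun y : R => cauchy_quotient f z (s, y)) y).
  { intros y. apply ccont_vertical.
    destruct (proj1 (analytic_disk_cdiff f) Hf (cexp (s, y)) (Cmod_cexp_lt_1 (s, y) Hs)) as [l Hl].
    apply (cdiff_div (fun w => (f (cexp w) - f z) * cexp w)%C (fun w => cexp w - z)%C (s, y)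
      ((cexp (s, y) * l - 0) * cexp (s, y) + (f (cexp (s, y)) - f z) * cexp (s, y))%C (cexp (s, y) - 0)%C).
    - apply (cdiff_mult (fun w => f (cexp w) - f z)%C cexp); [|apply cdiff_cexp].
      apply cdiff_minus; [|apply cdiff_const]. apply (cdiff_comp f cexp); [exact Hl | apply cdiff_cexp].
    - apply cdiff_minus; [apply cdiff_cexp | apply cdiff_const].
    - apply Hne. }
  assert (HR : is_CInt R_ (t - PI) (t + PI) (- (RtoC (2 * PI) * (csum (fun k => taylor_coef f k * z ^ k) (S n) - f z)))%C).
  { rewrite <- Esum.
    match goal with |- is_CInt _ _ _ (- ?e)%C => replace (- e)%C with (0 - e)%C by ring end.
    unfold R_. apply is_CInt_minus; [|exact Hsum].
    rewrite <- Ht. apply CInt_correct. intros y _. apply Hcont. }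
  apply (is_CInt_bound_const R_ _ _ ((Cmod z / exp s) ^ S n * ((M + Cmod (f z)) * exp s / (exp s - Cmod z)))) in HR.
  - rewrite Cmod_opp, Cmod_mult, Cmod_R, Rabs_pos_eq in HR by lra.
    apply Rmult_le_reg_l with (2 * PI); [lra|]. replace (t + PI - (t - PI)) with (2 * PI) in HR by ring. exact HR.
  - lra.
  - intros y _. unfold R_, cauchy_quotient. set (zeta := cexp (s, y)).
    assert (Hzeta : zeta <> 0%C) by apply cexp_neq_0.
    assert (Hm : Cmod zeta = exp s) by apply Cmod_cexp.
    replace (csum (fun k => term k y) (S n)) with
      ((f zeta - f z) * csum (fun k => z ^ k * / zeta ^ k) (S n))%C.
    2:{ rewrite <- csum_scal. apply csum_ext. intros k _. unfold term. fold zeta. ring. }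
    replace ((f zeta - f z) * zeta / (zeta - z))%C with ((f zeta - f z) * (zeta / (zeta - z)))%C
      by (unfold Cdiv; ring).
    rewrite (geometric_remainder zeta z (S n) Hzeta (Hne y)) at 1.
    match goal with |- Cmod ?e <= _ =>
      replace e with ((z ^ S n * / zeta ^ S n) * ((f zeta - f z) * (zeta / (zeta - z))))%C by ring end.
    rewrite Cmod_mult. replace (z ^ S n * / zeta ^ S n)%C with ((z / zeta) ^ S n)%C
      by (unfold Cdiv; rewrite Cpow_mult_l, Cpow_inv by exact Hzeta; reflexivity).
    rewrite Cmod_pow, Cmod_div, Hm by exact Hzeta.
    apply Rmult_le_compat_l; [apply pow_le, Rdiv_le_0_compat; [apply Cmod_ge_0 | apply exp_pos]|].
    rewrite Cmod_mult, Cmod_div, Hm by apply Hne.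
    unfold Rdiv. rewrite Rmult_assoc. pose proof (exp_pos s).
    assert (exp s - Cmod z <= Cmod (zeta - z)) by (rewrite <- Hm; apply Cmod_triangle_rev).
    apply Rmult_le_compat.
    + apply Cmod_ge_0.
    + apply Rmult_le_pos; [lra|]. left. apply Rinv_0_lt_compat. lra.
    + unfold Cminus at 1. eapply Rle_trans; [apply Cmod_triangle|]. rewrite Cmod_opp.
      apply Rplus_le_compat_r. apply HM, Hm.
    + apply Rmult_le_compat_l; [lra|]. apply Rinv_le_contravar; lra.
Qed.

Lemma taylor_expansion (f : C -> C) : analytic_disk f ->
  (forall r, r < 1 -> exists M, forall z, Cmod z <= r -> Cmod (f z) <= M) ->
  taylor_series_disk (taylor_coef f) f.
Proof.
  intros Hf Hb z Hz. apply is_cpseries_eps.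
  set (r := (1 + Cmod z) / 2). pose proof (Cmod_ge_0 z).
  assert (Hr : 0 < r) by (unfold r; lra).
  set (s := ln r). assert (Es : exp s = r) by (apply exp_ln, Hr).
  assert (Hs : s < 0) by (rewrite <- ln_1; apply ln_increasing; unfold r; lra).
  destruct (Hb r) as [M HM]; [unfold r; lra|].
  set (K := (M + Cmod (f z)) * exp s / (exp s - Cmod z)).
  assert (HK : 0 <= K).
  { unfold K. rewrite Es. apply Rdiv_le_0_compat; [|unfold r; lra].
    apply Rmult_le_pos; [|lra].
    pose proof (Cmod_ge_0 (f z)). specialize (HM z ltac:(unfold r; lra)). lra. }
  intros eps Heps.
  destruct (pow_lt_1_zero (Cmod z / r)) with (y := eps / (K + 1)) as [N HN].
  { rewrite Rabs_pos_eq by (apply Rdiv_le_0_compat; lra). apply Rlt_div_l; [lra|]. unfold r; lra. }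
  { apply Rdiv_lt_0_compat; lra. }
  exists (S N). intros n Hn. destruct n as [|n]; [lia|].
  eapply Rle_lt_trans; [apply (taylor_remainder f z s M n Hf Hs)|].
  - rewrite Es. unfold r; lra.
  - intros zeta Hzeta. apply HM. lra.
  - fold K. rewrite Es. specialize (HN (S n) ltac:(lia)).
    rewrite Rabs_pos_eq in HN by (apply pow_le, Rdiv_le_0_compat; lra).
    apply Rlt_div_r in HN; [|lra].
    assert (0 <= (Cmod z / r) ^ S n) by (apply pow_le, Rdiv_le_0_compat; lra). nra.
Qed.

(** * Taylor partial sums of functions of Korenblum growth *)

(** From sin x >= x - x^3/6 and x^2 <= 4. *)
Lemma sin_third_lb (x : R) : 0 <= x <= 2 -> x / 3 <= sin x.
Proof.
  intros Hx. destruct (pre_sin_bound x 0) as [H _]; [lra|lra|].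
  unfold sin_approx, sin_term in H. simpl in H.
  eapply Rle_trans; [|exact H]. nra.
Qed.

(** 1 - cos t = 2 sin^2 (t/2) >= 2 (t/6)^2, valid because t/2 <= PI/2 <= 2. *)
Lemma one_minus_cos_lb (y : R) : Rabs y <= PI -> y ^ 2 / 18 <= 1 - cos y.
Proof.
  intros Hy. pose proof PI_4.
  assert (W : forall t, 0 <= t <= PI -> t ^ 2 / 18 <= 1 - cos t).
  { intros t Ht. replace t with (2 * (t / 2)) at 2 by field. rewrite cos_2a_sin.
    pose proof (sin_third_lb (t / 2) ltac:(lra)). nra. }
  unfold Rabs in Hy. destruct (Rcase_abs y).
  - rewrite <- cos_neg. replace (y ^ 2) with ((- y) ^ 2) by ring. apply W. lra.
  - apply W. lra.
Qed.

(** With r = exp s, |1 - r e^(iy)|^2 = (1 - r)^2 + 2 r (1 - cos y) >= (1 - r)^2 + y^2/18 since 2 r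
    >= 1, and (u + v)^2 <= 2 (u^2 + v^2) turns this into the linear bound with 1/6. *)
Lemma circle_dist_one_lb (s y : R) : s < 0 -> 1 / 2 <= exp s -> Rabs y <= PI ->
  ((1 - exp s) + Rabs y) / 6 <= Cmod (1 - cexp (s, y)).
Proof.
  intros Hs Hr Hy.
  assert (H1 : exp s < 1) by (rewrite <- exp_0; apply exp_increasing, Hs).
  pose proof (Rabs_pos y) as Hy0.
  apply Rsqr_incr_0_var; [|apply Cmod_ge_0].
  rewrite !Rsqr_pow2, Cmod2_alt. unfold Re, Im, cexp; simpl fst; simpl snd.
  set (r := exp s) in *.
  replace ((1 + - (r * cos y)) ^ 2 + (0 + - (r * sin y)) ^ 2) with ((1 - r) ^ 2 + 2 * r * (1 - cos y)).
  - pose proof (one_minus_cos_lb y Hy) as H2. rewrite <- (pow2_abs y) in H2. set (a := Rabs y) in *.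
    assert (H3 : 0 <= (2 * r - 1) * (1 - cos y)).
    { apply Rmult_le_pos; [lra|]. pose proof (pow2_ge_0 a). lra. }
    apply Rle_trans with ((1 - r) ^ 2 + a ^ 2 / 18); [|lra].
    pose proof (pow2_ge_0 (1 - r - a)). pose proof (pow2_ge_0 (1 - r)). lra.
  - pose proof (sin2_cos2 y) as H2. unfold Rsqr in H2.
    transitivity (1 - 2 * r * cos y + r ^ 2 * (sin y * sin y + cos y * cos y)); [rewrite H2|]; ring.
Qed.

Lemma is_RInt_inv_shift (delta A : R) : 0 < delta ->
  is_RInt (fun y => A / (delta + y)) 0 PI (A * (ln (delta + PI) - ln delta)).
Proof.
  intros Hd. pose proof PI_RGT_0.
  replace (A * (ln (delta + PI) - ln delta)) with
    (minus (G := R_AbelianGroup) (A * ln (delta + PI)) (A * ln (delta + 0)))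
    by (rewrite Rplus_0_r; unfold minus, plus, opp; simpl; ring).
  apply (is_RInt_derive (V := R_CompleteNormedModule) (fun y => A * ln (delta + y)));
    rewrite Rmin_left, Rmax_right by lra; intros x Hx.
  - auto_derive; [lra | field; lra].
  - apply (ex_derive_continuous (K := R_AbsRing) (V := R_NormedModule)). auto_derive. lra.
Qed.

Lemma is_RInt_inv_shift_neg (delta A : R) : 0 < delta ->
  is_RInt (fun y => A / (delta - y)) (- PI) 0 (A * (ln (delta + PI) - ln delta)).
Proof.
  intros Hd. pose proof PI_RGT_0.
  replace (A * (ln (delta + PI) - ln delta)) with
    (minus (G := R_AbelianGroup) (- A * ln (delta - 0)) (- A * ln (delta - - PI)))
    by (rewrite Rminus_0_r; unfold minus, plus, opp; simpl; unfold Rminus; rewrite Ropp_involutive; ring).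
  apply (is_RInt_derive (V := R_CompleteNormedModule) (fun y => - A * ln (delta - y)));
    rewrite Rmin_left, Rmax_right by lra; intros x Hx.
  - auto_derive; [lra | field; lra].
  - apply (ex_derive_continuous (K := R_AbsRing) (V := R_NormedModule)). auto_derive. lra.
Qed.

(** Summing zeta^(-k) geometrically gives a kernel of size at most 6 (1 + r^(-n)) / (1 - r + |y|),
    whose integral over each half circle is the logarithm in the bound. *)
Lemma taylor_partial_sum_le (f : C -> C) (s M : R) (n : nat) : analytic_disk f ->
  s < 0 -> 1 / 2 <= exp s -> (forall zeta, Cmod zeta = exp s -> Cmod (f zeta) <= M) ->
  Cmod (csum (taylor_coef f) n) <=
    2 * M * (1 + (/ exp s) ^ n) * (ln (1 - exp s + PI) - ln (1 - exp s)).
Proof.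
  intros Hf Hs Hr HM. pose proof PI2_3_2 as Hpi.
  assert (H1 : exp s < 1) by (rewrite <- exp_0; apply exp_increasing, Hs).
  set (r := exp s) in *. set (delta := 1 - r).
  assert (Hd : 0 < delta) by (unfold delta; lra).
  set (g := fun y => csum (fun k => f (cexp (s, y)) * / cexp (s, y) ^ k)%C n).
  assert (Hg : is_CInt g (- PI) PI (RtoC (2 * PI) * csum (taylor_coef f) n)%C).
  { rewrite <- csum_scal. apply is_CInt_csum. intros k. rewrite <- (taylor_coef_circle f s k Hf Hs).
    apply CInt_correct. intros y _. apply ccont_circle; assumption. }
  assert (Hgc : forall y, ccont g y).
  { intros y. unfold g. clear Hg. induction n as [|m IH]; simpl.
    - apply ccont_const.
    - apply ccont_plus; [exact IH | apply ccont_circle; assumption]. }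
  set (A := 6 * M * (1 + (/ r) ^ n)).
  assert (HM0 : 0 <= M).
  { eapply Rle_trans; [apply Cmod_ge_0|]. apply (HM (cexp (s, 0))). apply Cmod_cexp. }
  assert (Hb : forall y, Rabs y <= PI -> Cmod (g y) <= A / (delta + Rabs y)).
  { intros y Hy. unfold g. rewrite csum_scal. set (zeta := cexp (s, y)).
    assert (Hz : zeta <> 0%C) by apply cexp_neq_0.
    assert (Hm : Cmod zeta = r) by apply Cmod_cexp.
    pose proof (circle_dist_one_lb s y Hs Hr Hy) as Hlb. fold zeta r delta in Hlb.
    pose proof (Rabs_pos y) as Hy0.
    assert (Hinv : Cmod (csum (fun k => / zeta ^ k)%C n) <= (1 + (/ r) ^ n) * 6 / (delta + Rabs y)).
    { pose proof (csum_geom (/ zeta) n) as G.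
      apply (f_equal Cmod) in G. rewrite Cmod_mult in G.
      assert (E : csum (fun k => (/ zeta) ^ k)%C n = csum (fun k => / zeta ^ k)%C n).
      { apply csum_ext. intros k _. apply Cpow_inv, Hz. }
      rewrite E in G.
      assert (H2 : Cmod (1 - (/ zeta) ^ n) <= 1 + (/ r) ^ n).
      { unfold Cminus. eapply Rle_trans; [apply Cmod_triangle|].
        rewrite Cmod_opp, Cmod_1, Cmod_pow, Cmod_inv, Hm by exact Hz. lra. }
      (* |1 - 1/zeta| = |1 - zeta| / r, and dividing by r < 1 only enlarges it. *)
      assert (H3 : (delta + Rabs y) / 6 <= Cmod (1 - / zeta)).
      { replace (1 - / zeta)%C with (- (1 - zeta) / zeta)%C by (field; exact Hz).
        rewrite Cmod_div, Cmod_opp, Hm by exact Hz. apply Rle_trans with (1 := Hlb).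
        apply Rle_div_r; [lra|]. pose proof (Cmod_ge_0 (1 - zeta)). nra. }
      apply Rle_div_r; [lra|].
      pose proof (Cmod_ge_0 (csum (fun k => / zeta ^ k)%C n)). nra. }
    rewrite Cmod_mult. apply Rle_trans with (M * ((1 + (/ r) ^ n) * 6 / (delta + Rabs y))).
    - apply Rmult_le_compat; auto using Cmod_ge_0.
    - right. unfold A. field. lra. }
  assert (I1 : Cmod (CInt g (- PI) 0) <= A * (ln (delta + PI) - ln delta)).
  { apply (is_CInt_bound g (fun y => A / (delta - y)) (- PI) 0); [lra| |apply CInt_correct; intros; apply Hgc | apply is_RInt_inv_shift_neg, Hd].
    intros t Ht. replace (delta - t) with (delta + Rabs t) by (rewrite Rabs_left1; lra).
    apply Hb. rewrite Rabs_left1; lra. }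
  assert (I2 : Cmod (CInt g 0 PI) <= A * (ln (delta + PI) - ln delta)).
  { apply (is_CInt_bound g (fun y => A / (delta + y)) 0 PI); [lra| |apply CInt_correct; intros; apply Hgc | apply is_RInt_inv_shift, Hd].
    intros t Ht. replace (delta + t) with (delta + Rabs t) by (rewrite Rabs_pos_eq; lra).
    apply Hb. rewrite Rabs_pos_eq; lra. }
  assert (E : (RtoC (2 * PI) * csum (taylor_coef f) n)%C = (CInt g (- PI) 0 + CInt g 0 PI)%C).
  { rewrite <- (CInt_unique _ _ _ _ Hg). apply CInt_unique.
    apply (is_CInt_Chasles g (- PI) 0 PI); apply CInt_correct; intros; apply Hgc. }
  apply (f_equal Cmod) in E. rewrite Cmod_mult, Cmod_R, Rabs_pos_eq in E by lra.
  pose proof (Cmod_triangle (CInt g (- PI) 0) (CInt g 0 PI)) as T.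
  set (L := ln (delta + PI) - ln delta) in *.
  assert (HL : 0 <= A * L) by (eapply Rle_trans; [apply Cmod_ge_0 | exact I1]).
  assert (H2 : 2 * PI * Cmod (csum (taylor_coef f) n) <= 2 * (A * L)) by lra.
  (* The two halves give 2 A L / (2 PI), and PI >= 3. *)
  replace (2 * M * (1 + (/ r) ^ n) * L) with (A * L / 3) by (unfold A; field).
  pose proof (Cmod_ge_0 (csum (taylor_coef f) n)). nra.
Qed.

Lemma ln_le_Rpower (x e : R) : 0 < x -> 0 < e -> ln x <= Rpower x e / e.
Proof.
  intros Hx He. apply Rle_div_r; [exact He|].
  unfold Rpower. rewrite Rmult_comm. pose proof (exp_ineq1_le (e * ln x)). lra.
Qed.

Definition korenblum_bound (alpha K : R) (f : C -> C) : Prop :=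
  forall z, Cmod z < 1 -> Rpower (1 - Cmod z ^ 2) alpha * Cmod (f z) <= K.

Lemma Rpower_pos (x y : R) : 0 < Rpower x y.
Proof. apply exp_pos. Qed.

Lemma Rle_Rpower_base (x y a : R) : 0 <= a -> 0 < x -> x <= y -> Rpower x a <= Rpower y a.
Proof.
  intros Ha Hx Hxy. unfold Rpower.
  assert (H : a * ln x <= a * ln y).
  { apply Rmult_le_compat_l; [exact Ha|]. destruct Hxy as [H| ->]; [left; apply ln_increasing|]; lra. }
  destruct H as [H| ->]; [left; apply exp_increasing; exact H | lra].
Qed.

Lemma korenblum_bound_le (alpha K : R) (f : C -> C) (z : C) : 0 < alpha ->
  korenblum_bound alpha K f -> Cmod z < 1 -> Cmod (f z) <= K * Rpower (/ (1 - Cmod z)) alpha.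
Proof.
  intros Ha Hf Hz. pose proof (Cmod_ge_0 z).
  assert (H1 : Rpower (1 - Cmod z) alpha <= Rpower (1 - Cmod z ^ 2) alpha).
  { apply Rle_Rpower_base; nra. }
  specialize (Hf z Hz).
  assert (E : Rpower (/ (1 - Cmod z)) alpha = / Rpower (1 - Cmod z) alpha).
  { unfold Rpower. rewrite ln_Rinv by lra. rewrite <- exp_Ropp. f_equal. ring. }
  rewrite E. apply Rle_div_r; [apply Rpower_pos|].
  pose proof (Cmod_ge_0 (f z)). nra.
Qed.

Lemma korenblum_bound_compact (alpha K : R) (f : C -> C) : 0 < alpha -> korenblum_bound alpha K f ->
  forall r, r < 1 -> exists M, forall z, Cmod z <= r -> Cmod (f z) <= M.
Proof.
  intros Ha Hf r Hr. exists (K * Rpower (/ (1 - r)) alpha). intros z Hz.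
  assert (HK : 0 <= K).
  { eapply Rle_trans; [|apply (Hf z); lra]. apply Rmult_le_pos; [left; apply Rpower_pos | apply Cmod_ge_0]. }
  eapply Rle_trans; [apply (korenblum_bound_le alpha K f z Ha Hf); lra|].
  apply Rmult_le_compat_l; [exact HK|]. apply Rle_Rpower_base; [lra| |].
  - apply Rinv_0_lt_compat; lra.
  - apply Rinv_le_contravar; lra.
Qed.

(** The logarithm of the kernel norm is traded for a power [e], as small as desired. The factor 4
    bounds 1 + r^(-n), and 4 + 1/e comes from the logarithmic difference. *)
Lemma taylor_partial_sum_growth (alpha K e : R) (f : C -> C) : 0 < alpha -> 0 < e ->
  analytic_disk f -> korenblum_bound alpha K f ->
  exists K', 0 <= K' /\ forall n, Cmod (csum (taylor_coef f) n) <= K' * Rpower (INR n + 2) (alpha + e).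
Proof.
  intros Ha He Hf HK.
  assert (HK0 : 0 <= K).
  { specialize (HK 0%C ltac:(rewrite Cmod_0; lra)). eapply Rle_trans; [|exact HK].
    apply Rmult_le_pos; [left; apply Rpower_pos | apply Cmod_ge_0]. }
  exists (2 * K * 4 * (4 + / e)). split.
  { assert (0 < / e) by (apply Rinv_0_lt_compat, He). nra. }
  intros n. pose proof (pos_INR n) as Hn. set (x := INR n + 2) in *.
  assert (Hx : 2 <= x) by (unfold x; lra).
  (* The shift by 2 in [x] keeps the radius at least 1/2 already for n = 0, as the estimate on the
     circle demands. *)
  set (r := 1 - / x).
  assert (Hix : 0 < / x <= / 2) by (split; [apply Rinv_0_lt_compat | apply Rinv_le_contravar]; lra).
  assert (Hr : 1 / 2 <= r < 1) by (unfold r; lra).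
  set (s := ln r). assert (Es : exp s = r) by (apply exp_ln; lra).
  assert (Hs : s < 0) by (unfold s; rewrite <- ln_1; apply ln_increasing; lra).
  pose proof (taylor_partial_sum_le f s (K * Rpower x alpha) n Hf Hs) as H. rewrite Es in H.
  specialize (H ltac:(lra)).
  lapply H; [clear H; intro H|].
  2:{ intros zeta Hz. eapply Rle_trans; [apply (korenblum_bound_le alpha K f zeta Ha HK); lra|].
      rewrite Hz. unfold r. replace (1 - (1 - / x)) with (/ x) by ring. rewrite Rinv_inv. lra. }
  eapply Rle_trans; [exact H|].
  (* 1/r = 1 + 1/(n+1), and its n-th power stays below e. *)
  assert (H1 : 0 <= (/ r) ^ n <= 3).
  { split; [apply pow_le; left; apply Rinv_0_lt_compat; lra|].
    assert (Hbase : / r <= exp (/ (INR n + 1))).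
    { replace (/ r) with (1 + / (INR n + 1)).
      - apply exp_ineq1_le.
      - unfold r, x. field. lra. }
    apply Rle_trans with (exp (/ (INR n + 1)) ^ n).
    - apply pow_incr. split; [left; apply Rinv_0_lt_compat; lra | exact Hbase].
    - rewrite <- Rpower_pow by apply exp_pos. unfold Rpower. rewrite ln_exp. apply Rle_trans with (exp 1); [|apply exp_le_3].
      assert (INR n * / (INR n + 1) <= 1) by (apply Rle_div_l; lra).
      destruct H0 as [H0|H0]; [left; apply exp_increasing; lra | right; f_equal; lra]. }
  assert (H2 : 0 <= ln (1 - r + PI) - ln (1 - r) <= (4 + / e) * Rpower x e).
  { unfold r. replace (1 - (1 - / x)) with (/ x) by ring. rewrite ln_Rinv by lra.
    pose proof PI_4. pose proof PI_RGT_0.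
    assert (L0 : ln (/ x) <= ln (/ x + PI)) by (left; apply ln_increasing; lra).
    rewrite ln_Rinv in L0 by lra.
    assert (L1 : ln (/ x + PI) <= 4).
    { apply Rle_trans with (/ x + PI - 1); [|lra].
      pose proof (exp_ineq1_le (ln (/ x + PI))) as H3. rewrite exp_ln in H3; lra. }
    assert (L2 : ln x <= Rpower x e / e) by (apply ln_le_Rpower; lra).
    assert (L3 : 1 <= Rpower x e).
    { rewrite <- (Rpower_O x) by lra. apply Rle_Rpower; lra. }
    unfold Rdiv in L2. split; [lra|]. lra. }
  rewrite Rpower_plus. pose proof (Rpower_pos x alpha). pose proof (Rpower_pos x e).
  set (P := Rpower x alpha) in *. set (Q := (4 + / e) * Rpower x e) in *.
  set (L := ln (1 - r + PI) - ln (1 - r)) in *. set (G := (/ r) ^ n) in *.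
  replace (2 * K * 4 * (4 + / e) * (P * Rpower x e)) with (2 * (K * P) * 4 * Q) by (unfold Q; ring).
  assert (0 <= K * P) by nra.
  apply Rmult_le_compat; [nra | lra | | lra].
  apply Rmult_le_compat_l; [nra | lra].
Qed.

Lemma Rpower_neg_vanishes (g eps : R) : 0 < g -> 0 < eps ->
  exists N, forall n, (N <= n)%nat -> Rpower (INR n + 2) (- g) < eps.
Proof.
  intros Hg He. destruct (INR_unbounded (exp (- ln eps / g))) as [N HN].
  exists N. intros n Hn. apply le_INR in Hn. pose proof (pos_INR n).
  unfold Rpower. rewrite <- (exp_ln eps) at 1 by exact He. apply exp_increasing.
  assert (H0 : - ln eps / g < ln (INR n + 2)).
  { apply exp_lt_inv. rewrite exp_ln; lra. }
  apply Rlt_div_l in H0; [lra | exact Hg].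
Qed.

(** Comparison with a telescoping series: by the mean value theorem (k+2)^(-g) - (k+3)^(-g) = g
    c^(-g-1) >= g (k+3)^(-g-1). *)
Lemma ex_series_Rpower (g : R) : 0 < g -> ex_series (fun k => Rpower (INR k + 3) (- g - 1)).
Proof.
  intros Hg. set (w := fun k => Rpower (INR k + 2) (- g)).
  assert (Hw : is_series (fun k => w k - w (S k)) (w 0%nat)).
  { apply (filterlim_ext (fun n => w 0%nat - w (S n))).
    - intros n. induction n as [|n IH]; [rewrite sum_O; reflexivity|].
      rewrite sum_Sn, <- IH. unfold plus; simpl. ring.
    - apply filterlim_locally. intros eps.
      destruct (Rpower_neg_vanishes g eps Hg (cond_pos eps)) as [N HN].
      exists N. intros n Hn. change (Rabs (w 0%nat - w (S n) - w 0%nat) < eps).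
      replace (w 0%nat - w (S n) - w 0%nat) with (- w (S n)) by ring.
      rewrite Rabs_Ropp, Rabs_pos_eq by (left; apply Rpower_pos). apply HN. lia. }
  apply (ex_series_le (K := R_AbsRing) (V := R_CompleteNormedModule) _ (fun k => / g * (w k - w (S k)))).
  - intros k. pose proof (pos_INR k) as Hk.
    change (Rabs (Rpower (INR k + 3) (- g - 1)) <= / g * (w k - w (S k))).
    rewrite Rabs_pos_eq by (left; apply Rpower_pos).
    unfold w. rewrite S_INR.
    destruct (MVT_cor2 (fun x => Rpower x (- g)) (fun x => - g * Rpower x (- g - 1)) (INR k + 2) (INR k + 3)) as (c & E & Hc).
    + lra.
    + intros c Hc. apply is_derive_Reals. unfold Rpower. auto_derive; [lra|].
      replace ((- g - 1) * ln c) with (- g * ln c + - ln c) by ring.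
      rewrite exp_plus, exp_Ropp, exp_ln by lra. field. lra.
    + replace (INR k + 1 + 2) with (INR k + 3) by ring.
      replace (Rpower (INR k + 2) (- g) - Rpower (INR k + 3) (- g)) with (g * Rpower c (- g - 1)) by lra.
      rewrite <- Rmult_assoc, Rinv_l, Rmult_1_l by lra.
      unfold Rpower. assert (ln c < ln (INR k + 3)) by (apply ln_increasing; lra).
      left. apply exp_increasing. nra.
  - apply (ex_series_scal_l (K := R_AbsRing) (/ g) (fun k => w k - w (S k))). exists (w 0%nat). exact Hw.
Qed.

Lemma csum_by_parts (a v : nat -> C) (n : nat) :
  csum (fun k => a k * v k)%C n =
  (csum a n * v n + csum (fun k => csum a (S k) * (v k - v (S k))) n)%C.
Proof.
  induction n as [|n IH]; [simpl; ring|].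
  change (csum (fun k => a k * v k)%C (S n)) with (csum (fun k => a k * v k)%C n + a n * v n)%C.
  rewrite IH. simpl. ring.
Qed.

(** Partial sums O(k^beta) against differences of 1/(n+k+1), which are O(k^(-2)), give an absolutely
    convergent series; the boundary term is O(m^(beta-1)). Both need beta < 1. *)
Lemma hilbert_series_converge (alpha K : R) (f : C -> C) (n : nat) : 0 < alpha < 1 ->
  analytic_disk f -> korenblum_bound alpha K f ->
  exists b : C, is_series (K := C_AbsRing) (V := C_NormedModule)
    (fun k : nat => (taylor_coef f k / RtoC (INR (n + k + 1)))%C) b.
Proof.
  intros Ha Hf HK. set (e := (1 - alpha) / 2).
  destruct (taylor_partial_sum_growth alpha K e f ltac:(lra) ltac:(unfold e; lra) Hf HK) as (K' & HK' & HS).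
  set (a := taylor_coef f) in *. set (beta := alpha + e) in *.
  assert (Hbeta : 0 < beta < 1) by (unfold beta, e; lra).
  set (v := fun k => RtoC (/ INR (n + k + 1))).
  assert (Hpos : forall k, 0 < INR (n + k + 1)) by (intros k; apply lt_0_INR; lia).
  assert (Hlow : forall k, INR k + 1 <= INR (n + k + 1)).
  { intros k. rewrite !plus_INR. simpl. pose proof (pos_INR n). lra. }
  assert (Hd : forall k, Cmod (v k - v (S k)) <= 6 / (INR k + 3) ^ 2).
  { intros k. unfold v. rewrite <- RtoC_minus, Cmod_R.
    replace (n + S k + 1)%nat with (S (n + k + 1)) by lia. rewrite S_INR.
    set (m := INR (n + k + 1)). assert (Hm : INR k + 1 <= m) by apply Hlow.
    pose proof (pos_INR k).
    replace (/ m - / (m + 1)) with (/ (m * (m + 1))) by (field; lra).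
    rewrite Rabs_pos_eq by (left; apply Rinv_0_lt_compat; nra).
    apply Rle_trans with (/ ((INR k + 1) * (INR k + 2))).
    - apply Rinv_le_contravar; nra.
    - apply Rle_div_r; [nra|]. rewrite Rmult_comm. apply Rle_div_l; nra. }
  assert (Hsplit : forall x, 0 < x -> Rpower x beta / x ^ 2 = Rpower x (- (1 - beta) - 1)).
  { intros x Hx. replace (- (1 - beta) - 1) with (beta + Ropp 2) by ring. rewrite Rpower_plus, Rpower_Ropp.
    unfold Rdiv. f_equal. f_equal. replace 2 with (INR 2) by (simpl; ring). symmetry. apply Rpower_pow, Hx. }
  destruct (ex_series_le (K := C_AbsRing) (V := C_CompleteNormedModule)
    (fun k => csum a (S k) * (v k - v (S k)))%C
    (fun k => (6 * K') * Rpower (INR k + 3) (- (1 - beta) - 1))) as [b Hb].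
  { intros k. change (Cmod (csum a (S k) * (v k - v (S k))) <= (6 * K') * Rpower (INR k + 3) (- (1 - beta) - 1)).
    rewrite Cmod_mult. pose proof (pos_INR k). specialize (HS (S k)). rewrite S_INR in HS.
    replace (INR k + 1 + 2) with (INR k + 3) in HS by ring.
    rewrite <- Hsplit by lra.
    apply Rle_trans with ((K' * Rpower (INR k + 3) beta) * (6 / (INR k + 3) ^ 2)).
    - apply Rmult_le_compat; auto using Cmod_ge_0.
    - right. field. lra. }
  { apply (ex_series_scal_l (K := R_AbsRing) (6 * K') (fun k => Rpower (INR k + 3) (- (1 - beta) - 1))). apply ex_series_Rpower. lra. }
  exists b. apply is_cseries_eps.
  intros eps Heps.
  destruct (proj1 (is_cseries_eps _ b) Hb (eps / 2) ltac:(lra)) as [N1 HN1].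
  destruct (Rpower_neg_vanishes (1 - beta) (eps / 2 / (2 * K' + 1)) ltac:(lra)) as [N2 HN2].
  { apply Rdiv_lt_0_compat; lra. }
  exists (Nat.max N1 N2). intros m Hm.
  specialize (HN1 m ltac:(lia)). specialize (HN2 m ltac:(lia)).
  rewrite (csum_ext _ (fun k => a k * v k)%C).
  2:{ intros k _. unfold v, Cdiv. rewrite RtoC_inv; [reflexivity|]. specialize (Hpos k). lra. }
  rewrite csum_by_parts.
  match goal with |- Cmod (?x + ?y - b) < _ => replace (x + y - b)%C with (x + (y - b))%C by ring end.
  eapply Rle_lt_trans; [apply Cmod_triangle|].
  assert (Hbd : Cmod (csum a m * v m) < eps / 2).
  { rewrite Cmod_mult. unfold v. pose proof (pos_INR m). specialize (Hlow m).
    rewrite Cmod_R, Rabs_pos_eq by (left; apply Rinv_0_lt_compat, Hpos).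
    apply Rle_lt_trans with (K' * Rpower (INR m + 2) beta * (2 / (INR m + 2))).
    - apply Rmult_le_compat; [apply Cmod_ge_0 | left; apply Rinv_0_lt_compat, Hpos | apply HS |].
      apply Rle_trans with (/ (INR m + 1)); [apply Rinv_le_contravar; lra|].
      apply Rle_div_r; [lra|]. rewrite Rmult_comm. apply Rle_div_l; lra.
    - replace (K' * Rpower (INR m + 2) beta * (2 / (INR m + 2))) with (2 * K' * Rpower (INR m + 2) (- (1 - beta))).
      + apply Rlt_div_r in HN2; [|lra]. pose proof (Rpower_pos (INR m + 2) (- (1 - beta))). nra.
      + replace (- (1 - beta)) with (beta + Ropp 1) by ring.
        rewrite Rpower_plus, Rpower_Ropp, Rpower_1 by lra. field. lra. }
  lra.
Qed.

(** * The real integrals *)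

Lemma ex_RInt_half_open (h : R -> R) (a b : R) :
  (forall t, 0 <= t < 1 -> continuous h t) -> 0 <= a -> a <= b -> b < 1 -> ex_RInt h a b.
Proof.
  intros Hc Ha Hab Hb. apply (ex_RInt_continuous (V := R_CompleteNormedModule)).
  rewrite Rmin_left, Rmax_right by exact Hab. intros t Ht. apply Hc. lra.
Qed.

Lemma RInt_nonneg_mono (h : R -> R) (x y : R) :
  (forall t, 0 <= t < 1 -> continuous h t) -> (forall t, 0 <= t < 1 -> 0 <= h t) ->
  0 <= x -> x <= y -> y < 1 -> RInt h 0 x <= RInt h 0 y.
Proof.
  intros Hc Hp Hx Hxy Hy.
  rewrite <- (RInt_Chasles (V := R_CompleteNormedModule) h 0 x y) by (apply ex_RInt_half_open; auto; lra).
  change (RInt h 0 x <= RInt h 0 x + RInt h x y).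
  assert (0 <= RInt h x y); [|lra].
  apply RInt_ge_0; [exact Hxy | apply ex_RInt_half_open; auto|]. intros t Ht. apply Hp. lra.
Qed.

(** For a nonnegative integrand the improper integral is the supremum of the integrals over [0,x].
    Hence a uniform bound on these yields convergence, and all comparisons can be made on [0,x] with
    x < 1. *)
Lemma int01_nonneg (h : R -> R) (M : R) :
  (forall t, 0 <= t < 1 -> continuous h t) -> (forall t, 0 <= t < 1 -> 0 <= h t) ->
  (forall x, 0 <= x < 1 -> RInt h 0 x <= M) ->
  ex_int01 h /\ (forall x, 0 <= x < 1 -> RInt h 0 x <= int01 h) /\ int01 h <= M.
Proof.
  intros Hc Hp HM.
  destruct (completeness (fun y => exists x, 0 <= x < 1 /\ y = RInt h 0 x)) as [l [Hub Hlub]].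
  { exists M. intros y (x & Hx & ->). apply HM, Hx. }
  { exists (RInt h 0 0), 0. split; [lra | reflexivity]. }
  assert (Hl : is_RInt_gen h (at_point 0) (at_left 1) l).
  { intros P [eps HP].
    assert (Hx0 : exists x0, 0 <= x0 < 1 /\ l - eps < RInt h 0 x0).
    { apply NNPP. intros Hno. apply (Rlt_not_le l (l - eps)); [pose proof (cond_pos eps); lra|].
      apply Hlub. intros y (x & Hx & ->). apply Rnot_lt_le. intros Hlt. apply Hno. exists x. auto. }
    destruct Hx0 as (x0 & Hx0 & Hlt).
    apply (Filter_prod _ _ _ (fun a => a = 0) (fun b => x0 < b < 1)).
    - reflexivity.
    - assert (Hd : 0 < 1 - x0) by lra. exists (mkposreal _ Hd). intros b Hb Hb1.
      change (Rabs (b - 1) < 1 - x0) in Hb. apply Rabs_lt_between in Hb. lra.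
    - intros a b -> Hb. exists (RInt h 0 b). split.
      + apply (RInt_correct (V := R_CompleteNormedModule)). apply ex_RInt_half_open; auto; simpl; lra.
      + apply HP. change (Rabs (RInt h 0 b - l) < eps).
        assert (RInt h 0 x0 <= RInt h 0 b) by (apply RInt_nonneg_mono; auto; lra).
        assert (RInt h 0 b <= l) by (apply Hub; exists b; split; [lra | reflexivity]).
        apply Rabs_lt_between. pose proof (cond_pos eps). lra. }
  assert (E : int01 h = l).
  { unfold int01. apply is_RInt_gen_unique; try typeclasses eauto. exact Hl. }
  rewrite E. split; [exists l; exact Hl|]. split.
  - intros x Hx. apply Hub. exists x. auto.
  - apply Hlub. intros y (x & Hx & ->). apply HM, Hx.
Qed.

Lemma log_factor_eq (alpha x : R) : 0 < x -> log_factor alpha x = ln 2 + / alpha - ln x.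
Proof.
  intros Hx. unfold log_factor. pose proof (exp_pos (1 / alpha)).
  rewrite ln_div, ln_mult, ln_exp by lra. unfold Rdiv. ring.
Qed.

Lemma ln_nonpos (x : R) : 0 < x <= 1 -> ln x <= 0.
Proof. intros [H1 [H2| ->]]; [left; rewrite <- ln_1; apply ln_increasing; assumption | rewrite ln_1; lra]. Qed.

Lemma ln_2_pos : 0 < ln 2.
Proof. rewrite <- ln_1. apply ln_increasing; lra. Qed.

(** The summand 1/alpha alone exceeds 1. Thus the weight is positive, and dropping the logarithm
    from a denominator gives an upper bound. *)
Lemma log_factor_ge_1 (alpha x : R) : 0 < alpha < 1 -> 0 < x <= 1 -> 1 <= log_factor alpha x.
Proof.
  intros Ha Hx. rewrite log_factor_eq by lra. pose proof (ln_nonpos x Hx). pose proof ln_2_pos.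
  assert (1 < / alpha) by (rewrite <- Rinv_1; apply Rinv_lt_contravar; lra). lra.
Qed.

Lemma lower_integrand_pos (alpha t : R) : 0 < alpha < 1 -> 0 <= t < 1 -> 0 < lower_integrand alpha t.
Proof.
  intros Ha Ht. unfold lower_integrand. pose proof (log_factor_ge_1 alpha (1 - t ^ 2) Ha ltac:(nra)).
  apply Rdiv_lt_0_compat; [lra|]. apply Rmult_lt_0_compat; [apply Rpower_pos | lra].
Qed.

Lemma continuous_Rpower (u : R -> R) (t a : R) :
  0 < u t -> continuous u t -> continuous (fun x => Rpower (u x) a) t.
Proof.
  intros Hu Hc. apply (continuous_comp u (fun y => Rpower y a)); [exact Hc|].
  apply (ex_derive_continuous (K := R_AbsRing) (V := R_NormedModule)). unfold Rpower. auto_derive. exact Hu.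
Qed.

Lemma continuous_log_factor (u : R -> R) (t alpha : R) :
  0 < u t -> continuous u t -> continuous (fun x => log_factor alpha (u x)) t.
Proof.
  intros Hu Hc. apply (continuous_comp u (log_factor alpha)); [exact Hc|].
  apply (ex_derive_continuous (K := R_AbsRing) (V := R_NormedModule)).
  unfold log_factor. pose proof (exp_pos (1 / alpha)) as He. set (E := exp (1 / alpha)) in *. clearbody E.
  auto_derive. split; [lra|]. split; [|exact I].
  apply Rmult_lt_0_compat; [lra | apply Rinv_0_lt_compat; exact Hu].
Qed.

Lemma continuous_Rdiv (u v : R -> R) (t : R) :
  v t <> 0 -> continuous u t -> continuous v t -> continuous (fun x => u x / v x) t.
Proof.
  intros Hv Hu Hc. apply (continuous_mult (K := R_AbsRing) u (fun x => / v x)); [exact Hu|].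
  apply (continuous_comp v Rinv); [exact Hc | apply continuous_Rinv, Hv].
Qed.

Lemma lower_integrand_continuous (alpha t : R) : 0 < alpha < 1 -> 0 <= t < 1 ->
  continuous (lower_integrand alpha) t.
Proof.
  intros Ha Ht. pose proof (log_factor_ge_1 alpha (1 - t ^ 2) Ha ltac:(nra)) as Hlf.
  pose proof (Rpower_pos (1 - t ^ 2) alpha).
  assert (Hc : continuous (fun x => 1 - x ^ 2) t).
  { apply (ex_derive_continuous (K := R_AbsRing) (V := R_NormedModule)). auto_derive. exact I. }
  unfold lower_integrand. apply continuous_Rdiv.
  - apply Rmult_integral_contrapositive_currified; lra.
  - apply continuous_const.
  - apply (continuous_mult (K := R_AbsRing)); [apply continuous_Rpower | apply continuous_log_factor];
      try exact Hc; nra.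
Qed.

Lemma lower_integrand_le (alpha t : R) : 0 < alpha < 1 -> 0 <= t < 1 ->
  lower_integrand alpha t <= Rpower (1 - t) (- alpha).
Proof.
  intros Ha Ht. unfold lower_integrand.
  pose proof (log_factor_ge_1 alpha (1 - t ^ 2) Ha ltac:(nra)) as Hlf.
  assert (H1 : Rpower (1 - t) alpha <= Rpower (1 - t ^ 2) alpha) by (apply Rle_Rpower_base; nra).
  rewrite Rpower_Ropp. unfold Rdiv. rewrite Rmult_1_l.
  pose proof (Rpower_pos (1 - t) alpha).
  apply Rinv_le_contravar; [assumption|]. nra.
Qed.

(** The majorant F(t) / (1 - t |z|) of the overview at |z| = r, before the change of variable. *)
Definition hilbert_integrand (alpha r t : R) : R := lower_integrand alpha t / (1 - t * r).

Lemma hilbert_integrand_nonneg (alpha r t : R) : 0 < alpha < 1 -> 0 <= r < 1 -> 0 <= t < 1 ->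
  0 <= hilbert_integrand alpha r t.
Proof.
  intros Ha Hr Ht. pose proof (lower_integrand_pos alpha t Ha Ht).
  left. apply Rdiv_lt_0_compat; [assumption | nra].
Qed.

Lemma hilbert_integrand_continuous (alpha r t : R) : 0 < alpha < 1 -> 0 <= r < 1 -> 0 <= t < 1 ->
  continuous (hilbert_integrand alpha r) t.
Proof.
  intros Ha Hr Ht. apply (continuous_mult (K := R_AbsRing) (lower_integrand alpha) (fun t => / (1 - t * r))).
  - apply lower_integrand_continuous; assumption.
  - apply (ex_derive_continuous (K := R_AbsRing) (V := R_NormedModule)). auto_derive. nra.
Qed.

Lemma is_RInt_Rpower_one_minus (p a b : R) : p <> 0 -> a <= b -> b < 1 ->
  is_RInt (fun t => Rpower (1 - t) (p - 1)) a b ((Rpower (1 - a) p - Rpower (1 - b) p) / p).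
Proof.
  intros Hp Hab Hb.
  assert (E : (Rpower (1 - a) p - Rpower (1 - b) p) / p =
    - Rpower (1 - b) p / p - (- Rpower (1 - a) p / p)) by (field; exact Hp).
  rewrite E.
  apply (is_RInt_derive (V := R_CompleteNormedModule) (fun t => - Rpower (1 - t) p / p));
    rewrite Rmin_left, Rmax_right by lra; intros x Hx.
  - unfold Rpower. auto_derive; [lra|].
    replace ((p - 1) * ln (1 - x)) with (p * ln (1 - x) + - ln (1 - x)) by ring.
    change (1 + - x) with (1 - x). rewrite exp_plus, exp_Ropp, exp_ln by lra. field. split; [lra | exact Hp].
  - apply (ex_derive_continuous (K := R_AbsRing) (V := R_NormedModule)). unfold Rpower. auto_derive. lra.
Qed.

(** Split at t = r. Below it 1 - t r >= 1 - t leaves (1-t)^(-alpha-1), which yields the term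
    1/alpha; above it 1 - t r >= 1 - r leaves (1-t)^(-alpha) / (1-r), which yields 1/(1-alpha). *)
Lemma RInt_hilbert_integrand_bound (alpha r x : R) : 0 < alpha < 1 -> 0 <= r < 1 -> 0 <= x < 1 ->
  RInt (hilbert_integrand alpha r) 0 x <= Rpower (1 - r) (- alpha) * (/ alpha + / (1 - alpha)).
Proof.
  intros Ha Hr Hx.
  assert (Hc : forall t, 0 <= t < 1 -> continuous (hilbert_integrand alpha r) t)
    by (intros; apply hilbert_integrand_continuous; assumption).
  assert (Hp : forall t, 0 <= t < 1 -> 0 <= hilbert_integrand alpha r t)
    by (intros; apply hilbert_integrand_nonneg; assumption).
  (* The integrand is nonnegative, so the interval may be enlarged until it contains the splitting
     point r. *)
  set (y := Rmax x r). assert (Hy : x <= y /\ r <= y /\ y < 1).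
  { unfold y. split; [apply Rmax_l|]. split; [apply Rmax_r|]. apply Rmax_lub_lt; lra. }
  apply Rle_trans with (RInt (hilbert_integrand alpha r) 0 y).
  { apply RInt_nonneg_mono; auto; lra. }
  rewrite <- (RInt_Chasles (V := R_CompleteNormedModule) _ 0 r y) by (apply ex_RInt_half_open; auto; lra).
  change (RInt (hilbert_integrand alpha r) 0 r + RInt (hilbert_integrand alpha r) r y
    <= Rpower (1 - r) (- alpha) * (/ alpha + / (1 - alpha))).
  assert (B : forall t, 0 <= t < 1 -> forall q, 0 < q -> q <= 1 - t * r ->
    hilbert_integrand alpha r t <= Rpower (1 - t) (- alpha) * / q).
  { intros t Ht q Hq Hqt. unfold hilbert_integrand, Rdiv.
    pose proof (lower_integrand_pos alpha t Ha Ht). pose proof (lower_integrand_le alpha t Ha Ht).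
    apply Rmult_le_compat; [lra | left; apply Rinv_0_lt_compat; lra | lra | apply Rinv_le_contravar; lra]. }
  assert (I1 : RInt (hilbert_integrand alpha r) 0 r <= Rpower (1 - r) (- alpha) * / alpha).
  { pose proof (is_RInt_Rpower_one_minus (- alpha) 0 r ltac:(lra) ltac:(lra) ltac:(lra)) as HI.
    eapply Rle_trans.
    - apply RInt_le with (g := fun t => Rpower (1 - t) (- alpha - 1)); [lra | apply ex_RInt_half_open; auto; lra | eexists; exact HI|].
      intros t Ht. eapply Rle_trans; [apply (B t ltac:(lra) (1 - t)); nra|].
      replace (- alpha - 1) with (- alpha + Ropp 1) by ring. rewrite Rpower_plus, (Rpower_Ropp _ 1), Rpower_1 by lra. lra.
    - rewrite (is_RInt_unique _ _ _ _ HI). rewrite Rminus_0_r.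
      pose proof (Rpower_pos 1 (- alpha)).
      replace ((Rpower 1 (- alpha) - Rpower (1 - r) (- alpha)) / - alpha) with
        ((Rpower (1 - r) (- alpha) - Rpower 1 (- alpha)) * / alpha) by (field; lra).
      apply Rmult_le_compat_r; [left; apply Rinv_0_lt_compat; lra | lra]. }
  assert (I2 : RInt (hilbert_integrand alpha r) r y <= Rpower (1 - r) (- alpha) * / (1 - alpha)).
  { pose proof (is_RInt_Rpower_one_minus (1 - alpha) r y ltac:(lra) ltac:(lra) ltac:(lra)) as HI.
    apply (is_RInt_scal (V := R_NormedModule) _ _ _ (/ (1 - r))) in HI.
    eapply Rle_trans.
    - apply RInt_le with (g := fun t => scal (/ (1 - r)) (Rpower (1 - t) (1 - alpha - 1))); [lra | apply ex_RInt_half_open; auto; lra | eexists; exact HI|].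
      intros t Ht. eapply Rle_trans; [apply (B t ltac:(lra) (1 - r)); nra|].
      replace (1 - alpha - 1) with (- alpha) by ring. right. apply Rmult_comm.
    - eapply Rle_trans; [right; exact (is_RInt_unique (V := R_CompleteNormedModule) _ _ _ _ HI)|].
      change (/ (1 - r) * ((Rpower (1 - r) (1 - alpha) - Rpower (1 - y) (1 - alpha)) / (1 - alpha))
        <= Rpower (1 - r) (- alpha) * / (1 - alpha)).
      replace (Rpower (1 - r) (- alpha)) with (/ (1 - r) * Rpower (1 - r) (1 - alpha)).
      2:{ replace (1 - alpha) with (1 + - alpha) by ring. rewrite Rpower_plus, Rpower_1 by lra. field. lra. }
      pose proof (Rpower_pos (1 - y) (1 - alpha)).
      unfold Rdiv. rewrite <- Rmult_assoc.
      apply Rmult_le_compat_r; [left; apply Rinv_0_lt_compat; lra|].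
      apply Rmult_le_compat_l; [left; apply Rinv_0_lt_compat; lra | lra]. }
  lra.
Qed.

Definition phi (r t : R) : R := t / (1 - (1 - t) * r).

Lemma phi_range (r t : R) : 0 <= r < 1 -> 0 <= t < 1 -> 0 <= phi r t < 1.
Proof.
  intros Hr Ht. unfold phi. assert (0 < 1 - (1 - t) * r) by nra. split.
  - apply Rdiv_le_0_compat; lra.
  - apply Rlt_div_l; nra.
Qed.

(** With D = 1 - (1-t) r one has D - t = (1-t)(1-r), hence 1 - phi^2 = (1-t)(1-r)(D+t) / D^2 and 1 -
    r phi = (1-r) / D. The factor (1-r) / D^2 is the derivative of [phi r]. *)
Lemma norm_integrand_phi (alpha r t : R) : 0 < alpha < 1 -> 0 <= r < 1 -> 0 <= t < 1 ->
  norm_integrand alpha r t = Rpower (1 - r ^ 2) alpha *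
    ((1 - r) / (1 - (1 - t) * r) ^ 2 * hilbert_integrand alpha r (phi r t)).
Proof.
  intros Ha Hr Ht. unfold norm_integrand, hilbert_integrand, lower_integrand.
  fold (phi r t). set (lf := log_factor alpha (1 - phi r t ^ 2)).
  assert (Hlf : 0 < lf).
  { pose proof (phi_range r t Hr Ht). pose proof (log_factor_ge_1 alpha (1 - phi r t ^ 2) Ha ltac:(nra)). unfold lf. lra. }
  clearbody lf.
  set (D := 1 - (1 - t) * r). assert (HD : 0 < D) by (unfold D; nra).
  assert (HDt : 0 < D + t) by lra.
  replace ((t - 1) * r + 1) with D by (unfold D; ring).
  assert (E1 : 1 - phi r t ^ 2 = (1 - t) * ((1 - r) * (D + t)) / (D * D)).
  { unfold phi. fold D. unfold D in *. field. lra. }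
  assert (E2 : 1 - phi r t * r = (1 - r) / D).
  { unfold phi. fold D. unfold D in *. field. lra. }
  rewrite E1, E2.
  replace (1 - r ^ 2) with ((1 + r) * (1 - r)) by ring.
  rewrite <- (Rpower_mult_distr (1 + r) (1 - r)) by lra.
  assert (P1 : Rpower ((1 - t) * ((1 - r) * (D + t)) / (D * D)) alpha =
    Rpower (1 - t) alpha * (Rpower (1 - r) alpha * Rpower (D + t) alpha) / (Rpower D alpha * Rpower D alpha)).
  { assert (P0 : 0 < (1 - r) * (D + t)) by (apply Rmult_lt_0_compat; lra).
    assert (P00 : 0 < D * D) by (apply Rmult_lt_0_compat; lra).
    unfold Rdiv. rewrite <- Rpower_mult_distr; [|apply Rmult_lt_0_compat; lra | apply Rinv_0_lt_compat; exact P00].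
    rewrite <- (Rpower_mult_distr (1 - t)) by lra. rewrite <- (Rpower_mult_distr (1 - r)) by lra.
    f_equal. rewrite Rpower_mult_distr by lra. unfold Rpower. rewrite ln_Rinv by exact P00.
    rewrite <- exp_Ropp. f_equal. ring. }
  rewrite P1.
  assert (P2 : Rpower D (2 * alpha - 1) = Rpower D alpha * Rpower D alpha / D).
  { replace (2 * alpha - 1) with (alpha + alpha + Ropp 1) by ring.
    rewrite !Rpower_plus, Rpower_Ropp, Rpower_1 by exact HD. reflexivity. }
  rewrite P2.
  pose proof (Rpower_pos (1 - t) alpha). pose proof (Rpower_pos (1 - r) alpha).
  pose proof (Rpower_pos (D + t) alpha). pose proof (Rpower_pos D alpha).
  field. repeat split; lra.
Qed.

Lemma phi_derive (r t : R) : 0 <= r < 1 -> 0 <= t -> is_derive (phi r) t ((1 - r) / (1 - (1 - t) * r) ^ 2).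
Proof.
  intros Hr Ht. assert (0 < 1 - (1 - t) * r) by nra.
  unfold phi. auto_derive; [lra|]. field. lra.
Qed.

Lemma RInt_norm_integrand (alpha r x : R) : 0 < alpha < 1 -> 0 <= r < 1 -> 0 <= x < 1 ->
  RInt (norm_integrand alpha r) 0 x =
  Rpower (1 - r ^ 2) alpha * RInt (hilbert_integrand alpha r) 0 (phi r x).
Proof.
  intros Ha Hr Hx. apply (is_RInt_unique (V := R_CompleteNormedModule)).
  apply (is_RInt_ext (fun t => scal (Rpower (1 - r ^ 2) alpha)
    (scal ((1 - r) / (1 - (1 - t) * r) ^ 2) (hilbert_integrand alpha r (phi r t))))).
  { rewrite Rmin_left, Rmax_right by lra. intros t Ht. symmetry. apply norm_integrand_phi; lra || assumption. }
  apply (is_RInt_scal (V := R_NormedModule)).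
  replace 0 with (phi r 0) at 2 by (unfold phi, Rdiv; ring).
  apply (is_RInt_comp (V := R_CompleteNormedModule) (hilbert_integrand alpha r) (phi r));
    rewrite Rmin_left, Rmax_right by lra; intros t Ht.
  - apply hilbert_integrand_continuous; [assumption | assumption | apply phi_range; lra].
  - split; [apply phi_derive; lra|].
    apply (ex_derive_continuous (K := R_AbsRing) (V := R_NormedModule)).
    assert (0 < 1 - (1 - t) * r) by nra. auto_derive.
    apply Rgt_not_eq. assert (0 < (1 - (1 - t) * r) ^ 2) by (apply pow_lt; assumption). simpl in *. unfold Rminus in *. lra.
Qed.

Lemma norm_integrand_continuous (alpha r t : R) : 0 < alpha < 1 -> 0 <= r < 1 -> 0 <= t < 1 ->
  continuous (norm_integrand alpha r) t.
Proof.
  intros Ha Hr Ht. pose proof (phi_range r t Hr Ht) as Hphi.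
  assert (Hq : 0 < 1 - phi r t ^ 2 <= 1) by nra.
  pose proof (log_factor_ge_1 alpha (1 - phi r t ^ 2) Ha Hq) as Hlf.
  assert (HD : 0 < 1 - (1 - t) * r) by nra.
  pose proof (Rpower_pos (1 - t) alpha). pose proof (Rpower_pos ((t - 1) * r + 1 + t) alpha).
  assert (Hphic : continuous (fun x => 1 - phi r x ^ 2) t).
  { apply (ex_derive_continuous (K := R_AbsRing) (V := R_NormedModule)). unfold phi. auto_derive. lra. }
  unfold norm_integrand. apply continuous_Rdiv.
  - apply Rmult_integral_contrapositive_currified; [apply Rmult_integral_contrapositive_currified; lra|].
    fold (phi r t). lra.
  - apply (continuous_mult (K := R_AbsRing)); [apply continuous_const|].
    apply continuous_Rpower; [nra|].
    apply (ex_derive_continuous (K := R_AbsRing) (V := R_NormedModule)). auto_derive. exact I.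
  - apply (continuous_mult (K := R_AbsRing)); [apply (continuous_mult (K := R_AbsRing))|].
    + apply continuous_Rpower; [lra|].
      apply (ex_derive_continuous (K := R_AbsRing) (V := R_NormedModule)). auto_derive. exact I.
    + apply continuous_Rpower; [nra|].
      apply (ex_derive_continuous (K := R_AbsRing) (V := R_NormedModule)). auto_derive. exact I.
    + apply (continuous_log_factor (fun x => 1 - phi r x ^ 2)); [lra | exact Hphic].
Qed.

Lemma norm_integrand_nonneg (alpha r t : R) : 0 < alpha < 1 -> 0 <= r < 1 -> 0 <= t < 1 ->
  0 <= norm_integrand alpha r t.
Proof.
  intros Ha Hr Ht. rewrite norm_integrand_phi by assumption.
  apply Rmult_le_pos; [left; apply Rpower_pos|]. apply Rmult_le_pos.
  - apply Rdiv_le_0_compat; [lra|]. apply pow_lt. nra.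
  - apply hilbert_integrand_nonneg; [assumption | assumption | apply phi_range; assumption].
Qed.

Lemma int01_norm_integrand (alpha r M : R) : 0 < alpha < 1 -> 0 <= r < 1 ->
  (forall x, 0 <= x < 1 -> Rpower (1 - r ^ 2) alpha * RInt (hilbert_integrand alpha r) 0 x <= M) ->
  ex_int01 (norm_integrand alpha r) /\
  (forall x, 0 <= x < 1 ->
     Rpower (1 - r ^ 2) alpha * RInt (hilbert_integrand alpha r) 0 x <= int01 (norm_integrand alpha r)) /\
  int01 (norm_integrand alpha r) <= M.
Proof.
  intros Ha Hr HM.
  destruct (int01_nonneg (norm_integrand alpha r) M) as (H1 & H2 & H3).
  - intros; apply norm_integrand_continuous; assumption.
  - intros; apply norm_integrand_nonneg; assumption.
  - intros x Hx. rewrite RInt_norm_integrand by assumption. apply HM. apply phi_range; assumption.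
  - split; [exact H1|]. split; [|exact H3].
    (* The preimage of x under [phi r]: since [0,1) is mapped onto itself, every truncation of one
       integral is a truncation of the other. *)
    intros x Hx. set (t := x * (1 - r) / (1 - x * r)).
    assert (Hd : 0 < 1 - x * r) by nra.
    assert (Ht : 0 <= t < 1).
    { unfold t. split; [apply Rdiv_le_0_compat; nra | apply Rlt_div_l; nra]. }
    assert (E : phi r t = x).
    { unfold phi, t. field. split; [lra|]. nra. }
    rewrite <- E at 1. rewrite <- RInt_norm_integrand by assumption. apply H2, Ht.
Qed.

(** A crude bound uniform in r, for finiteness only: (1 - r^2)^alpha (1 - r)^(-alpha) = (1 +
    r)^alpha <= 2, times the two pieces of the split integral. *)
Definition norm_const (alpha : R) : R := 2 * (/ alpha + / (1 - alpha)).

Lemma weighted_hilbert_integral_bound (alpha r x : R) : 0 < alpha < 1 -> 0 <= r < 1 -> 0 <= x < 1 ->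
  Rpower (1 - r ^ 2) alpha * RInt (hilbert_integrand alpha r) 0 x <= norm_const alpha.
Proof.
  intros Ha Hr Hx. pose proof (RInt_hilbert_integrand_bound alpha r x Ha Hr Hx) as H.
  assert (H0 : 0 < / alpha + / (1 - alpha)) by (apply Rplus_lt_0_compat; apply Rinv_0_lt_compat; lra).
  pose proof (Rpower_pos (1 - r ^ 2) alpha).
  apply Rle_trans with (Rpower (1 - r ^ 2) alpha * (Rpower (1 - r) (- alpha) * (/ alpha + / (1 - alpha)))).
  { apply Rmult_le_compat_l; lra. }
  rewrite <- Rmult_assoc. apply Rmult_le_compat_r; [lra|].
  replace (1 - r ^ 2) with ((1 + r) * (1 - r)) by ring.
  rewrite <- Rpower_mult_distr by lra. rewrite Rmult_assoc, <- Rpower_plus.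
  replace (alpha + - alpha) with 0 by ring. rewrite Rpower_O, Rmult_1_r by lra.
  apply Rle_trans with (Rpower 2 alpha); [apply Rle_Rpower_base; lra|].
  rewrite <- (Rpower_1 2) at 2 by lra. apply Rle_Rpower; lra.
Qed.

(** * Abel's theorem and the coefficients of the image *)

Lemma CV_radius_ge_1 (a : nat -> R) :
  (forall x, 0 <= x < 1 -> ex_pseries a x) -> Rbar_le 1 (CV_radius a).
Proof.
  intros H. apply Rbar_not_lt_le. intros Hlt.
  pose proof (CV_radius_ge_0 a) as H0.
  destruct (CV_radius a) as [c| |] eqn:E; simpl in *; try tauto.
  apply (CV_disk_outside a ((c + 1) / 2)).
  - rewrite E. simpl. rewrite Rabs_pos_eq; lra.
  - apply ex_series_lim_0. exact (proj1 (ex_pseries_R a _) (H ((c + 1) / 2) ltac:(lra))).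
Qed.

(** Abel's theorem proper covers radius of convergence 1; for a larger radius the claim is
    continuity at 1. *)
Lemma abel_at_1 (c : nat -> R) (l : R) :
  Rbar_le 1 (CV_radius c) -> is_series c l -> filterlim (PSeries c) (at_left 1) (locally l).
Proof.
  intros Hc Hl.
  assert (Hp : is_pseries c 1 l).
  { apply is_pseries_R. apply is_series_ext with (2 := Hl). intros n. rewrite pow1. symmetry. apply Rmult_1_r. }
  rewrite <- (is_pseries_unique _ _ _ Hp).
  destruct (Rbar_le_lt_or_eq_dec _ _ Hc) as [Hlt|Heq].
  - apply (filterlim_filter_le_1 (PSeries c) (filter_le_within (F := locally 1) (fun x => x < 1))).
    apply continuity_pt_filterlim. apply PSeries_continuity. rewrite Rabs_R1. exact Hlt.
  - pose proof (Abel c) as HA. rewrite <- Heq in HA. apply HA; simpl; try lra; try tauto.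
    exists l. exact Hp.
Qed.

(** Termwise integration up to x < 1 gives the power series with terms a_k x^(n+k+1) / (n+k+1), and
    Abel's theorem passes to x = 1 without absolute convergence there. *)
Lemma RInt_power_limit (a : nat -> R) (n : nat) (l : R) :
  (forall x, 0 <= x < 1 -> ex_pseries a x) ->
  is_series (fun k => a k / INR (n + k + 1)) l ->
  filterlim (fun x => RInt (fun t => t ^ n * PSeries a t) 0 x) (at_left 1) (locally l).
Proof.
  intros Ha Hl. set (c := PS_Int (PS_incr_n a n)).
  assert (Hcv : Rbar_le 1 (CV_radius (PS_incr_n a n))).
  { apply CV_radius_ge_1. intros x Hx. apply ex_pseries_incr_n. apply Ha, Hx. }
  assert (Hc : is_series c l).
  (* The coefficients [c] start with n + 1 zeros: n from the factor t^n and one from the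
     integration. *)
  { apply is_series_decr_n with (n := S n); [lia|].
    assert (Z : sum_n c n = 0).
    { rewrite (sum_n_ext_loc c (fun _ => 0)).
      - rewrite sum_n_const. apply Rmult_0_r.
      - intros [|k] Hk; [reflexivity|]. unfold c, PS_Int. rewrite PS_incr_n_simplify.
        destruct (Compare_dec.le_lt_dec n k); [lia|]. unfold zero; simpl. unfold Rdiv. ring. }
    match goal with |- is_series _ ?e => replace e with l
      by (change (l = l + - sum_n c n); rewrite Z; ring) end.
    apply is_series_ext with (2 := Hl). intros k.
    change (c (S n + k)%nat) with (PS_incr_n a n (n + k) / INR (S (n + k))).
    rewrite PS_incr_n_simplify. destruct (Compare_dec.le_lt_dec n (n + k)); [|lia].
    replace (n + k - n)%nat with k by lia. replace (n + k + 1)%nat with (S (n + k)) by lia. reflexivity. }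
  apply (filterlim_ext_loc (PSeries c)).
  - exists (mkposreal 1 Rlt_0_1). intros x Hx Hx1.
    change (Rabs (x - 1) < 1) in Hx. apply Rabs_lt_between in Hx.
    unfold c. rewrite <- RInt_PSeries.
    + apply RInt_ext. intros t _. apply PSeries_incr_n.
    + rewrite Rabs_pos_eq by lra. apply Rbar_lt_le_trans with (2 := Hcv). simpl. lra.
  - apply abel_at_1; [unfold c; rewrite CV_radius_Int; exact Hcv | exact Hc].
Qed.

Lemma fst_csum (u : nat -> C) (n : nat) : fst (csum u (S n)) = sum_n (fun k => fst (u k)) n.
Proof.
  induction n as [|n IH]; [rewrite sum_O; simpl; ring|].
  rewrite sum_Sn, <- IH. reflexivity.
Qed.

Lemma snd_csum (u : nat -> C) (n : nat) : snd (csum u (S n)) = sum_n (fun k => snd (u k)) n.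
Proof.
  induction n as [|n IH]; [rewrite sum_O; simpl; ring|].
  rewrite sum_Sn, <- IH. reflexivity.
Qed.

Lemma is_cseries_fst (u : nat -> C) (l : C) :
  is_series (K := C_AbsRing) (V := C_NormedModule) u l -> is_series (fun k => fst (u k)) (fst l).
Proof.
  intros H. apply filterlim_locally. intros eps.
  destruct (proj1 (is_cseries_eps u l) H eps (cond_pos eps)) as [N HN].
  exists N. intros n Hn. change (Rabs (sum_n (fun k => fst (u k)) n - fst l) < eps).
  rewrite <- fst_csum. eapply Rle_lt_trans; [|apply (HN (S n)); lia].
  apply (Rabs_fst_Cmod (csum u (S n) - l)).
Qed.

Lemma is_cseries_snd (u : nat -> C) (l : C) :
  is_series (K := C_AbsRing) (V := C_NormedModule) u l -> is_series (fun k => snd (u k)) (snd l).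
Proof.
  intros H. apply filterlim_locally. intros eps.
  destruct (proj1 (is_cseries_eps u l) H eps (cond_pos eps)) as [N HN].
  exists N. intros n Hn. change (Rabs (sum_n (fun k => snd (u k)) n - snd l) < eps).
  rewrite <- snd_csum. eapply Rle_lt_trans; [|apply (HN (S n)); lia].
  apply (Rabs_snd_Cmod (csum u (S n) - l)).
Qed.

Lemma taylor_real_axis (a : nat -> C) (f : C -> C) (x : R) : taylor_series_disk a f -> Rabs x < 1 ->
  is_pseries (fun k => fst (a k)) x (fst (f (RtoC x))) /\
  is_pseries (fun k => snd (a k)) x (snd (f (RtoC x))).
Proof.
  intros Ht Hx. specialize (Ht (RtoC x)). rewrite Cmod_R in Ht. specialize (Ht Hx).
  assert (E : forall k, scal (K := C_Ring) (V := C_NormedModule) (pow_n (K := C_Ring) (RtoC x) k) (a k)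
     = (a k * RtoC (x ^ k))%C).
  { intros k. change (pow_n (K := C_Ring) (RtoC x) k * a k = a k * RtoC (x ^ k))%C. rewrite pow_n_Cpow, RtoC_pow. ring. }
  split; apply is_pseries_R.
  - apply is_cseries_fst in Ht. apply is_series_ext with (2 := Ht). intros k.
    etransitivity; [exact (f_equal fst (E k))|]. apply re_scal_r.
  - apply is_cseries_snd in Ht. apply is_series_ext with (2 := Ht). intros k.
    etransitivity; [exact (f_equal snd (E k))|]. apply im_scal_r.
Qed.

Lemma filterlim_at_left_eps (h : R -> R) (l eps : R) : filterlim h (at_left 1) (locally l) -> 0 < eps ->
  exists x0, 0 <= x0 < 1 /\ forall x, x0 < x < 1 -> Rabs (h x - l) < eps.
Proof.
  intros H He. destruct (proj1 (filterlim_locally _ _) H (mkposreal _ He)) as [d Hd].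
  exists (Rmax 0 (1 - d)). split.
  - split; [apply Rmax_l | apply Rmax_lub_lt; [lra | pose proof (cond_pos d); lra]].
  - intros x [Hx1 Hx2]. apply Hd; [|exact Hx2].
    change (Rabs (x - 1) < d). pose proof (Rmax_r 0 (1 - d)). apply Rabs_lt_between. lra.
Qed.

Lemma analytic_real_axis (f : C -> C) (t : R) : analytic_disk f -> 0 <= t < 1 ->
  ccont (fun s : R => f (RtoC s)) t.
Proof.
  intros Hf Ht. apply (ccont_horizontal f t 0). apply (proj1 (analytic_disk_cdiff f) Hf).
  change (Cmod (RtoC t) < 1). rewrite Cmod_R, Rabs_pos_eq; lra.
Qed.

Lemma ccont_RtoC (u : R -> R) (t : R) : continuous u t -> ccont (fun s : R => RtoC (u s)) t.
Proof. intros H. apply (ccont_pair u (fun _ => 0)); [exact H | apply continuous_const]. Qed.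

Lemma ccont_moment (f : C -> C) (n : nat) (t : R) : analytic_disk f -> 0 <= t < 1 ->
  ccont (fun s : R => RtoC (s ^ n) * f (RtoC s))%C t.
Proof.
  intros Hf Ht. apply ccont_mult; [|apply analytic_real_axis; assumption].
  apply ccont_RtoC. apply (ex_derive_continuous (K := R_AbsRing) (V := R_NormedModule)). auto_derive. exact I.
Qed.

Lemma is_CInt_moment (f : C -> C) (n : nat) (x : R) : analytic_disk f -> 0 <= x < 1 ->
  is_CInt (fun t => RtoC (t ^ n) * f (RtoC t))%C 0 x (CInt (fun t => RtoC (t ^ n) * f (RtoC t))%C 0 x).
Proof.
  intros Hf Hx. apply CInt_correct. rewrite Rmin_left, Rmax_right by lra. intros t Ht.
  apply ccont_moment; [exact Hf | lra].
Qed.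

(** Abel's theorem is applied to the real and the imaginary part on [0,1). The coefficients are any
    sequence that sums to [f], since [hilbert_image] leaves them existential. *)
Lemma hilbert_coef_limit (f : C -> C) (a : nat -> C) (b : C) (n : nat) :
  analytic_disk f -> taylor_series_disk a f ->
  is_series (K := C_AbsRing) (V := C_NormedModule) (fun k : nat => (a k / RtoC (INR (n + k + 1)))%C) b ->
  forall eps, 0 < eps -> exists x0, 0 <= x0 < 1 /\ forall x, x0 < x < 1 ->
    Cmod (CInt (fun t => RtoC (t ^ n) * f (RtoC t))%C 0 x - b) < eps.
Proof.
  intros Hf Ht Hb eps Heps.
  assert (Hpos : forall k, INR (n + k + 1) <> 0) by (intros k; apply not_0_INR; lia).
  assert (E : forall k, (a k / RtoC (INR (n + k + 1)))%C = (a k * RtoC (/ INR (n + k + 1)))%C).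
  { intros k. unfold Cdiv. rewrite RtoC_inv by apply Hpos. reflexivity. }
  assert (L1 : filterlim (fun x => RInt (fun t => t ^ n * PSeries (fun k => fst (a k)) t) 0 x) (at_left 1) (locally (fst b))).
  { apply RInt_power_limit.
    - intros x Hx. eexists. apply (taylor_real_axis a f x Ht). rewrite Rabs_pos_eq; lra.
    - apply is_cseries_fst in Hb. apply is_series_ext with (2 := Hb). intros k. rewrite E. apply re_scal_r. }
  assert (L2 : filterlim (fun x => RInt (fun t => t ^ n * PSeries (fun k => snd (a k)) t) 0 x) (at_left 1) (locally (snd b))).
  { apply RInt_power_limit.
    - intros x Hx. eexists. apply (taylor_real_axis a f x Ht). rewrite Rabs_pos_eq; lra.
    - apply is_cseries_snd in Hb. apply is_series_ext with (2 := Hb). intros k. rewrite E. apply im_scal_r. }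
  destruct (filterlim_at_left_eps _ _ (eps / 2) L1) as (x1 & Hx1 & H1); [lra|].
  destruct (filterlim_at_left_eps _ _ (eps / 2) L2) as (x2 & Hx2 & H2); [lra|].
  exists (Rmax x1 x2). split; [split; [eapply Rle_trans; [|apply Rmax_l]; lra | apply Rmax_lub_lt; lra]|].
  intros x [Hx Hx'].
  assert (Hxx : x1 < x /\ x2 < x) by (split; eapply Rle_lt_trans; [apply Rmax_l | exact Hx | apply Rmax_r | exact Hx]).
  specialize (H1 x ltac:(lra)). specialize (H2 x ltac:(lra)).
  pose proof (is_CInt_moment f n x Hf ltac:(lra)) as HI.
  set (J := CInt (fun t => RtoC (t ^ n) * f (RtoC t))%C 0 x) in *.
  assert (E1 : RInt (fun t => t ^ n * PSeries (fun k => fst (a k)) t) 0 x = fst J).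
  { apply (is_RInt_unique (V := R_CompleteNormedModule)). apply is_CInt_fst in HI.
    apply is_RInt_ext with (2 := HI). rewrite Rmin_left, Rmax_right by lra. intros t Ht'.
    destruct (taylor_real_axis a f t Ht) as [Q _]; [rewrite Rabs_pos_eq; lra|].
    rewrite (is_pseries_unique _ _ _ Q). apply re_scal_l. }
  assert (E2 : RInt (fun t => t ^ n * PSeries (fun k => snd (a k)) t) 0 x = snd J).
  { apply (is_RInt_unique (V := R_CompleteNormedModule)). apply is_CInt_snd in HI.
    apply is_RInt_ext with (2 := HI). rewrite Rmin_left, Rmax_right by lra. intros t Ht'.
    destruct (taylor_real_axis a f t Ht) as [_ Q]; [rewrite Rabs_pos_eq; lra|].
    rewrite (is_pseries_unique _ _ _ Q). apply im_scal_l. }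
  rewrite E1 in H1. rewrite E2 in H2.
  eapply Rle_lt_trans; [apply Cmod_le_Rabs|].
  change (Rabs (fst J - fst b) + Rabs (snd J - snd b) < eps). lra.
Qed.

(** For fixed N only finitely many moments are involved, so one threshold [x0] serves them all, and
    the kernel appears as a finite geometric sum. *)
Lemma hilbert_partial_sum_limit (f : C -> C) (a b : nat -> C) (z : C) (N : nat) :
  analytic_disk f -> taylor_series_disk a f ->
  (forall n : nat, is_series (K := C_AbsRing) (V := C_NormedModule)
     (fun k : nat => (a k / RtoC (INR (n + k + 1)))%C) (b n)) ->
  Cmod z < 1 -> forall eps, 0 < eps -> exists x0, 0 <= x0 < 1 /\ forall x, x0 < x < 1 -> exists J,
    is_CInt (fun t => f (RtoC t) * csum (fun n => (RtoC t * z) ^ n) N)%C 0 x J /\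
    Cmod (J - csum (fun n => b n * z ^ n)%C N) < eps.
Proof.
  intros Hf Ht Hb Hz. induction N as [|N IH]; intros eps Heps.
  - exists 0. split; [lra|]. intros x Hx. exists (RtoC 0). split.
    + apply (is_CInt_ext (fun _ => RtoC 0)); [intros t _; simpl; ring|].
      pose proof (is_CInt_const 0 x 0) as H0. rewrite Cmult_0_r in H0. exact H0.
    + simpl. replace (0 - 0)%C with (RtoC 0) by ring. rewrite Cmod_0. exact Heps.
  - destruct (IH (eps / 2)) as (x1 & Hx1 & H1); [lra|].
    destruct (hilbert_coef_limit f a (b N) N Hf Ht (Hb N) (eps / 2)) as (x2 & Hx2 & H2); [lra|].
    exists (Rmax x1 x2). split; [split; [eapply Rle_trans; [|apply Rmax_l]; lra | apply Rmax_lub_lt; lra]|].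
    intros x [Hx Hx'].
    assert (Hxx : x1 < x /\ x2 < x) by (split; eapply Rle_lt_trans; [apply Rmax_l | exact Hx | apply Rmax_r | exact Hx]).
    destruct (H1 x ltac:(lra)) as (J & HJ & HJb). specialize (H2 x ltac:(lra)).
    set (m := CInt (fun t => RtoC (t ^ N) * f (RtoC t))%C 0 x) in *.
    exists (J + z ^ N * m)%C. split.
    + apply (is_CInt_ext (fun t => f (RtoC t) * csum (fun n => (RtoC t * z) ^ n) N
         + z ^ N * (RtoC (t ^ N) * f (RtoC t)))%C).
      * intros t _. simpl csum. rewrite Cpow_mult_l, RtoC_pow. ring.
      * apply is_CInt_plus; [exact HJ|]. apply is_CInt_scal. apply is_CInt_moment; [exact Hf | lra].
    + simpl csum.
      match goal with |- Cmod ?e < _ =>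
        replace e with ((J - csum (fun n => b n * z ^ n) N) + z ^ N * (m - b N))%C by ring end.
      eapply Rle_lt_trans; [apply Cmod_triangle|]. rewrite Cmod_mult, Cmod_pow.
      assert (0 <= Cmod z ^ N <= 1).
      { pose proof (Cmod_ge_0 z). split; [apply pow_le; assumption|].
        rewrite <- (pow1 N). apply pow_incr. lra. }
      pose proof (Cmod_ge_0 (m - b N)). nra.
Qed.

Lemma csum_geom_le (q : C) (r t : R) (N : nat) : 0 <= t < 1 -> 0 <= r < 1 -> Cmod q = t * r ->
  Cmod (csum (fun n => q ^ n)%C N) <= (1 + r ^ N) / (1 - t * r).
Proof.
  intros Ht Hr Hq. pose proof (csum_geom q N) as G. apply (f_equal Cmod) in G. rewrite Cmod_mult in G.
  assert (H1 : 1 - t * r <= Cmod (1 - q)).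
  { pose proof (Cmod_triangle_rev 1 q) as H. rewrite Cmod_1, Hq in H. exact H. }
  assert (H2 : Cmod (1 - q ^ N) <= 1 + r ^ N).
  { unfold Cminus. eapply Rle_trans; [apply Cmod_triangle|]. rewrite Cmod_1, Cmod_opp, Cmod_pow, Hq.
    apply Rplus_le_compat_l. apply pow_incr. nra. }
  assert (0 < 1 - t * r) by nra. apply Rle_div_r; [assumption|].
  pose proof (Cmod_ge_0 (csum (fun n => q ^ n)%C N)). nra.
Qed.

(** * Pointwise bounds for the image *)

Definition korenblum_log_bound (alpha K : R) (f : C -> C) : Prop :=
  forall z, Cmod z < 1 -> Rpower (1 - Cmod z ^ 2) alpha * log_factor alpha (1 - Cmod z ^ 2) * Cmod (f z) <= K.

Lemma log_bound_nonneg (alpha K : R) (f : C -> C) : 0 < alpha < 1 -> korenblum_log_bound alpha K f -> 0 <= K.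
Proof.
  intros Ha HK. specialize (HK 0%C). rewrite Cmod_0 in HK. specialize (HK Rlt_0_1).
  eapply Rle_trans; [|exact HK]. pose proof (log_factor_ge_1 alpha (1 - 0 ^ 2) Ha ltac:(simpl; lra)).
  apply Rmult_le_pos; [|apply Cmod_ge_0]. apply Rmult_le_pos; [left; apply Rpower_pos | lra].
Qed.

Lemma log_bound_korenblum (alpha K : R) (f : C -> C) : 0 < alpha < 1 ->
  korenblum_log_bound alpha K f -> korenblum_bound alpha K f.
Proof.
  intros Ha HK z Hz. eapply Rle_trans; [|apply (HK z Hz)].
  pose proof (Cmod_ge_0 z).
  pose proof (log_factor_ge_1 alpha (1 - Cmod z ^ 2) Ha ltac:(nra)).
  apply Rmult_le_compat_r; [apply Cmod_ge_0|]. pose proof (Rpower_pos (1 - Cmod z ^ 2) alpha). nra.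
Qed.

Lemma log_bound_real_axis (alpha K t : R) (f : C -> C) : 0 < alpha < 1 ->
  korenblum_log_bound alpha K f -> 0 <= t < 1 -> Cmod (f (RtoC t)) <= K * lower_integrand alpha t.
Proof.
  intros Ha HK Ht. specialize (HK (RtoC t)). rewrite Cmod_R, Rabs_pos_eq in HK by lra.
  specialize (HK ltac:(lra)). unfold lower_integrand.
  pose proof (log_factor_ge_1 alpha (1 - t ^ 2) Ha ltac:(nra)). pose proof (Rpower_pos (1 - t ^ 2) alpha).
  assert (0 < Rpower (1 - t ^ 2) alpha * log_factor alpha (1 - t ^ 2)) by (apply Rmult_lt_0_compat; lra).
  unfold Rdiv. rewrite Rmult_1_l. apply Rle_div_r; [assumption|]. rewrite Rmult_comm. exact HK.
Qed.

Lemma RInt_hilbert_correct (alpha r x : R) : 0 < alpha < 1 -> 0 <= r < 1 -> 0 <= x < 1 ->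
  is_RInt (hilbert_integrand alpha r) 0 x (RInt (hilbert_integrand alpha r) 0 x).
Proof.
  intros Ha Hr Hx. apply (RInt_correct (V := R_CompleteNormedModule)). apply ex_RInt_half_open; try lra.
  intros; apply hilbert_integrand_continuous; assumption.
Qed.

(** Each partial sum of the image is at most (1 + r^N) K I, r = |z|, by taking x close to 1 for that
    N; letting N grow removes r^N. *)
Lemma hilbert_image_le (alpha K I : R) (f g : C -> C) (z : C) : 0 < alpha < 1 ->
  analytic_disk f -> korenblum_log_bound alpha K f -> hilbert_image f g -> Cmod z < 1 ->
  (forall x, 0 <= x < 1 -> RInt (hilbert_integrand alpha (Cmod z)) 0 x <= I) -> Cmod (g z) <= K * I.
Proof.
  intros Ha Hf HK (a & b & Hta & Hb & Htb & _) Hz HI.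
  pose proof (Cmod_ge_0 z) as Hz0. set (r := Cmod z) in *.
  pose proof (log_bound_nonneg alpha K f Ha HK) as HK0.
  assert (HI0 : 0 <= I).
  { eapply Rle_trans; [|apply (HI 0); lra]. rewrite RInt_point. right; reflexivity. }
  assert (HP : forall N, Cmod (csum (fun n => b n * z ^ n)%C N) <= (1 + r ^ N) * (K * I)).
  { intros N. apply le_epsilon. intros eps Heps.
    destruct (hilbert_partial_sum_limit f a b z N Hf Hta Hb Hz eps Heps) as (x0 & Hx0 & H).
    destruct (H ((x0 + 1) / 2) ltac:(lra)) as (J & HJ & HJb). set (x := (x0 + 1) / 2) in *.
    assert (Hx : 0 <= x < 1) by (unfold x; lra).
    assert (HJ1 : Cmod J <= (1 + r ^ N) * K * RInt (hilbert_integrand alpha r) 0 x).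
    { apply (is_CInt_bound _ (fun t => scal ((1 + r ^ N) * K) (hilbert_integrand alpha r t)) 0 x J _ (proj1 Hx)) with (2 := HJ).
      - intros t Ht. rewrite Cmod_mult.
        change (scal ((1 + r ^ N) * K) (hilbert_integrand alpha r t)) with ((1 + r ^ N) * K * hilbert_integrand alpha r t).
        replace ((1 + r ^ N) * K * hilbert_integrand alpha r t) with
          (K * lower_integrand alpha t * ((1 + r ^ N) / (1 - t * r))) by (unfold hilbert_integrand, Rdiv; ring).
        apply Rmult_le_compat; try apply Cmod_ge_0.
        + apply log_bound_real_axis; [exact Ha | exact HK | lra].
        + apply csum_geom_le; [lra | lra |]. rewrite Cmod_mult, Cmod_R, Rabs_pos_eq by lra. reflexivity.
      - apply (is_RInt_scal (V := R_NormedModule)). apply RInt_hilbert_correct; lra || assumption. }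
    pose proof (Cmod_triangle_rev (csum (fun n => b n * z ^ n)%C N) J) as T. rewrite Cmod_minus_sym in T.
    specialize (HI x Hx). assert (0 <= r ^ N) by (apply pow_le; exact Hz0).
    assert ((1 + r ^ N) * K * RInt (hilbert_integrand alpha r) 0 x <= (1 + r ^ N) * (K * I)).
    { rewrite Rmult_assoc. apply Rmult_le_compat_l; [lra|]. apply Rmult_le_compat_l; assumption. }
    lra. }
  assert (HKI : 0 <= K * I) by (apply Rmult_le_pos; assumption).
  apply le_epsilon. intros eps Heps.
  destruct (proj1 (is_cpseries_eps b z (g z)) (Htb z Hz) (eps / 2)) as [N1 HN1]; [lra|].
  destruct (pow_lt_1_zero r) with (y := eps / 2 / (K * I + 1)) as [N2 HN2].
  { rewrite Rabs_pos_eq; assumption. }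
  { apply Rdiv_lt_0_compat; lra. }
  specialize (HN1 (Nat.max N1 N2) ltac:(lia)). specialize (HN2 (Nat.max N1 N2) ltac:(lia)).
  set (N := Nat.max N1 N2) in *. specialize (HP N).
  rewrite Rabs_pos_eq in HN2 by (apply pow_le; exact Hz0). apply Rlt_div_r in HN2; [|lra].
  assert (0 <= r ^ N) by (apply pow_le; exact Hz0).
  pose proof (Cmod_triangle_rev (g z) (csum (fun n => b n * z ^ n)%C N)) as T. rewrite Cmod_minus_sym in T. nra.
Qed.

(** Since t^n <= 1, the integral at r = 0 bounds all moments at once. Bounded coefficients are what
    makes the image a power series on the whole disk. *)
Lemma hilbert_coef_bound (alpha K I : R) (f : C -> C) (a : nat -> C) (b : C) (n : nat) : 0 < alpha < 1 ->
  analytic_disk f -> korenblum_log_bound alpha K f -> taylor_series_disk a f ->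
  is_series (K := C_AbsRing) (V := C_NormedModule) (fun k : nat => (a k / RtoC (INR (n + k + 1)))%C) b ->
  (forall x, 0 <= x < 1 -> RInt (hilbert_integrand alpha 0) 0 x <= I) -> Cmod b <= K * I.
Proof.
  intros Ha Hf HK Hta Hb HI. apply le_epsilon. intros eps Heps.
  pose proof (log_bound_nonneg alpha K f Ha HK) as HK0.
  destruct (hilbert_coef_limit f a b n Hf Hta Hb eps Heps) as (x0 & Hx0 & H).
  set (x := (x0 + 1) / 2). specialize (H x ltac:(unfold x; lra)).
  assert (Hx : 0 <= x < 1) by (unfold x; lra).
  pose proof (is_CInt_moment f n x Hf Hx) as HJ.
  set (J := CInt (fun t => RtoC (t ^ n) * f (RtoC t))%C 0 x) in *.
  assert (HJ1 : Cmod J <= K * RInt (hilbert_integrand alpha 0) 0 x).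
  { apply (is_CInt_bound _ (fun t => scal K (hilbert_integrand alpha 0 t)) 0 x J _ (proj1 Hx)) with (2 := HJ).
    - intros t Ht. rewrite Cmod_mult, Cmod_R, Rabs_pos_eq by (apply pow_le; lra).
      change (scal K (hilbert_integrand alpha 0 t)) with (K * hilbert_integrand alpha 0 t).
      unfold hilbert_integrand. rewrite Rmult_0_r, Rminus_0_r, Rdiv_1_r.
      pose proof (log_bound_real_axis alpha K t f Ha HK ltac:(lra)) as H1.
      assert (H2 : 0 <= t ^ n <= 1).
      { split; [apply pow_le; lra|]. rewrite <- (pow1 n). apply pow_incr. lra. }
      pose proof (Cmod_ge_0 (f (RtoC t))). nra.
    - apply (is_RInt_scal (V := R_NormedModule)). apply RInt_hilbert_correct; lra. }
  pose proof (Cmod_triangle_rev b J) as T. rewrite Cmod_minus_sym in T.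
  specialize (HI x Hx). nra.
Qed.

(** On the positive axis all quantities are real and nonnegative, so nothing is lost: the truncated
    kernel (1 - (t r)^N) / (1 - t r) is at least (1 - r^N) / (1 - t r), and N tends to infinity. *)
Lemma hilbert_image_ge (alpha r x : R) (f g : C -> C) : 0 < alpha < 1 ->
  analytic_disk f -> (forall t, 0 <= t < 1 -> f (RtoC t) = RtoC (lower_integrand alpha t)) ->
  hilbert_image f g -> 0 <= r < 1 -> 0 <= x < 1 ->
  RInt (hilbert_integrand alpha r) 0 x <= Cmod (g (RtoC r)).
Proof.
  intros Ha Hf Hreal (a & b & Hta & Hb & Htb & _) Hr Hx.
  assert (Hz : Cmod (RtoC r) < 1) by (rewrite Cmod_R, Rabs_pos_eq; lra).
  set (H0 := RInt (hilbert_integrand alpha r) 0 x).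
  assert (HP : forall N, (1 - r ^ N) * H0 <= Cmod (csum (fun n => b n * RtoC r ^ n)%C N)).
  { intros N. apply le_epsilon. intros eps Heps.
    destruct (hilbert_partial_sum_limit f a b (RtoC r) N Hf Hta Hb Hz eps Heps) as (x0 & Hx0 & H).
    set (y := (Rmax x0 x + 1) / 2).
    assert (Hy : x0 < y /\ x <= y /\ 0 <= y < 1).
    { pose proof (Rmax_l x0 x). pose proof (Rmax_r x0 x). pose proof (Rmax_lub_lt x0 x 1 ltac:(lra) ltac:(lra)). unfold y. lra. }
    destruct (H y ltac:(lra)) as (J & HJ & HJb).
    assert (HJ1 : (1 - r ^ N) * RInt (hilbert_integrand alpha r) 0 y <= fst J).
    { apply is_CInt_fst in HJ.
      apply (is_RInt_le (fun t => scal (1 - r ^ N) (hilbert_integrand alpha r t))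
        (fun t => fst (f (RtoC t) * csum (fun n => (RtoC t * RtoC r) ^ n) N)%C) 0 y); [lra| |exact HJ|].
      - apply (is_RInt_scal (V := R_NormedModule)). apply RInt_hilbert_correct; lra || assumption.
      - intros t Ht. rewrite Hreal by lra.
        assert (E : csum (fun n => (RtoC t * RtoC r) ^ n)%C N = RtoC ((1 - (t * r) ^ N) / (1 - t * r))).
        { pose proof (csum_geom (RtoC t * RtoC r) N) as G.
          assert (Hd : 1 - t * r <> 0) by nra.
          rewrite RtoC_div, RtoC_minus, RtoC_pow, RtoC_minus, RtoC_mult by exact Hd.
          rewrite <- G. field. rewrite <- RtoC_mult, <- RtoC_minus. intros E. apply RtoC_inj in E. auto. }
        rewrite E. rewrite <- RtoC_mult.
        change (fst (RtoC (lower_integrand alpha t * ((1 - (t * r) ^ N) / (1 - t * r)))))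
          with (lower_integrand alpha t * ((1 - (t * r) ^ N) / (1 - t * r))).
        change (scal (1 - r ^ N) (hilbert_integrand alpha r t)) with ((1 - r ^ N) * hilbert_integrand alpha r t).
        replace (lower_integrand alpha t * ((1 - (t * r) ^ N) / (1 - t * r))) with
          ((1 - (t * r) ^ N) * hilbert_integrand alpha r t) by (unfold hilbert_integrand, Rdiv; ring).
        apply Rmult_le_compat_r; [apply hilbert_integrand_nonneg; lra || assumption|].
        assert ((t * r) ^ N <= r ^ N) by (apply pow_incr; nra). lra. }
    assert (Hm : H0 <= RInt (hilbert_integrand alpha r) 0 y).
    { apply RInt_nonneg_mono; try lra; intros; [apply hilbert_integrand_continuous | apply hilbert_integrand_nonneg]; assumption. }
    assert (Hrn : r ^ N <= 1) by (rewrite <- (pow1 N); apply pow_incr; lra).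
    pose proof (Rabs_fst_Cmod J) as HfJ. pose proof (Rle_abs (fst J)).
    pose proof (Cmod_triangle_rev J (csum (fun n => b n * RtoC r ^ n)%C N)). nra. }
  apply le_epsilon. intros eps Heps.
  assert (HH0 : 0 <= H0).
  { replace 0 with (RInt (hilbert_integrand alpha r) 0 0) by exact (RInt_point (V := R_CompleteNormedModule) 0 _).
    apply RInt_nonneg_mono; try lra; intros; [apply hilbert_integrand_continuous | apply hilbert_integrand_nonneg]; assumption. }
  destruct (proj1 (is_cpseries_eps b (RtoC r) (g (RtoC r))) (Htb _ Hz) (eps / 2)) as [N1 HN1]; [lra|].
  destruct (pow_lt_1_zero r) with (y := eps / 2 / (H0 + 1)) as [N2 HN2].
  { rewrite Rabs_pos_eq; lra. }
  { apply Rdiv_lt_0_compat; lra. }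
  specialize (HN1 (Nat.max N1 N2) ltac:(lia)). specialize (HN2 (Nat.max N1 N2) ltac:(lia)).
  set (N := Nat.max N1 N2) in *. specialize (HP N).
  rewrite Rabs_pos_eq in HN2 by (apply pow_le; lra). apply Rlt_div_r in HN2; [|lra].
  assert (0 <= r ^ N) by (apply pow_le; lra).
  pose proof (Cmod_triangle_rev (csum (fun n => b n * RtoC r ^ n)%C N) (g (RtoC r))). nra.
Qed.

(** * Analyticity of the image and the extremal function *)

(** The error E_n obeys E_(n+1) = w E_n + n z^(n-1) (w - z)^2, and n^2 + n <= (n+1)^2 closes the
    induction. At n = 0 the value of [pred] is harmless, being multiplied by 0. *)
Lemma pow_second_order (z w : C) (rho : R) (n : nat) : 0 < rho -> Cmod z <= rho -> Cmod w <= rho ->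
  Cmod (w ^ n - z ^ n - RtoC (INR n) * z ^ pred n * (w - z)) <=
    INR n ^ 2 * rho ^ n * (/ rho ^ 2 * Cmod (w - z) ^ 2).
Proof.
  intros Hr Hz Hw. set (c := / rho ^ 2 * Cmod (w - z) ^ 2).
  assert (Hc : Cmod (w - z) ^ 2 = rho ^ 2 * c) by (unfold c; field; lra).
  assert (Hc0 : 0 <= c).
  { unfold c. apply Rmult_le_pos; [left; apply Rinv_0_lt_compat, pow_lt, Hr | apply pow2_ge_0]. }
  clearbody c. induction n as [|n IH].
  - simpl. replace (1 - 1 - 0 * 1 * (w - z))%C with (RtoC 0) by ring. rewrite Cmod_0. lra.
  - replace (w ^ S n - z ^ S n - RtoC (INR (S n)) * z ^ pred (S n) * (w - z))%C with
      (w * (w ^ n - z ^ n - RtoC (INR n) * z ^ pred n * (w - z))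
        + RtoC (INR n) * z ^ pred n * ((w - z) * (w - z)))%C.
    2:{ rewrite S_INR, RtoC_plus. simpl pred. rewrite !Cpow_S.
        destruct n as [|n]; [simpl; ring|]. simpl pred. rewrite !Cpow_S. ring. }
    eapply Rle_trans; [apply Cmod_triangle|]. rewrite !Cmod_mult, Cmod_R, Cmod_pow.
    rewrite Rabs_pos_eq by apply pos_INR.
    replace (Cmod (w - z) * Cmod (w - z)) with (rho ^ 2 * c) by (rewrite <- Hc; ring).
    pose proof (Cmod_ge_0 z). pose proof (pos_INR n) as Hn.
    assert (Hp : 0 <= rho ^ n) by (apply pow_le; lra).
    assert (H1 : INR n * Cmod z ^ pred n * (rho ^ 2 * c) <= INR n * rho ^ S n * c).
    { destruct n as [|n]; [simpl; lra|]. simpl pred.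
      replace (INR (S n) * rho ^ S (S n) * c) with (INR (S n) * rho ^ n * (rho ^ 2 * c)) by (simpl; ring).
      apply Rmult_le_compat_r; [apply Rmult_le_pos; [apply pow2_ge_0 | exact Hc0]|].
      apply Rmult_le_compat_l; [exact Hn|]. apply pow_incr. lra. }
    assert (H2 : Cmod w * Cmod (w ^ n - z ^ n - RtoC (INR n) * z ^ pred n * (w - z)) <= rho * (INR n ^ 2 * rho ^ n * c)).
    { apply Rmult_le_compat; auto using Cmod_ge_0. }
    rewrite S_INR.
    apply Rle_trans with (rho * (INR n ^ 2 * rho ^ n * c) + INR n * rho ^ S n * c); [lra|].
    replace (rho * (INR n ^ 2 * rho ^ n * c) + INR n * rho ^ S n * c) with ((INR n ^ 2 + INR n) * (rho ^ S n * c)) by (simpl; ring).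
    rewrite Rmult_assoc. apply Rmult_le_compat_r; [|nra].
    apply Rmult_le_pos; [apply pow_le; lra | exact Hc0].
Qed.

(** This is the second derivative of the geometric series. *)
Lemma ex_series_quadratic_geom (rho : R) : 0 <= rho < 1 ->
  ex_series (fun n => INR (S n) * INR (S (S n)) * rho ^ n).
Proof.
  intros Hr.
  assert (Hcv : Rbar_lt (Rabs rho) (CV_radius (fun _ => 1))).
  { apply Rbar_lt_le_trans with 1; [simpl; rewrite Rabs_pos_eq; lra|].
    apply CV_radius_ge_1. intros x Hx. apply ex_pseries_R.
    apply ex_series_ext with (fun n => x ^ n); [intros n; symmetry; apply Rmult_1_l|].
    apply ex_series_geom. rewrite Rabs_pos_eq; lra. }
  pose proof (ex_pseries_derive (PS_derive (fun _ => 1)) rho) as H.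
  rewrite CV_radius_derive in H. specialize (H Hcv). apply ex_pseries_R in H.
  apply ex_series_ext with (2 := H). intros n. unfold PS_derive. match goal with |- @eq _ ?x ?y => change (@eq R x y) end. ring.
Qed.

Lemma sum_n_nonneg_le_series (u : nat -> R) (n : nat) : (forall k, 0 <= u k) -> ex_series u ->
  sum_n u n <= Series u.
Proof.
  intros Hp Hu. apply Series_correct in Hu.
  apply (is_lim_seq_incr_compare (sum_n u) (Series u)); [exact Hu|].
  intros k. rewrite sum_Sn. unfold plus; simpl. specialize (Hp (S k)). lra.
Qed.

Lemma Cmod_csum_le (u : nat -> C) (v : nat -> R) (n : nat) : (forall k, Cmod (u k) <= v k) ->
  Cmod (csum u (S n)) <= sum_n v n.
Proof.
  intros H. induction n as [|n IH].
  - rewrite sum_O. simpl. rewrite Cplus_0_l. apply H.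
  - rewrite sum_Sn. change (csum u (S (S n))) with (csum u (S n) + u (S n))%C.
    eapply Rle_trans; [apply Cmod_triangle|]. apply Rplus_le_compat; [exact IH | apply H].
Qed.

(** The termwise second-order estimate is summable on |w| <= rho, so g(w) - g(z) - l (w - z) is O(|w
    - z|^2), where l is the sum of the differentiated series. *)
Lemma power_series_analytic (b : nat -> C) (g : C -> C) (B : R) :
  (forall n, Cmod (b n) <= B) -> taylor_series_disk b g -> analytic_disk g.
Proof.
  intros HB Hg. apply analytic_disk_cdiff. intros z Hz.
  pose proof (Cmod_ge_0 z) as Hz0.
  (* A radius strictly between |z| and 1 leaves room for w near z inside |w| <= rho. *)
  set (rho := (1 + Cmod z) / 2). assert (Hr : 0 < rho < 1 /\ Cmod z < rho) by (unfold rho; lra).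
  assert (HB0 : 0 <= B) by (eapply Rle_trans; [apply Cmod_ge_0 | apply (HB O)]).
  set (q := fun n => INR (S n) * INR (S (S n)) * rho ^ n).
  assert (Hq : ex_series q) by (apply ex_series_quadratic_geom; lra).
  assert (Hq0 : forall n, 0 <= q n).
  { intros n. unfold q. apply Rmult_le_pos; [apply Rmult_le_pos; apply pos_INR | apply pow_le; lra]. }
  assert (Hnq : forall n, INR n ^ 2 * rho ^ n <= q n).
  { intros n. unfold q. apply Rmult_le_compat_r; [apply pow_le; lra|]. rewrite !S_INR. pose proof (pos_INR n). nra. }
  set (dterm := fun n => (b n * (RtoC (INR n) * z ^ pred n))%C).
  assert (Hd : exists l, is_series (K := C_AbsRing) (V := C_NormedModule) dterm l).
  { apply (ex_series_le (K := C_AbsRing) (V := C_CompleteNormedModule) dterm (fun n => B / rho * q n)).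
    - intros n. change (Cmod (dterm n) <= B / rho * q n). unfold dterm.
      rewrite !Cmod_mult, Cmod_R, Cmod_pow, Rabs_pos_eq by apply pos_INR.
      unfold Rdiv. rewrite Rmult_assoc. apply Rmult_le_compat; [apply Cmod_ge_0 | | apply HB |].
      + apply Rmult_le_pos; [apply pos_INR | apply pow_le, Hz0].
      + apply Rle_trans with (/ rho * (INR n ^ 2 * rho ^ n)).
        * destruct n as [|n]; [simpl; lra|]. simpl pred.
          replace (/ rho * (INR (S n) ^ 2 * rho ^ S n)) with (INR (S n) ^ 2 * rho ^ n) by (simpl; field; lra).
          apply Rmult_le_compat; [apply pos_INR | apply pow_le, Hz0 | | apply pow_incr; lra].
          rewrite S_INR. pose proof (pos_INR n). nra.
        * apply Rmult_le_compat_l; [left; apply Rinv_0_lt_compat; lra | apply Hnq].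
    - apply (ex_series_scal_l (K := R_AbsRing) (B / rho) q). exact Hq. }
  destruct Hd as [l Hl]. exists l.
  set (T := B * / rho ^ 2 * Series q).
  assert (HT : 0 <= T).
  { unfold T. apply Rmult_le_pos.
    - apply Rmult_le_pos; [exact HB0 | left; apply Rinv_0_lt_compat, pow_lt; lra].
    - eapply Rle_trans; [|apply (sum_n_nonneg_le_series q 0 Hq0 Hq)]. rewrite sum_O. apply Hq0. }
  assert (Main : forall w, Cmod (w - z) < rho - Cmod z -> Cmod (g w - g z - l * (w - z)) <= T * Cmod (w - z) ^ 2).
  { intros w Hw. assert (Hwr : Cmod w <= rho) by (pose proof (Cmod_triangle_rev w z); lra).
    apply le_epsilon. intros eps Heps.
    (* Three tails are discarded, those of g(w), g(z) and l; the last is multiplied by w - z, hence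
       the normalisation. *)
    set (e := eps / 3 / (1 + Cmod (w - z))).
    pose proof (Cmod_ge_0 (w - z)) as Hwz.
    assert (He : 0 < e) by (unfold e; apply Rdiv_lt_0_compat; lra).
    assert (He' : e * (1 + Cmod (w - z)) = eps / 3) by (unfold e; field; lra).
    destruct (proj1 (is_cpseries_eps b w (g w)) (Hg w ltac:(lra)) e He) as [N1 H1].
    destruct (proj1 (is_cpseries_eps b z (g z)) (Hg z Hz) e He) as [N2 H2].
    destruct (proj1 (is_cseries_eps dterm l) Hl e He) as [N3 H3].
    set (N := S (N1 + N2 + N3)).
    specialize (H1 N ltac:(lia)). specialize (H2 N ltac:(lia)). specialize (H3 N ltac:(lia)).
    assert (E : csum (fun n => b n * (w ^ n - z ^ n - RtoC (INR n) * z ^ pred n * (w - z)))%C N =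
      (csum (fun n => b n * w ^ n) N - csum (fun n => b n * z ^ n) N - (w - z) * csum dterm N)%C).
    { rewrite <- csum_scal, <- !csum_minus. apply csum_ext. intros k _. unfold dterm. ring. }
    assert (HS : Cmod (csum (fun n => b n * (w ^ n - z ^ n - RtoC (INR n) * z ^ pred n * (w - z)))%C N)
      <= T * Cmod (w - z) ^ 2).
    { unfold N.
      apply Rle_trans with (sum_n (fun n => (B * / rho ^ 2 * Cmod (w - z) ^ 2) * q n) (N1 + N2 + N3)).
      - apply Cmod_csum_le. intros n. rewrite Cmod_mult.
        apply Rle_trans with (B * (q n * (/ rho ^ 2 * Cmod (w - z) ^ 2))); [|right; ring].
        apply Rmult_le_compat; [apply Cmod_ge_0 | apply Cmod_ge_0 | apply HB |].
        eapply Rle_trans; [apply (pow_second_order z w rho n); lra|].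
        apply Rmult_le_compat_r; [|apply Hnq].
        apply Rmult_le_pos; [left; apply Rinv_0_lt_compat, pow_lt; lra | apply pow2_ge_0].
      - rewrite (sum_n_mult_l (K := R_Ring)).
        change ((B * / rho ^ 2 * Cmod (w - z) ^ 2) * sum_n q (N1 + N2 + N3) <= T * Cmod (w - z) ^ 2).
        unfold T. pose proof (sum_n_nonneg_le_series q (N1 + N2 + N3) Hq0 Hq).
        replace (B * / rho ^ 2 * Series q * Cmod (w - z) ^ 2) with ((B * / rho ^ 2 * Cmod (w - z) ^ 2) * Series q) by ring.
        apply Rmult_le_compat_l; [|assumption].
        apply Rmult_le_pos; [|apply pow2_ge_0].
        apply Rmult_le_pos; [exact HB0 | left; apply Rinv_0_lt_compat, pow_lt; lra]. }
    rewrite E in HS.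
    set (X := csum (fun n => b n * w ^ n)%C N) in *. set (Y := csum (fun n => b n * z ^ n)%C N) in *.
    set (Z := csum dterm N) in *.
    replace (g w - g z - l * (w - z))%C with
      ((X - Y - (w - z) * Z) + (- (X - g w) + ((Y - g z) + (w - z) * (Z - l))))%C by ring.
    eapply Rle_trans; [apply Cmod_triangle|].
    pose proof (Cmod_triangle (- (X - g w)) ((Y - g z) + (w - z) * (Z - l))) as T1.
    pose proof (Cmod_triangle (Y - g z) ((w - z) * (Z - l))) as T2.
    rewrite Cmod_opp in T1. rewrite Cmod_mult in T2.
    pose proof (Cmod_ge_0 (Z - l)). nra. }
  intros eps Heps. exists (Rmin (rho - Cmod z) (eps / (T + 1))). split.
  { apply Rmin_pos; [lra|]. apply Rdiv_lt_0_compat; lra. }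
  intros w Hw.
  assert (H1 : Cmod (w - z) < rho - Cmod z) by (apply Rlt_le_trans with (1 := Hw), Rmin_l).
  assert (H2 : Cmod (w - z) < eps / (T + 1)) by (apply Rlt_le_trans with (1 := Hw), Rmin_r).
  eapply Rle_trans; [apply Main, H1|].
  apply Rlt_div_r in H2; [|lra]. pose proof (Cmod_ge_0 (w - z)). nra.
Qed.

(** The function f_0 of the overview; Re (1 - z^2) > 0 on the disk, so the principal logarithm is
    meaningful and defines both the power and the logarithmic factor. *)
Definition extremal (alpha : R) (z : C) : C :=
  (/ (cexp (RtoC alpha * clog (1 - z * z)) * (RtoC (ln 2 + / alpha) - clog (1 - z * z))))%C.

Lemma one_minus_sq_bounds (z : C) : Cmod z < 1 ->
  0 < fst (1 - z * z)%C /\ 1 - Cmod z ^ 2 <= Cmod (1 - z * z) <= 2.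
Proof.
  intros Hz. pose proof (Cmod_ge_0 z).
  assert (H1 : Cmod (z * z) = Cmod z ^ 2) by (rewrite Cmod_mult; ring).
  split; [|split].
  - pose proof (Rabs_fst_Cmod (z * z)) as H0. rewrite H1 in H0.
    apply Rabs_le_between in H0. change (0 < 1 + - fst (z * z)%C). nra.
  - rewrite <- H1. rewrite <- Cmod_1 at 1. apply Cmod_triangle_rev.
  - unfold Cminus. eapply Rle_trans; [apply Cmod_triangle|]. rewrite Cmod_opp, Cmod_1, H1. nra.
Qed.

(** The modulus dominates the real part, and that is at least 1/alpha because |1 - z^2| <= 2. *)
Lemma extremal_denominator (alpha : R) (z : C) : 0 < alpha < 1 -> Cmod z < 1 ->
  0 < ln 2 + / alpha - ln (Cmod (1 - z * z)) <= Cmod (RtoC (ln 2 + / alpha) - clog (1 - z * z)).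
Proof.
  intros Ha Hz. destruct (one_minus_sq_bounds z Hz) as (H1 & H2 & H3).
  pose proof (Cmod_ge_0 z).
  assert (H4 : ln (Cmod (1 - z * z)) <= ln 2).
  { destruct H3 as [H3| ->]; [left; apply ln_increasing; nra | lra]. }
  assert (0 < / alpha) by (apply Rinv_0_lt_compat; lra).
  split; [lra|]. eapply Rle_trans; [apply Rle_abs|].
  apply (Rabs_fst_Cmod (RtoC (ln 2 + / alpha) - clog (1 - z * z))).
Qed.

Lemma extremal_analytic (alpha : R) : 0 < alpha < 1 -> analytic_disk (extremal alpha).
Proof.
  intros Ha. apply analytic_disk_cdiff. intros z Hz.
  destruct (one_minus_sq_bounds z Hz) as (H1 & _).
  assert (D0 : cdiff (fun w => 1 - w * w)%C z (0 - (1 * z + z * 1))%C).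
  { apply cdiff_minus; [apply cdiff_const|]. apply (cdiff_mult (fun w => w) (fun w => w)); apply cdiff_id. }
  pose proof (cdiff_comp clog (fun w => 1 - w * w)%C z _ _ (cdiff_clog _ H1) D0) as D1.
  pose proof (cdiff_comp cexp (fun w => RtoC alpha * clog (1 - w * w))%C z _ _ (cdiff_cexp _)
    (cdiff_scal (RtoC alpha) _ z _ D1)) as D2.
  pose proof (cdiff_minus (fun _ => RtoC (ln 2 + / alpha)) _ z _ _ (cdiff_const _ z) D1) as D3.
  apply (cdiff_inv _ z _ (cdiff_mult _ _ z _ _ D2 D3)).
  apply Cmult_neq_0; [apply cexp_neq_0|].
  apply Cmod_gt_0. pose proof (extremal_denominator alpha z Ha Hz). lra.
Qed.

(** In the derivative the contribution of 1/alpha cancels the derivative of the logarithm, leaving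
    alpha x^(alpha-1) (ln 2 - ln x), nonnegative up to 2. *)
Lemma weight_increasing (alpha s m : R) : 0 < alpha < 1 -> 0 < s -> s <= m -> m <= 2 ->
  Rpower s alpha * (ln 2 + / alpha - ln s) <= Rpower m alpha * (ln 2 + / alpha - ln m).
Proof.
  intros Ha Hs Hsm Hm. destruct Hsm as [Hsm| ->]; [|lra].
  destruct (MVT_cor2 (fun x => Rpower x alpha * (ln 2 + / alpha - ln x))
    (fun x => Rpower x alpha * / x * (alpha * (ln 2 - ln x))) s m Hsm) as (c & E & Hc).
  - intros c Hc. apply is_derive_Reals. unfold Rpower. auto_derive; [lra|]. field. lra.
  - assert (0 <= Rpower c alpha * / c * (alpha * (ln 2 - ln c)) * (m - s)); [|lra].
    apply Rmult_le_pos; [|lra]. apply Rmult_le_pos.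
    + apply Rmult_le_pos; [left; apply Rpower_pos | left; apply Rinv_0_lt_compat; lra].
    + apply Rmult_le_pos; [lra|]. assert (ln c < ln 2) by (apply ln_increasing; lra). lra.
Qed.

(** Monotonicity of the weight applies between s = 1 - |z|^2 and m = |1 - z^2|, as s <= m <= 2;
    replacing the modulus of the complex logarithmic factor by its real part only weakens the
    denominator. *)
Lemma Cmod_extremal_weighted (alpha : R) (z : C) : 0 < alpha < 1 -> Cmod z < 1 ->
  Rpower (1 - Cmod z ^ 2) alpha * log_factor alpha (1 - Cmod z ^ 2) * Cmod (extremal alpha z) <= 1.
Proof.
  intros Ha Hz. destruct (one_minus_sq_bounds z Hz) as (H1 & H2 & H3).
  pose proof (Cmod_ge_0 z). pose proof (extremal_denominator alpha z Ha Hz) as [H4 H5].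
  set (s := 1 - Cmod z ^ 2) in *. assert (Hs : 0 < s) by (unfold s; nra).
  rewrite log_factor_eq by exact Hs.
  set (m := Cmod (1 - z * z)) in *.
  pose proof (weight_increasing alpha s m Ha Hs H2 H3) as H6.
  unfold extremal. rewrite Cmod_inv, Cmod_mult, Cmod_cexp.
  2:{ apply Cmult_neq_0; [apply cexp_neq_0 | apply Cmod_gt_0; lra]. }
  replace (exp (fst (RtoC alpha * clog (1 - z * z))%C)) with (Rpower m alpha).
  2:{ unfold Rpower. f_equal. symmetry. apply re_scal_l. }
  pose proof (Rpower_pos m alpha).
  apply Rle_div_l; [apply Rmult_lt_0_compat; lra|]. rewrite Rmult_1_l.
  apply Rle_trans with (1 := H6). apply Rmult_le_compat_l; lra.
Qed.

Lemma extremal_real (alpha t : R) : 0 < alpha < 1 -> 0 <= t < 1 ->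
  extremal alpha (RtoC t) = RtoC (lower_integrand alpha t).
Proof.
  intros Ha Ht. assert (H1 : 0 < 1 - t ^ 2) by nra.
  pose proof (log_factor_ge_1 alpha (1 - t ^ 2) Ha ltac:(nra)) as H2.
  unfold extremal, lower_integrand. rewrite log_factor_eq in * by exact H1.
  pose proof (Rpower_pos (1 - t ^ 2) alpha).
  assert (E : clog (1 - RtoC t * RtoC t) = RtoC (ln (1 - t ^ 2))).
  { replace (1 - RtoC t * RtoC t)%C with (RtoC (1 - t ^ 2)) by (rewrite RtoC_minus, RtoC_pow; simpl; ring).
    unfold clog. rewrite Cmod_R, Rabs_pos_eq by lra. simpl snd. simpl fst. unfold Rdiv. rewrite Rmult_0_l, atan_0. reflexivity. }
  rewrite E, <- RtoC_mult, <- RtoC_minus.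
  replace (cexp (RtoC (alpha * ln (1 - t ^ 2)))) with (RtoC (Rpower (1 - t ^ 2) alpha)).
  - rewrite <- RtoC_mult, <- RtoC_inv.
    + f_equal. unfold Rdiv. ring.
    + apply Rmult_integral_contrapositive_currified; lra.
  - unfold cexp, Rpower, RtoC. simpl fst. simpl snd. rewrite cos_0, sin_0, Rmult_1_r, Rmult_0_r. reflexivity.
Qed.

(** * From pointwise bounds to norms *)

Lemma Lub_Rbar_le (E : R -> Prop) (M : Rbar) :
  Rbar_le (Lub_Rbar E) M <-> forall y, E y -> Rbar_le y M.
Proof.
  destruct (Lub_Rbar_correct E) as [Hub Hl]. split.
  - intros H y Hy. apply Rbar_le_trans with (2 := H). apply Hub, Hy.
  - intros H. apply Hl. exact H.
Qed.

Lemma korenblum_log_norm_le (alpha K : R) (f : C -> C) :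
  Rbar_le (korenblum_log_norm alpha f) K <-> korenblum_log_bound alpha K f.
Proof.
  unfold korenblum_log_norm. rewrite Lub_Rbar_le. split.
  - intros H z Hz. apply (H _ (ex_intro _ z (conj Hz eq_refl))).
  - intros H y (z & Hz & ->). apply H, Hz.
Qed.

Lemma in_space_log_bound (alpha : R) (f : C -> C) : 0 < alpha < 1 ->
  in_space (korenblum_log_norm alpha) f -> exists K, korenblum_log_bound alpha K f.
Proof.
  intros Ha [_ H]. destruct (korenblum_log_norm alpha f) as [K| |] eqn:E.
  - exists K. apply korenblum_log_norm_le. rewrite E. apply Rbar_le_refl.
  - destruct H.
  - exists 0. apply korenblum_log_norm_le. rewrite E. exact I.
Qed.

(** The coefficient series converge by summation by parts; their sums are bounded in n through the
    moments, so they define an analytic function. *)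
Lemma hilbert_image_exists (alpha K : R) (f : C -> C) : 0 < alpha < 1 ->
  analytic_disk f -> korenblum_log_bound alpha K f -> exists g, hilbert_image f g.
Proof.
  intros Ha Hf HK. pose proof (log_bound_korenblum alpha K f Ha HK) as HK'.
  assert (Hta : taylor_series_disk (taylor_coef f) f).
  { apply taylor_expansion; [exact Hf|]. apply (korenblum_bound_compact alpha K); [lra | exact HK']. }
  assert (Hb : forall n, exists b, is_series (K := C_AbsRing) (V := C_NormedModule)
    (fun k : nat => (taylor_coef f k / RtoC (INR (n + k + 1)))%C) b).
  { intros n. apply (hilbert_series_converge alpha K); assumption. }
  set (b := fun n => proj1_sig (constructive_indefinite_description _ (Hb n))).
  assert (Hbs : forall n, is_series (K := C_AbsRing) (V := C_NormedModule)
    (fun k : nat => (taylor_coef f k / RtoC (INR (n + k + 1)))%C) (b n)).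
  { intros n. exact (proj2_sig (constructive_indefinite_description _ (Hb n))). }
  assert (HB : forall n, Cmod (b n) <= K * norm_const alpha).
  { intros n. apply (hilbert_coef_bound alpha K _ f (taylor_coef f) (b n) n Ha Hf HK Hta (Hbs n)).
    intros x Hx. pose proof (weighted_hilbert_integral_bound alpha 0 x Ha ltac:(lra) Hx) as H.
    replace (1 - 0 ^ 2) with 1 in H by ring.
    unfold Rpower in H. rewrite ln_1, Rmult_0_r, exp_0, Rmult_1_l in H. exact H. }
  assert (Hg : forall z, exists l, Cmod z < 1 -> is_pseries (K := C_AbsRing) (V := C_NormedModule) b z l).
  (* Values outside the disk are irrelevant; 0 is put there so that [g] is total. *)
  { intros z. destruct (Rlt_dec (Cmod z) 1) as [Hz|Hz]; [|exists (RtoC 0); intros; lra].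
    pose proof (Cmod_ge_0 z).
    destruct (ex_series_le (K := C_AbsRing) (V := C_CompleteNormedModule)
      (fun k => scal (K := C_Ring) (V := C_NormedModule) (pow_n (K := C_Ring) z k) (b k))
      (fun k => (K * norm_const alpha) * Cmod z ^ k)) as [l Hl].
    - intros k. change (Cmod (pow_n (K := C_Ring) z k * b k) <= K * norm_const alpha * Cmod z ^ k).
      rewrite Cmod_mult, pow_n_Cpow, Cmod_pow, Rmult_comm.
      apply Rmult_le_compat_r; [apply pow_le; assumption | apply HB].
    - apply (ex_series_scal_l (K := R_AbsRing) (K * norm_const alpha) (fun k => Cmod z ^ k)).
      apply ex_series_geom. rewrite Rabs_pos_eq; assumption.
    - exists l. intros _. exact Hl. }
  set (g := fun z => proj1_sig (constructive_indefinite_description _ (Hg z))).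
  assert (Htb : taylor_series_disk b g).
  { intros z Hz. exact (proj2_sig (constructive_indefinite_description _ (Hg z)) Hz). }
  exists g, (taylor_coef f), b. repeat split; try assumption.
  apply (power_series_analytic b g _ HB Htb).
Qed.

Lemma int01_norm_integrand_spec (alpha r : R) : 0 < alpha < 1 -> 0 <= r < 1 ->
  ex_int01 (norm_integrand alpha r) /\
  (forall x, 0 <= x < 1 ->
     Rpower (1 - r ^ 2) alpha * RInt (hilbert_integrand alpha r) 0 x <= int01 (norm_integrand alpha r)) /\
  int01 (norm_integrand alpha r) <= norm_const alpha.
Proof.
  intros Ha Hr. apply int01_norm_integrand; [exact Ha | exact Hr|].
  intros x Hx. apply weighted_hilbert_integral_bound; assumption.
Qed.

Lemma korenblum_norm_image_le (alpha K : R) (f g : C -> C) (z : C) : 0 < alpha < 1 ->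
  analytic_disk f -> korenblum_log_bound alpha K f -> hilbert_image f g -> Cmod z < 1 ->
  Rpower (1 - Cmod z ^ 2) alpha * Cmod (g z) <= K * int01 (norm_integrand alpha (Cmod z)).
Proof.
  intros Ha Hf HK Hfg Hz. pose proof (Cmod_ge_0 z).
  destruct (int01_norm_integrand_spec alpha (Cmod z) Ha ltac:(lra)) as (_ & HJ & _).
  set (J := int01 (norm_integrand alpha (Cmod z))) in *.
  pose proof (Rpower_pos (1 - Cmod z ^ 2) alpha) as Hp. set (p := Rpower (1 - Cmod z ^ 2) alpha) in *.
  assert (H1 : Cmod (g z) <= K * (J / p)).
  { apply (hilbert_image_le alpha K (J / p) f g z Ha Hf HK Hfg Hz).
    intros x Hx. apply Rle_div_r; [exact Hp|]. rewrite Rmult_comm. apply HJ, Hx. }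
  apply Rle_trans with (p * (K * (J / p))); [apply Rmult_le_compat_l; lra|].
  right. field. lra.
Qed.

Lemma lower_integrand_norm_integrand (alpha t : R) : 0 < t < 1 ->
  norm_integrand alpha 0 t = lower_integrand alpha t.
Proof.
  intros Ht. unfold norm_integrand, lower_integrand.
  replace ((t - 1) * 0 + 1) with 1 by ring. replace (1 + 0) with 1 by ring.
  replace (t / (1 - (1 - t) * 0)) with t by (field; lra).
  replace (1 - t ^ 2) with ((1 - t) * (1 + t)) by ring.
  rewrite <- (Rpower_mult_distr (1 - t) (1 + t)) by lra.
  unfold Rpower at 1 2. rewrite ln_1, !Rmult_0_r, exp_0. f_equal. ring.
Qed.

(* The first three conjuncts say that the quantities compared in the last two
   exist: the operator is defined on the whole space, the integrals converge. *)
Theorem theorem3p1 (alpha : R) (alpha_gt0 : 0 < alpha) (alpha_lt1 : alpha < 1) :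
  maps_into hilbert_image (korenblum_log_norm alpha) (korenblum_norm alpha) /\
  (forall r : R, 0 <= r < 1 -> ex_int01 (norm_integrand alpha r)) /\
  ex_int01 (lower_integrand alpha) /\
  operator_norm hilbert_image (korenblum_log_norm alpha) (korenblum_norm alpha)
  = Lub_Rbar (fun y : R => exists r : R, 0 <= r < 1 /\
      y = int01 (norm_integrand alpha r)) /\
  Rbar_le (int01 (lower_integrand alpha))
    (operator_norm hilbert_image (korenblum_log_norm alpha) (korenblum_norm alpha)).
Proof.
  assert (Ha : 0 < alpha < 1) by (split; assumption).
  set (E := fun y : R => exists r : R, 0 <= r < 1 /\ y = int01 (norm_integrand alpha r)).
  assert (Hlow : ex_int01 (lower_integrand alpha) /\ int01 (lower_integrand alpha) = int01 (norm_integrand alpha 0)).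
  { destruct (int01_norm_integrand_spec alpha 0 Ha ltac:(lra)) as (Hex & _ & _).
    (* The two integrands need to agree only inside the interval of integration, hence for 0 < t <
       1. *)
    assert (Hev : filter_prod (at_point 0) (at_left 1) (fun ab : R * R =>
       forall x, Rmin (fst ab) (snd ab) < x < Rmax (fst ab) (snd ab) ->
         norm_integrand alpha 0 x = lower_integrand alpha x)).
    { apply (Filter_prod _ _ _ (fun a => a = 0) (fun b => 0 < b < 1)).
      - reflexivity.
      - exists (mkposreal 1 Rlt_0_1). intros b Hb Hb1. change (Rabs (b - 1) < 1) in Hb.
        apply Rabs_lt_between in Hb. lra.
      - intros a b -> Hb x. simpl fst. simpl snd. rewrite Rmin_left, Rmax_right by lra.
        intros Hx. apply lower_integrand_norm_integrand. lra. }
    split.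
    - apply (ex_RInt_gen_ext _ _ Hev Hex).
    - symmetry. apply (RInt_gen_ext (V := R_CompleteNormedModule) _ _ Hev Hex). }
  assert (Hnorm : operator_norm hilbert_image (korenblum_log_norm alpha) (korenblum_norm alpha) = Lub_Rbar E).
  { unfold operator_norm. apply Rbar_is_lub_unique. split.
    - intros y (f & g & [Hf _] & Hf1 & Hfg & ->).
      apply korenblum_log_norm_le in Hf1. apply Lub_Rbar_le. intros y (z & Hz & ->).
      pose proof (korenblum_norm_image_le alpha 1 f g z Ha Hf Hf1 Hfg Hz) as H. rewrite Rmult_1_l in H.
      apply Rbar_le_trans with (int01 (norm_integrand alpha (Cmod z))); [exact H|].
      apply (proj1 (Lub_Rbar_correct E)). exists (Cmod z). split; [split; [apply Cmod_ge_0 | exact Hz] | reflexivity].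
    (* One extremal function serves all r: the norm of its image is at least its weighted value at
       the real point r, which dominates the integral for that r. *)
    - intros M HM. apply Lub_Rbar_le. intros y (r & Hr & ->).
      pose proof (extremal_analytic alpha Ha) as Hf.
      assert (Hf1 : korenblum_log_bound alpha 1 (extremal alpha)) by (intros z Hz; apply Cmod_extremal_weighted; assumption).
      destruct (hilbert_image_exists alpha 1 (extremal alpha) Ha Hf Hf1) as [g Hg].
      apply korenblum_log_norm_le in Hf1.
      apply Rbar_le_trans with (korenblum_norm alpha g).
      + assert (Hz : Cmod (RtoC r) < 1) by (rewrite Cmod_R, Rabs_pos_eq; lra).
        apply Rbar_le_trans with (Rpower (1 - Cmod (RtoC r) ^ 2) alpha * Cmod (g (RtoC r))).
        (* The improper integral is bounded by the weighted value of the image because each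
           truncated integral is. *)
        * apply (int01_norm_integrand alpha r _ Ha Hr). intros x Hx.
          rewrite Cmod_R, Rabs_pos_eq by lra. apply Rmult_le_compat_l; [left; apply Rpower_pos|].
          apply (hilbert_image_ge alpha r x (extremal alpha) g Ha Hf); try assumption.
          intros t Ht. apply extremal_real; assumption.
        * apply (proj1 (Lub_Rbar_correct _)). exists (RtoC r). split; [exact Hz | reflexivity].
      + apply HM. exists (extremal alpha), g. split; [|split; [exact Hf1 | split; [exact Hg | reflexivity]]].
        split; [exact Hf|]. apply Rbar_le_lt_trans with (1 := Hf1). exact I. }
  split; [|split; [|split; [|split]]].
  - intros f Hf. destruct (in_space_log_bound alpha f Ha Hf) as [K HK]. destruct Hf as [Hf _].
    destruct (hilbert_image_exists alpha K f Ha Hf HK) as [g Hg]. exists g. split; [exact Hg|].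
    split; [destruct Hg as (a & b & _ & _ & _ & H); exact H|].
    apply Rbar_le_lt_trans with (K * norm_const alpha); [|exact I].
    apply Lub_Rbar_le. intros y (z & Hz & ->).
    apply Rle_trans with (1 := korenblum_norm_image_le alpha K f g z Ha Hf HK Hg Hz).
    apply Rmult_le_compat_l; [apply (log_bound_nonneg alpha K f Ha HK)|].
    apply (int01_norm_integrand_spec alpha (Cmod z) Ha). split; [apply Cmod_ge_0 | exact Hz].
  - intros r Hr. apply (int01_norm_integrand_spec alpha r Ha Hr).
  - apply Hlow.
  - exact Hnorm.
  - rewrite Hnorm, (proj2 Hlow). apply (proj1 (Lub_Rbar_correct E)). exists 0. split; [lra | reflexivity].
Qed.
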